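(* Let $\theta\in[-1,1)$, $a>-1$, let $t=t(\theta,a)$ be as given in the regions below, and let $y\in[-t,1]$ (with $y\neq\frac1\theta$ in case $t=-\frac1\theta$). Then the limiting process $M'$ given by $$\lim_{n\to\infty}\mathbb P_y\big((M_k)_{1\le k\le m}\in\cdot\,\big|\,\Omega_n\big)=\mathbb P_y\big((M'_k)_{1\le k\le m}\in\cdot\,\big),\qquad m\in\mathbb N,$$ exists and is a time-homogeneous Markov chain on $[-t,1]$ with (reduced) transition kernel $$p'(x_1,\mathrm dx_2)=\mathbf 1_S(x_2,x_1)\frac{h(x_2)}{h(x_1)}\frac1\lambda\frac1{a+1}\,\mathrm dx_2,\qquad x_1,x_2\in[-t,1],$$ where $\lambda$ is the persistence exponent, i.e. $\log\lambda=\lim_{n\to\infty}\frac1n\log p_n^a(\theta)$, and $h:\mathbb R\to\mathbb R$ has the following form: $h(x)=0$ if $\theta x\ge1$; $h(x)$ is positive and region dependent, as given below, if $-t\le\theta x<1$; $h(x)=h\left(\frac{-t}{\theta}\right)$ if $\theta x<-t$. The regions are: (B) Let either $\theta\in(0,1)$ and $a\ge0$, or $\theta\in[-1,0)$ and $a\in[-\theta,\frac{-1}\theta]$. Then $t=a$, $\lambda$ is the inverse of the zero with the smallest absolute value of the function $z\mapsto E\left(\theta,\frac{-z}{a+1}\right)$, and $$h(x)=E\left(\theta,\frac{-\theta x}{\lambda(a+1)}\right),\qquad -a\le\theta x<1.$$ (G) Let $\theta\in[-1,0)$ and $a\ge\frac{-1}\theta$. Then $t=-\frac1\theta$, $\lambda$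 is the inverse of the zero with the smallest absolute value of the function $z\mapsto E\left(\theta,\frac{-z}{a+1}\right)$, and $$h(x)=E\left(\theta,\frac{-\theta x}{\lambda(a+1)}\right),\qquad \tfrac1\theta\le\theta x<1.$$ (Y) Let $\theta\in[-1,0)$ and $a\in(0,-\theta)$. Then $t=a$, $\lambda$ is the inverse of the solution $z$ with the smallest absolute value of the equation $\frac{E\left(\theta,\frac{za}{\theta(a+1)}\right)}{E\left(\theta,\frac{za}{a+1}\right)}=z\cdot\frac{\theta+a}{\theta(a+1)}$, and $$h(x)=\begin{cases}E\left(\theta,\frac{-\theta x}{\lambda(a+1)}\right),&-a\le\theta x\le\frac{-a}\theta,\\[1mm] \frac{1-\theta x}{\lambda(a+1)}\,E\left(\theta,\frac a{\lambda(a+1)}\right),&\frac{-a}\theta<\theta x<1.\end{cases}$$ (O) Let $\theta\in(0,1)$ and $a\in[-\theta,0)$. Then $t=a$, $\lambda$ is the inverse of the zero with the smallest absolute value of the function $u$ defined below, and $$h(x)=\begin{cases}\sum_{i=0}^{m+1}c_i(\theta,\lambda,a,m+1)\,x^i,&\theta x\in\left[\frac{-a}{\theta^m},\frac{-a}{\theta^{m+1}}\right),\ 0\le m\le p-1,\\[1mm] \frac1{\lambda(a+1)}\sum_{i=0}^pc_i(\theta,\lambda,a,p)\frac1{i+1}\left(1-(\theta x)^{i+1}\right),&\theta x\in\left[\frac{-a}{\theta^p},1\right),\end{cases}$$ where $p=p(\theta,a):=\max\{n\in\mathbb N_0:\theta^n\ge-a\}$, $u(z):=1-z\sum_{i=0}^p\frac{(\theta^i+a)^{i+1}}{(i+1)!\,\theta^{i(i+1)/2}(a+1)^{i+1}}(-z)^i$,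 $$c_i(\theta,\lambda,a,m)=\frac{-1}{u'\left(\frac1\lambda\right)}\left(\frac{-1}{\lambda(a+1)}\right)^i\frac{\theta^{i(i+1)/2}}{i!}\sum_{\ell=0}^{m-i}\ \sum_{\substack{i_1,\dots,i_\ell\ge0\\ i_1+\dots+i_\ell=m-i-\ell}}\ \prod_{r=1}^\ell s\Big(m-i-(r-1)-\sum_{j=1}^{r-1}i_j,\ i_r\Big),$$ with the convention that the $\ell=0$ term of the outer sum equals $1$ if $i=m$ and $0$ if $i<m$, and $$s(k,i):=\theta^{\frac{i(i+1)}2-ki}\left(\frac a{\lambda(a+1)}\right)^{i+1}\frac1{(i+1)!}\left(\frac{\lambda(a+1)(i+1)}a-\theta^{i+1-k}\right).$$ (W) Let $\theta\in[-1,1)$ and $-1<a\le\min(-\theta,0)$. Then $t=a$ and $h(x)=\lambda=1$ (that is, $\lambda=1$, and $h(x)=1$ whenever $\theta x<1$). (T) Let $\theta=0$ and $a\ge0$. Then $t=0$, $h(x)=1$ and $\lambda=\frac1{a+1}$.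
   Context: Let $(X_i)_{i\ge1}$ be i.i.d. random variables uniformly distributed on $[-a,1]$. Set $M_0:=(X_1,0)$ and $M_i:=(X_{i+1},X_i)$ for $i\ge1$; $S:=\{(x_2,x_1)\in[-a,1]^2 : x_2>\theta x_1\}$; $\Omega_n:=\bigcap_{i=1}^n\{M_i\in S\}$; $\mathbb P_y(\cdot):=\mathbb P(\cdot\mid X_1=y)$; and $p_n^a(\theta):=\mathbb P(X_2\ge\theta X_1,\dots,X_{n+1}\ge\theta X_n)=\mathbb P(\Omega_n)$ for $n\ge1$. That $M'$ is a Markov chain with reduced transition kernel $p'$ means that $M'_k=(Y_{k+1},Y_k)$ for $k\ge1$, where $(Y_k)_{k\ge1}$ is the time-homogeneous Markov chain with $Y_1=y$ and transition kernel $p'$. When $-t=\frac1\theta$ (region (G), and region (B) with $a=-\frac1\theta$), the state space $[-t,1]$ is to be read as $(\frac1\theta,1]$. The deformed exponential function is $E(r,z):=\sum_{n=0}^\infty\frac{r^{n(n-1)/2}}{n!}z^n$ for $r,z\in\mathbb C$ with $|r|\le1$. *)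

(* Defs.v *)
From HB Require Import structures.
From mathcomp Require Import all_boot all_order all_algebra.
From mathcomp Require Import complex.
From mathcomp Require Import all_classical all_reals all_analysis.
From mathcomp Require Import measurable_realfun.

Set Implicit Arguments.
Unset Strict Implicit.
Unset Printing Implicit Defensive.

Import Order.TTheory GRing.Theory Num.Theory.
Import numFieldNormedType.Exports.

Local Open Scope classical_set_scope.
Local Open Scope complex_scope.
Local Open Scope ring_scope.

(* E(r, z) = sum_n r^(n(n-1)/2) / n! z^n.  The definition is generic so that it
   covers both complex arguments (zeros) and real ones (the function h). *)
Definition deformed_exp (K : numFieldType) (r z : K) : K :=
  limn (series (fun n : nat => r ^+ 'C(n, 2) / (n`!)%:R * z ^+ n)).

Definition cdeformed_exp (R : realType) (r : R) (z : R[i]) : R[i] :=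
  @deformed_exp (R[i] : numFieldType) r%:C z.

(* z is the (unique) element of A with the smallest absolute value. *)
Definition smallest_abs (R : realType) (A : set R[i]) (z : R[i]) : Prop :=
  A z /\ forall w, A w -> w <> z -> `|z| < `|w|.

Section random_variables.
Context d (T : measurableType d) (R : realType) (P : probability T R).
Implicit Type X : nat -> {RV P >-> R}.

Definition mutually_independent (D : set nat) X : Prop :=
  forall (s : seq nat) (B : nat -> set R),
    uniq s -> (forall i, i \in s -> D i) -> (forall i, measurable (B i)) ->
    P (\bigcap_(i in [set` s]) (X i @^-1` B i)) =
    (\prod_(i <- s) P (X i @^-1` B i))%E.

Definition uniform_law (Z : {RV P >-> R}) (l u : R) (lu : l < u) : Prop :=
  forall B : set R, measurable B -> distribution P Z B = uniform_prob lu B.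

(* Sequences are indexed from 1 on; the value at index 0 is never used. *)
Definition iid_uniform X (l u : R) (lu : l < u) : Prop :=
  mutually_independent [set i | (0 < i)%N] X /\
  forall i, (0 < i)%N -> uniform_law (X i) lu.

End random_variables.

Fact ltrN1_ltNr1 (R : realType) (a : R) : -1 < a -> - a < 1.
Proof. by rewrite ltrNl. Qed.

Definition lag_pair (R : realType) (x : nat -> R) (i : nat) : R * R :=
  (x i.+1, if i is 0%N then 0 else x i).

(* Pairs are ordered as in the chain: the current value x2 first, then x1. *)
Definition S_set (R : realType) (theta a : R) : set (R * R) :=
  [set u | [/\ - a <= u.1 <= 1, - a <= u.2 <= 1 & theta * u.2 < u.1]].

Definition Omega (R : realType) (theta a : R) (n : nat) : set (nat -> R) :=
  [set x | forall i, (1 <= i <= n)%N -> S_set theta a (lag_pair x i)].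

Definition start_at (R : realType) (y : R) (x : nat -> R) (i : nat) : R :=
  if i == 1%N then y else x i.

Section conditioned_process.
Context d (T : measurableType d) (R : realType) (P : probability T R).
Variable X : nat -> {RV P >-> R}.

Definition persistence_prob (theta : R) (n : nat) : R :=
  fine (P [set w | forall i, (1 <= i <= n)%N -> theta * X i w <= X i.+1 w]).

Definition persistence_exponent (theta lambda : R) : Prop :=
  0 < lambda /\
  (fun n : nat => n%:R^-1 * ln (persistence_prob theta n)) @ \oo --> ln lambda.

(* P(. | X_1 = y) conditions on a null event.  As X_1 is independent of
   (X_i)_(i >= 2), the law of (y, X_2, X_3, ...) is the canonical version,
   defined for every y. *)
Definition prob_start (y : R) (A : set (nat -> R)) : R :=
  fine (P [set w | A (start_at y (fun i => X i w))]).

Definition cond_prob_start (y : R) (A C : set (nat -> R)) : R :=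
  prob_start y (A `&` C) / prob_start y C.

End conditioned_process.

(* The interval [-t, 1], read as ]1/theta, 1] when -t = 1/theta. *)
Definition state_space (R : realType) (theta t : R) : set R :=
  [set x | - t <= x <= 1 /\ (theta != 0 -> - t = theta^-1 -> x <> - t)].

Definition reduced_kernel (R : realType) (theta a t lambda : R) (h : R -> R)
    (x1 : R) (B : set R) : \bar R :=
  (\int[lebesgue_measure]_(x2 in B `&` state_space theta t)
    (\1_(S_set theta a) (x2, x1) * (h x2 / h x1) * (1 / lambda) *
     (1 / (a + 1)))%:E)%E.

Definition transition_kernel (R : realType) (E : set R)
    (K : R -> set R -> \bar R) : Prop :=
  (forall x, E x -> exists2 mu : probability R R,
     forall B, measurable B -> K x B = mu B & mu E = 1%E) /\
  (forall B : set R, measurable B ->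
     measurable_fun E (fun x => K x B)).

(* Y_1, Y_2, ... is a time-homogeneous Markov chain in E with Y_1 = y: the last
   clause says P(Y_(k+1) \in B | Y_1, ..., Y_k) = K(Y_k, B) almost surely. *)
Definition markov_chain d (T : measurableType d) (R : realType)
    (P : probability T R) (E : set R) (K : R -> set R -> \bar R) (y : R)
    (Y : nat -> {RV P >-> R}) : Prop :=
  [/\ transition_kernel E K,
      P [set w | Y 1%N w = y] = 1%E,
      forall k, (0 < k)%N -> P [set w | E (Y k w)] = 1%E &
      forall k (A : set (k.-tuple R)) (B : set R), (0 < k)%N ->
        measurable A -> measurable B ->
        let past := [set w | A [tuple Y i.+1 w | i < k]] in
        P (past `&` [set w | B (Y k.+1 w)]) =
        (\int[P]_(w in past) K (Y k w) B)%E].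

Inductive region := RegB | RegG | RegY | RegO | RegW | RegT.

Section regions.
Variable R : realType.
Implicit Types (theta a t lambda : R) (h : R -> R) (r : region).

Definition in_region r theta a : Prop :=
  match r with
  | RegB => (0 < theta < 1 /\ 0 <= a) \/
            (-1 <= theta < 0 /\ - theta <= a <= -1 / theta)
  | RegG => -1 <= theta < 0 /\ -1 / theta <= a
  | RegY => -1 <= theta < 0 /\ 0 < a < - theta
  | RegO => 0 < theta < 1 /\ - theta <= a < 0
  | RegW => -1 <= theta < 1 /\ -1 < a <= Num.min (- theta) 0
  | RegT => theta = 0 /\ 0 <= a
  end.

Definition region_t r theta a : R :=
  match r with
  | RegB | RegY | RegO | RegW => a
  | RegG => -1 / theta
  | RegT => 0
  end.

(* max {n | theta^n >= -a} *)
Definition O_p theta a : nat :=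
  xget 0%N [set n | - a <= theta ^+ n /\
                    forall m : nat, - a <= theta ^+ m -> (m <= n)%N].

Definition O_u theta a : {poly R} :=
  1 - 'X * \sum_(i < (O_p theta a).+1)
    ((theta ^+ i + a) ^+ i.+1 /
     ((i.+1)`!%:R * theta ^+ 'C(i.+1, 2) * (a + 1) ^+ i.+1))%:P * (- 'X) ^+ i.

Definition O_s theta lambda a (k i : nat) : R :=
  theta ^ ('C(i.+1, 2)%:Z - (k * i)%:Z) *
  (a / (lambda * (a + 1))) ^+ i.+1 * (1 / (i.+1)`!%:R) *
  (lambda * (a + 1) * i.+1%:R / a - theta ^ (i.+1%:Z - k%:Z)).

(* The tuple (i_1, ..., i_l) is f : 'I_l -> 'I_m.+1, with i_r = f (r - 1); the
   bound on its values is implied by the sum condition, under which the first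
   argument of O_s is a genuine (non-truncated) difference. *)
Definition O_c theta lambda a (m i : nat) : R :=
  -1 / (O_u theta a)^`().[1 / lambda] * (-1 / (lambda * (a + 1))) ^+ i *
  (theta ^+ 'C(i.+1, 2) / i`!%:R) *
  \sum_(l < (m - i).+1)
    \sum_(f : {ffun 'I_l -> 'I_m.+1} | (\sum_j f j + l + i == m)%N)
      \prod_(r < l)
        O_s theta lambda a (m - i - r - \sum_(j < l | (j < r)%N) f j)%N (f r).

Definition lambda_spec r theta a lambda : Prop :=
  match r with
  | RegB | RegG =>
      smallest_abs [set z | cdeformed_exp theta (- z / (a + 1)%:C) = 0]
        (lambda^-1)%:C
  | RegY =>
      smallest_abs
        [set z | cdeformed_exp theta (z * a%:C / (a + 1)%:C) <> 0 /\
                 cdeformed_exp theta (z * a%:C / (theta * (a + 1))%:C) /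
                 cdeformed_exp theta (z * a%:C / (a + 1)%:C) =
                 z * ((theta + a) / (theta * (a + 1)))%:C]
        (lambda^-1)%:C
  | RegO =>
      smallest_abs [set z | (map_poly (real_complex R) (O_u theta a)).[z] = 0]
        (lambda^-1)%:C
  | RegW => lambda = 1
  | RegT => lambda = 1 / (a + 1)
  end.

Definition h_formula r theta a lambda h : Prop :=
  match r with
  | RegB | RegG =>
      forall x, - region_t r theta a <= theta * x < 1 ->
        h x = deformed_exp theta (- theta * x / (lambda * (a + 1)))
  | RegY =>
      (forall x, - a <= theta * x <= - a / theta ->
        h x = deformed_exp theta (- theta * x / (lambda * (a + 1)))) /\
      (forall x, - a / theta < theta * x < 1 ->
        h x = (1 - theta * x) / (lambda * (a + 1)) *
              deformed_exp theta (a / (lambda * (a + 1))))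
  | RegO =>
      let p := O_p theta a in
      (forall (m : nat) x, (m < p)%N ->
        - a / theta ^+ m <= theta * x < - a / theta ^+ m.+1 ->
        h x = \sum_(i < m.+2) O_c theta lambda a m.+1 i * x ^+ i) /\
      (forall x, - a / theta ^+ p <= theta * x < 1 ->
        h x = 1 / (lambda * (a + 1)) *
              \sum_(i < p.+1) O_c theta lambda a p i * (1 / i.+1%:R) *
                              (1 - (theta * x) ^+ i.+1))
  | RegW => forall x, theta * x < 1 -> h x = 1
  | RegT => forall x, theta * x < 1 -> h x = 1
  end.

Definition h_spec r theta a lambda h : Prop :=
  let t := region_t r theta a in
  [/\ forall x, 1 <= theta * x -> h x = 0,
      forall x, - t <= theta * x < 1 -> 0 < h x,
      forall x, theta * x < - t -> h x = h (- t / theta) &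
      h_formula r theta a lambda h].

End regions.

(* Main.v *)
From HB Require Import structures.
Require Import Defs.
From mathcomp Require Import all_boot all_order all_algebra.
From mathcomp Require Import complex zify ring lra.
From mathcomp Require Import all_classical all_reals all_analysis.
From mathcomp Require Import measurable_realfun.

Import Order.TTheory GRing.Theory Num.Theory.
Import numFieldNormedType.Exports.

Local Open Scope classical_set_scope.
Local Open Scope ring_scope.

(** Conditioned on [X 1 = x], a step of the walk survives when the next value
    exceeds [theta * x]. Averaging over that value gives the positive operator
    [(transfer theta a f) x], the integral of [f] over the part of the segment
    beyond [theta * x], divided by [a + 1]; its [n]-th iterate on the constant 1
    is the probability of surviving [n] steps.

    Suppose that [h >= 0] is continuous, not zero near 1, and an eigenfunction
    of the operator for [lam > 0]. Two steps of the walk have a part that does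
    not depend on the starting point, up to a factor comparable with [h]
    ([transfer2_lower]). Hence the ratio of [T^n f / lam^n] to [h] is squeezed to
    a constant, geometrically fast and uniformly, even where [h] vanishes
    ([transfer_converges]). For [f = 1] the constant is positive, so survival
    probabilities are of the order of [lam^n] and [lam] is the persistence
    exponent ([persistence_exponentP]). The law of the first [m] steps given
    survival up to [n] has density proportional to the probability of surviving
    the other [n - m] steps; in the limit this becomes [h], which is the
    Doob transform in the statement ([history_law], [conditioned_limit]). The
    limiting chain is built on the given probability space, a step being the
    image of the next [X k] under a quantile function ([sampler_integral]).

    It remains to find [lam] and [h]. In each of the regions B, G, Y and O there
    is an explicit function [g_z], analytic in [z], with [g_z = u(z) + z T g_z]
    for a constant [u(z)] ([family]): the deformed exponential, its affine
    continuation beyond a point, or a sum of powers of positive parts. Starting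
    from [g_0 = 1], let [z] grow to the first [z0] where positivity of [g_z] or
    of [u] fails. Positivity of the operator forces [u(z0) = 0] and keeps
    [g_z0 >= 0] ([first_zero]), so [g_z0] is the eigenfunction wanted and
    [lam = 1 / z0]. If [w] is another complex zero of [u], then [g_w] is an
    eigenfunction as well, [T^n g_w = w^-n g_w]; as [T^n g_w / lam^n] converges
    to a multiple of [g_z0], either [w = z0] or [|w| > z0] ([root_modulus]). So
    [z0] is the zero of smallest absolute value. In region O one also needs the
    sign of [u'(z0)], which follows by applying to [g_z = u(z) + z T g_z] the
    functional that extracts the limit constant ([root_simple]), and the
    expansion of the nested sums for the coefficients, which satisfy a
    telescoping recursion ([O_c_poly]). In the regions W and T the function
    [h = 1] is an eigenfunction by inspection. *)

Set Implicit Arguments.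
Unset Strict Implicit.
Unset Printing Implicit Defensive.

(** * Integrals of continuous functions over segments *)

Section Integral.
Variable R : realType.
Implicit Types (f g : R -> R) (a b c s : R).

Definition integ f a b : R := \int[lebesgue_measure]_(y in `[a, b]) f y.

Lemma integ_integrable f a b : continuous f ->
  (@lebesgue_measure R).-integrable `[a, b] (EFin \o f).
Proof.
move=> cf; apply: continuous_compact_integrable; first exact: segment_compact.
exact: continuous_subspaceT.
Qed.

Lemma integD f g a b : continuous f -> continuous g ->
  integ (fun x => f x + g x) a b = integ f a b + integ g a b.
Proof. by move=> cf cg; apply: RintegralD => //; exact: integ_integrable. Qed.

Lemma integZ k f a b : continuous f ->
  integ (fun x => k * f x) a b = k * integ f a b.
Proof. by move=> cf; apply: RintegralZl => //; exact: integ_integrable. Qed.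

Lemma integB f g a b : continuous f -> continuous g ->
  integ (fun x => f x - g x) a b = integ f a b - integ g a b.
Proof. by move=> cf cg; apply: RintegralB => //; exact: integ_integrable. Qed.

Lemma eq_integ f g a b : (forall x, a <= x <= b -> f x = g x) ->
  integ f a b = integ g a b.
Proof.
by move=> fg; apply: eq_Rintegral => x; rewrite inE /= in_itv /=; exact: fg.
Qed.

Lemma integ_ge0 f a b : (forall x, a <= x <= b -> 0 <= f x) -> 0 <= integ f a b.
Proof. by move=> f0; apply: Rintegral_ge0 => x /=; rewrite in_itv /=; exact: f0. Qed.

Lemma integ_cst k a b : a <= b -> integ (fun=> k) a b = k * (b - a).
Proof.
move=> ab; rewrite /integ Rintegral_cst //= lebesgue_measure_itv /= lte_fin.
by move: ab; rewrite le_eqVlt => /predU1P[->|->//]; rewrite ltxx subrr.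
Qed.

Lemma integ_split f a c b : continuous f -> a <= c -> c <= b ->
  integ f a b = integ f a c + integ f c b.
Proof.
move=> cf ac cb; apply/eqP; rewrite addrC -subr_eq; apply/eqP.
rewrite /integ Rintegral_itvB ?bnd_simp//; last exact: integ_integrable.
rewrite Rintegral_itv_obnd_cbnd //.
by apply: integrableS (integ_integrable c b cf) => //; exact: subset_itv_oc_cc.
Qed.

Lemma integ_empty f a b : b <= a -> integ f a b = 0.
Proof.
rewrite le_eqVlt => /predU1P[->|ba]; first by rewrite /integ set_itv1 Rintegral_set1.
by rewrite /integ set_itv_ge ?Rintegral_set0 // bnd_simp -ltNge.
Qed.

Lemma le_integ f g a b : continuous f -> continuous g ->
  (forall x, a <= x <= b -> f x <= g x) -> integ f a b <= integ g a b.
Proof.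
move=> cf cg fg; apply: le_Rintegral;
  [by []|exact: integ_integrable|exact: integ_integrable|].
by move=> x /=; rewrite in_itv /=; exact: fg.
Qed.

Lemma integ_le_cst f k a b : continuous f -> a <= b ->
  (forall x, a <= x <= b -> f x <= k) -> integ f a b <= k * (b - a).
Proof.
move=> cf ab fk; rewrite -integ_cst //; apply: le_integ => //; exact: cst_continuous.
Qed.

Lemma integ_ge_cst f k a b : continuous f -> a <= b ->
  (forall x, a <= x <= b -> k <= f x) -> k * (b - a) <= integ f a b.
Proof.
move=> cf ab fk; rewrite -integ_cst //; apply: le_integ => //; exact: cst_continuous.
Qed.

(** Shrinking the interval decreases the integral of a nonnegative function. *)
Lemma integ_shrink f a b s : continuous f -> a <= s ->
  (forall x, a <= x <= b -> 0 <= f x) -> integ f s b <= integ f a b.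
Proof.
move=> cf as_ f0; have [sb|/ltW bs] := leP s b; last first.
  by rewrite (integ_empty _ bs); exact: integ_ge0.
rewrite (integ_split cf as_ sb) lerDr integ_ge0 // => x /andP[ax xs].
by rewrite f0 // ax (le_trans xs).
Qed.

Lemma bounded_on_segment f a b : continuous f ->
  exists2 M, 0 < M & forall x, a <= x <= b -> `|f x| <= M.
Proof.
move=> cf; have [ab|ab] := leP a b; last first.
  by exists 1 => // x /andP[ax /(le_trans ax)]; rewrite leNgt ab.
have cnf : continuous (fun x => `|f x|).
  by move=> x; apply: continuous_comp; [exact: cf|exact: norm_continuous].
have [c cab fc] := EVT_max ab (continuous_subspaceT cnf).
exists (`|f c| + 1); first by rewrite ltr_wpDl.
by move=> x xab; rewrite (le_trans (fc x _)) ?in_itv //= lerDl.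
Qed.

Lemma lipschitz_continuous_real f k :
  (forall x y, `|f x - f y| <= k * `|x - y|) -> continuous f.
Proof.
move=> fk x; apply/cvgrPdist_le => e e0.
have k1 : 0 < `|k| + 1 by rewrite ltr_wpDl.
exists (e / (`|k| + 1)) => /=; first by rewrite divr_gt0.
move=> y /= /ltW; rewrite ler_pdivlMr // => xy; apply: le_trans xy.
rewrite mulrC (le_trans (fk _ _)) // ler_wpM2r //.
by rewrite (le_trans (ler_norm k)) // lerDl.
Qed.

Lemma cvg_of_bound (u e : nat -> R) (l k : R) : e @ \oo --> 0 ->
  (forall n, `|u n - l| <= e n * k) -> u @ \oo --> l.
Proof.
move=> e0 ue; have ek : (fun n => e n * k) @ \oo --> 0 * k.
  by apply: cvgM => //; exact: cvg_cst.
apply/cvgrPdist_le => eps eps0; move: ek; rewrite mul0r => /cvgrPdist_le/(_ _ eps0).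
apply: filterS => n; rewrite sub0r normrN distrC => h.
exact: le_trans (ue n) (le_trans (ler_norm _) h).
Qed.

(** Continuity lets an integral of a nonnegative function vanish only when the
    function does. *)
Lemma integ_gt0 f a b c : continuous f -> a < b ->
  (forall x, a <= x <= b -> 0 <= f x) -> a <= c <= b -> 0 < f c ->
  0 < integ f a b.
Proof.
move=> cf ab f0 /andP[ac cb] fc.
have fc2 : 0 < f c / 2 by rewrite divr_gt0.
have /cvgrPdist_le /(_ _ fc2) [e /= e0 he] := cf c.
pose l := Num.max a (c - e / 2); pose r := Num.min b (c + e / 2).
have e2 : 0 < e / 2 by rewrite divr_gt0.
have al : a <= l by rewrite le_max lexx.
have rb : r <= b by rewrite ge_min lexx.
have lr : l < r.
  rewrite gt_max !lt_min ab /=; apply/andP; split.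
    by rewrite (le_lt_trans ac) // ltrDl.
  apply/andP; split; first by rewrite (lt_le_trans _ cb) // gtrBl.
  by rewrite (@lt_trans _ _ c) // ?gtrBl // ltrDl.
rewrite (integ_split cf al) ?(le_trans (ltW lr)) // (integ_split cf (ltW lr) rb).
rewrite ltr_wpDl ?integ_ge0 // => [x /andP[ax xl]|].
  by rewrite f0 // ax (le_trans xl) // (le_trans (ltW lr)).
rewrite ltr_wpDr ?integ_ge0 // => [x /andP[rx xb]|].
  by rewrite f0 // xb andbT (le_trans al) // (le_trans (ltW lr)).
apply: lt_le_trans (integ_ge_cst cf (ltW lr) (k := f c / 2) _).
  by rewrite mulr_gt0 // subr_gt0.
move=> x; rewrite ge_max le_min => /andP[/andP[_ cx] /andP[_ xc]].
have /he : ball c e x.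
  rewrite /ball /= ltr_distl; apply/andP; split; last by lra.
  by lra.
rewrite ler_distl => /andP[_]; lra.
Qed.

Lemma integ_FTC f (F : R -> R) a b : a <= b -> continuous f ->
  (forall x : R, is_derive x (1 : R) F (f x)) -> integ f a b = F b - F a.
Proof.
move=> ab cf dF.
have cF : continuous F.
  by move=> x; apply/differentiable_continuous/derivable1_diffP.
move: ab; rewrite le_eqVlt => /predU1P[->|ab]; first by rewrite integ_empty // subrr.
rewrite /integ /Rintegral (@continuous_FTC2 _ f F a b ab) //.
- exact: continuous_subspaceT.
- split.
  + by move=> x _.
  + by apply: cvg_at_right_filter; exact: cF.
  + by apply: cvg_at_left_filter; exact: cF.
- by move=> x _; rewrite derive1E derive_val.
Qed.

End Integral.

(** * The transfer operator of the killed walk *)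

Ltac minmax_lra := repeat match goal with
  | H : context [Num.max _ _] |- _ => move: H
  | H : context [Num.min _ _] |- _ => move: H
  | |- context [Num.max ?x ?y] => case: (leP x y) => ?
  | |- context [Num.min ?x ?y] => case: (leP x y) => ?
  end; intros; lra.

Section Operator.
Variable R : realType.
Implicit Types (f g : R -> R) (t s x y : R).

(** The next value survives a jump from [x] exactly when it lies above
    [clamp a (theta * x)], so that integrals over the survival region become
    integrals over a segment. *)
Definition clamp t s : R := Num.min 1 (Num.max s (- t)).

Lemma clamp_bounds t s : -1 < t -> - t <= clamp t s <= 1.
Proof.
move=> t1; rewrite /clamp le_min ge_min lexx /= le_max lexx orbT andbT /=.
lra.
Qed.

Lemma clamp_id t s : - t <= s <= 1 -> clamp t s = s.
Proof. by move=> /andP[ts s1]; rewrite /clamp max_l // min_r. Qed.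

Lemma clamp_low t s : -1 < t -> s <= - t -> clamp t s = - t.
Proof. by move=> t1 st; rewrite /clamp max_r // min_r //; lra. Qed.

Lemma clamp_high t s : 1 <= s -> clamp t s = 1.
Proof. by move=> s1; rewrite /clamp min_l // le_max s1. Qed.

Lemma clamp_lip t s y : `|clamp t s - clamp t y| <= `|s - y|.
Proof.
wlog sy : s y / s <= y => [hw|].
  by have [/hw //|/ltW/hw] := leP s y; rewrite distrC (distrC y).
rewrite (distrC s) (ger0_norm (_ : 0 <= y - s)) ?subr_ge0 //.
by rewrite ler_norml /clamp; apply/andP; split; minmax_lra.
Qed.

Variables theta a : R.
Hypothesis theta_range : -1 <= theta < 1.
Hypothesis a_gtN1 : -1 < a.

(** The expectation of [f] after one step from [x], killed on leaving [S]. *)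
Definition transfer f x : R := (a + 1)^-1 * integ f (clamp a (theta * x)) 1.

Local Notation T := transfer.

Let a1_gt0 : 0 < a + 1. Proof. by have := a_gtN1; lra. Qed.
Let ia_gt0 : 0 < (a + 1)^-1. Proof. by rewrite invr_gt0. Qed.
Let clb s : - a <= clamp a s <= 1. Proof. exact: clamp_bounds. Qed.
Hint Resolve a1_gt0 ia_gt0 clb : core.

Lemma transfer_continuous f : continuous f -> continuous (T f).
Proof.
move=> cf; have [M M0 fM] := bounded_on_segment (- a) 1 cf.
apply: (@lipschitz_continuous_real _ _ ((a + 1)^-1 * (M * `|theta|))) => x y.
rewrite -mulrBr normrM gtr0_norm // -!mulrA ler_pM2l // -normrM mulrBr.
apply: le_trans (_ : M * `|clamp a (theta * x) - clamp a (theta * y)| <= _); last first.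
  by rewrite ler_pM2l // clamp_lip.
move: (clb (theta * x)) (clb (theta * y)).
move: (clamp a _) (clamp a _) => s s'.
wlog ss : s s' / s <= s' => [hw|] hs hs'.
  have [ss|/ltW ss] := leP s s'; first exact: hw.
  by rewrite distrC [X in _ <= _ * X]distrC; exact: hw.
have [/andP[s0' s1'] /andP[s0 s1]] := (hs, hs').
rewrite (integ_split cf ss s1') distrC addrK (ger0_norm (_ : 0 <= s' - s)) ?subr_ge0 //.
have H z : s <= z <= s' -> `|f z| <= M.
  by move=> /andP[z1 z2]; apply: fM; rewrite (le_trans s0) // (le_trans z2).
rewrite ler_norml -mulNr integ_ge_cst ?integ_le_cst // => z /H;
  by rewrite ler_norml => /andP[].
Qed.

Lemma transferD f g x : continuous f -> continuous g ->
  T (fun x => f x + g x) x = T f x + T g x.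
Proof. by move=> cf cg; rewrite /T integD // mulrDr. Qed.

Lemma transferB f g x : continuous f -> continuous g ->
  T (fun x => f x - g x) x = T f x - T g x.
Proof. by move=> cf cg; rewrite /T integB // mulrBr. Qed.

Lemma transferZ k f x : continuous f -> T (fun x => k * f x) x = k * T f x.
Proof. by move=> cf; rewrite /T integZ // mulrCA. Qed.

Lemma in_clamp_itv s x : clamp a s <= x <= 1 -> - a <= x <= 1.
Proof. by case/andP: (clb s) => h _ /andP[/(le_trans h) -> ->]. Qed.

Lemma eq_transfer f g x : (forall x, - a <= x <= 1 -> f x = g x) -> T f x = T g x.
Proof.
by move=> fg; rewrite /T; congr (_ * _); apply: eq_integ => y /in_clamp_itv/fg.
Qed.

Lemma le_transfer f g x : continuous f -> continuous g ->
  (forall x, - a <= x <= 1 -> f x <= g x) -> T f x <= T g x.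
Proof.
move=> cf cg fg; rewrite /T ler_pM2l //.
by apply: le_integ => // y /in_clamp_itv/fg.
Qed.

Lemma transfer_ge0 f x : (forall x, - a <= x <= 1 -> 0 <= f x) -> 0 <= T f x.
Proof.
move=> f0; apply: mulr_ge0; first exact: ltW.
by apply: integ_ge0 => // y /in_clamp_itv/f0.
Qed.

Lemma iter_transfer_continuous n f : continuous f -> continuous (iter n T f).
Proof. by move=> cf; elim: n => //= n; exact: transfer_continuous. Qed.

Lemma iter_transfer_ge0 n f x : (forall x, - a <= x <= 1 -> 0 <= f x) ->
  - a <= x <= 1 -> 0 <= iter n T f x.
Proof.
by move=> f0; elim: n x => [|n IH] x xD /=; [exact: f0|exact: transfer_ge0].
Qed.

Lemma iter_transferD n f g x : continuous f -> continuous g ->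
  - a <= x <= 1 ->
  iter n T (fun x => f x + g x) x = iter n T f x + iter n T g x.
Proof.
move=> cf cg; elim: n x => //= n IH x xD.
by rewrite (eq_transfer _ IH) transferD //; exact: iter_transfer_continuous.
Qed.

Lemma iter_transferZ n k f x : continuous f -> - a <= x <= 1 ->
  iter n T (fun x => k * f x) x = k * iter n T f x.
Proof.
move=> cf; elim: n x => //= n IH x xD.
by rewrite (eq_transfer _ IH) transferZ //; exact: iter_transfer_continuous.
Qed.

Lemma eq_iter_transfer n f g x : (forall x, - a <= x <= 1 -> f x = g x) ->
  - a <= x <= 1 -> iter n T f x = iter n T g x.
Proof.
move=> fg; elim: n x => [|n IH] x xD /=; first exact: fg.
exact: eq_transfer.
Qed.

(** A measure of the survival probability from [x], with the linear decay at
    [theta * x = 1] that eigenfunctions share. *)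
Definition room x : R := Num.max 0 (1 - theta * x).

Lemma transfer_upper f M x : continuous f -> 0 <= M ->
  (forall x, - a <= x <= 1 -> f x <= M) -> T f x <= M / (a + 1) * room x.
Proof.
move=> cf M0 fM; rewrite /T mulrC [M / _ * _]mulrAC ler_pM2r //.
apply: le_trans (integ_le_cst cf _ (fun y yD => fM y (in_clamp_itv yD))) _.
  by case/andP: (clb (theta * x)).
rewrite ler_wpM2l // /room /clamp; minmax_lra.
Qed.

Definition core_bound : R := Num.max theta (Num.max 0 (- a)).

(** The mass that one step out of any point of [0, 1] is sure to reach. *)
Definition core_mass f : R := integ f core_bound 1.

Lemma core_bound_lt1 : core_bound < 1.
Proof.
by rewrite /core_bound !gt_max ltr01; case/andP: theta_range => _ ->; have := a_gtN1; lra.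
Qed.

Lemma core_bound_ge : - a <= core_bound.
Proof. by rewrite /core_bound !le_max lexx !orbT. Qed.

Lemma core_massB f g : continuous f -> continuous g ->
  core_mass (fun x => f x - g x) = core_mass f - core_mass g.
Proof. exact: integB. Qed.

Definition minorization_const : R :=
  (a + 1)^-1 ^+ 2 * (Num.min 1 (1 + a) / (2 + `|a|)).

Lemma minorization_const_gt0 : 0 < minorization_const.
Proof.
have a2 : 0 < 2 + `|a| by have := normr_ge0 a; lra.
have m0 : 0 < Num.min 1 (1 + a) by rewrite lt_min ltr01 addrC.
by apply: mulr_gt0; [exact: exprn_gt0|exact: divr_gt0].
Qed.

Lemma room_bound x : - a <= x <= 1 -> theta * x < 1 ->
  Num.min 1 (1 + a) / (2 + `|a|) * room x <= 1 - Num.max (clamp a (theta * x)) 0.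
Proof.
move=> /andP[ax x1] tx1.
have a2 : 0 < 2 + `|a| by have := normr_ge0 a; lra.
have m1 : Num.min 1 (1 + a) <= 1 by rewrite ge_min lexx.
have ma : Num.min 1 (1 + a) <= 1 + a by rewrite ge_min lexx orbT.
have m0 : 0 < Num.min 1 (1 + a) by rewrite lt_min ltr01 addrC.
set m := Num.min _ _ in m0 m1 ma *.
have r0 : room x = 1 - theta * x by rewrite /room max_r // subr_ge0 ltW.
have rb : room x <= 2 + `|a|.
  have : - (theta * x) <= 1 + `|a|.
    apply: le_trans (ler_norm _) _; rewrite normrN normrM.
    have : `|theta| <= 1 by case/andP: theta_range => h1 /ltW h2; rewrite ler_norml h1.
    have : `|x| <= 1 + `|a|.
      rewrite ler_norml; apply/andP; split; last first.
        by rewrite (le_trans x1) // lerDl.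
      rewrite lerNl; apply: le_trans (_ : `|a| <= _); last by rewrite lerDr.
      by have := ler_norm a; lra.
    move=> hx ht; rewrite -[leRHS]mul1r; apply: ler_pM => //.
  by rewrite r0; lra.
have mr : m / (2 + `|a|) * room x <= m.
  by rewrite mulrAC ler_pdivrMr // ler_pM2l.
have mr' : m / (2 + `|a|) * room x <= room x.
  rewrite -[leRHS]mul1r ler_wpM2r //; first by rewrite r0 subr_ge0 ltW.
  rewrite ler_pdivrMr // mul1r (le_trans m1) //.
  by have := normr_ge0 a; lra.
move: (_ * room x) mr mr' r0 => z zm zr r0.
rewrite /clamp; minmax_lra.
Qed.

(** Uniform two-step minorization: the first step lands near 1 with probability
    comparable to [room x], and from [0, 1] the second step spreads over
    [core_bound, 1] with full density. *)
Lemma transfer2_lower f x : continuous f ->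
  (forall x, - a <= x <= 1 -> 0 <= f x) -> - a <= x <= 1 ->
  minorization_const * room x * core_mass f <= T (T f) x.
Proof.
move=> cf f0 xD; have [tx1|tx1] := leP 1 (theta * x).
  rewrite /room max_l ?subr_le0 // mulr0 mul0r.
  by apply: transfer_ge0 => y _; exact: transfer_ge0.
have phi0 : 0 <= core_mass f.
  by apply: integ_ge0 => y /andP[/(le_trans core_bound_ge) ay y1]; apply: f0; rewrite ay.
have cTf := transfer_continuous cf.
have step y : 0 <= y <= 1 -> (a + 1)^-1 * core_mass f <= T f y.
  move=> /andP[y0 y1]; rewrite /T ler_pM2l //; apply: integ_shrink => //.
    rewrite /clamp /core_bound; have [t0|t0] := leP theta 0.
      have : theta * y <= 0 by rewrite mulr_le0_ge0.
      minmax_lra.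
    have : theta * y <= theta by rewrite ler_piMr // ltW.
    minmax_lra.
  by move=> z /in_clamp_itv/f0.
set b := Num.max (clamp a (theta * x)) 0.
have b1 : b <= 1 by rewrite ge_max ler01 andbT; case/andP: (clb (theta * x)).
apply: le_trans (_ : (a + 1)^-1 * ((a + 1)^-1 * core_mass f * (1 - b)) <= _).
  have -> : minorization_const * room x * core_mass f = (a + 1)^-1 *
    ((a + 1)^-1 * core_mass f * (Num.min 1 (1 + a) / (2 + `|a|) * room x)).
    by rewrite /minorization_const; ring.
  rewrite ler_pM2l // ler_wpM2l ?room_bound //.
  by rewrite mulr_ge0 // ltW.
rewrite {2}/T ler_pM2l //.
apply: le_trans (_ : integ (T f) b 1 <= _).
  apply: integ_ge_cst => // y /andP[by_ y1]; apply: step.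
  by rewrite y1 andbT (le_trans _ by_) // le_max lexx orbT.
apply: integ_shrink => //; first by rewrite le_max lexx.
by move=> y _; exact: transfer_ge0.
Qed.

End Operator.

(** * Convergence of the normalized iterates *)

Section Doeblin.
Variable R : realType.
Variables theta a : R.
Hypothesis theta_range : -1 <= theta < 1.
Hypothesis a_gtN1 : -1 < a.
Variables (lam : R) (h : R -> R).
Hypothesis lam_gt0 : 0 < lam.
Hypothesis h_cont : continuous h.
Hypothesis h_ge0 : forall x : R, - a <= x <= 1 -> 0 <= h x.
Hypothesis h_eigen : forall x : R, - a <= x <= 1 -> transfer theta a h x = lam * h x.
Hypothesis h_core : 0 < core_mass theta a h.
Implicit Types (f g : R -> R) (x : R).

Local Notation T := (transfer theta a).
Local Notation c0 := (minorization_const a).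
Local Notation phi := (core_mass theta a).
Local Notation u := (room theta).
Local Notation inD x := (- a <= x <= 1).

Let lam0 : lam != 0. Proof. by rewrite gt_eqF. Qed.

Lemma iter_eigen n x : inD x -> iter n T h x = lam ^+ n * h x.
Proof.
elim: n x => [|n IH] x xD /=; first by rewrite mul1r.
by rewrite (eq_transfer theta a_gtN1 _ IH) transferZ // h_eigen // exprSr mulrA.
Qed.

Lemma transfer2_eigen x : inD x -> T (T h) x = lam ^+ 2 * h x.
Proof. by move=> xD; rewrite -[T (T h)]/(iter 2 T h) iter_eigen. Qed.

Lemma eigen_upper : exists2 C, 0 < C & forall x, inD x -> h x <= C * u x.
Proof.
have [M M0 hM] := bounded_on_segment (- a) 1 h_cont.
exists (lam^-1 * (M / (a + 1))) => [|x xD].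
  by rewrite !mulr_gt0 ?invr_gt0 //; have := a_gtN1; lra.
rewrite -mulrA -(ler_pM2l lam_gt0) mulVKf // -h_eigen //.
apply: transfer_upper => //; first exact: ltW.
by move=> y /hM; apply: le_trans; exact: ler_norm.
Qed.

Lemma eigen_lower : exists2 c, 0 < c & forall x, inD x -> c * u x <= h x.
Proof.
exists (c0 * phi h / lam ^+ 2) => [|x xD].
  by rewrite divr_gt0 ?exprn_gt0 // mulr_gt0 // minorization_const_gt0.
rewrite mulrAC ler_pdivrMr ?exprn_gt0 // [leRHS]mulrC -transfer2_eigen //.
by rewrite mulrAC; exact: transfer2_lower.
Qed.

(** [m] and [M] being bounds for [g / h], the minorization turns the core mass of
    the slack [g - m * h] or [M * h - g] into a better bound after two steps. *)
Definition lower_step (c : R) g (m : R) := m + c * phi (fun x => g x - m * h x).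
Definition upper_step (c : R) g (m : R) := m - c * phi (fun x => m * h x - g x).

Lemma cont_scale (k : R) f : continuous f -> continuous (fun x => k * f x).
Proof. by move=> cf x; apply: cvgM; [exact: cvg_cst|exact: cf]. Qed.

Lemma cont_sub f g : continuous f -> continuous g ->
  continuous (fun x => f x - g x).
Proof. by move=> cf cg x; apply: cvgB; [exact: cf|exact: cg]. Qed.

Lemma doeblin_step : exists2 c, 0 < c /\ c * phi h <= 1 &
  forall g m M, continuous g ->
    (forall x, inD x -> m * h x <= g x <= M * h x) ->
    forall x, inD x ->
      lower_step c g m * h x <= (lam ^+ 2)^-1 * T (T g) x <= upper_step c g M * h x.
Proof.
have [C C0 hC] := eigen_upper.
have l2 : 0 < lam ^+ 2 by rewrite exprn_gt0.
have cc0 : 0 < c0 by exact: minorization_const_gt0.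
(* one-sided estimate, used below for both g - m h and M h - g *)
have low f x : continuous f -> (forall x, inD x -> 0 <= f x) -> inD x ->
    c0 / C / lam ^+ 2 * phi f * h x <= (lam ^+ 2)^-1 * T (T f) x.
  move=> cf f0 xD.
  have p0 : 0 <= phi f.
    apply: integ_ge0 => y /andP[/(le_trans (core_bound_ge _ _)) ay y1].
    by apply: f0; rewrite ay.
  apply: le_trans (_ : (lam ^+ 2)^-1 * (c0 * u x * phi f) <= _); last first.
    by rewrite ler_pM2l ?invr_gt0 //; exact: transfer2_lower.
  have -> : c0 / C / lam ^+ 2 * phi f * h x =
      (lam ^+ 2)^-1 * (c0 * (h x / C) * phi f) by ring.
  rewrite ler_pM2l ?invr_gt0 // ler_wpM2r // ler_pM2l //.
  by rewrite ler_pdivrMr // mulrC; exact: hC.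
exists (c0 / C / lam ^+ 2); first split; first by rewrite !divr_gt0.
  have D1 : inD (1 : R) by rewrite lexx andbT; have := a_gtN1; lra.
  have u1 : 0 < u 1 by rewrite /room lt_max mulr1 subr_gt0; case/andP: theta_range => _ ->; rewrite orbT.
  have h1 : 0 < h 1.
    by have [c c_0 hc] := eigen_lower; apply: lt_le_trans (hc _ D1); rewrite mulr_gt0.
  rewrite -(ler_pM2r h1) mul1r.
  apply: le_trans (low h 1 h_cont h_ge0 D1) _.
  by rewrite transfer2_eigen // mulKf // gt_eqF.
move=> g m M cg gmM x xD.
have TTB f k : continuous f ->
    T (T (fun x => f x - k * h x)) x = T (T f) x - k * (lam ^+ 2 * h x).
  move=> cf; have cT k := @transfer_continuous _ theta _ a_gtN1 k.
  rewrite (@eq_transfer _ theta _ a_gtN1 _ (fun x => T f x - k * T h x)); last first.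
    by move=> y _; rewrite transferB ?transferZ //; exact: cont_scale.
  rewrite transferB; [|exact: cT|by apply: cont_scale; exact: cT].
  by rewrite transferZ ?transfer2_eigen //; exact: cT.
have TTB' f k : continuous f ->
    T (T (fun x => k * h x - f x)) x = k * (lam ^+ 2 * h x) - T (T f) x.
  move=> cf; have cT k := @transfer_continuous _ theta _ a_gtN1 k.
  rewrite (@eq_transfer _ theta _ a_gtN1 _ (fun x => k * T h x - T f x)); last first.
    by move=> y _; rewrite transferB ?transferZ //; exact: cont_scale.
  rewrite transferB; [|by apply: cont_scale; exact: cT|exact: cT].
  by rewrite transferZ ?transfer2_eigen //; exact: cT.
rewrite /lower_step /upper_step; apply/andP; split.
  have := low (fun x => g x - m * h x) x.
  rewrite TTB // mulrBr [_^-1 * (m * _)]mulrCA mulKf ?gt_eqF //.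
  move=> /(_ (cont_sub cg (@cont_scale m _ h_cont)) _ xD) H.
  rewrite mulrDl -lerBrDl; apply: H => y /gmM /andP[? _].
  by rewrite subr_ge0.
have := low (fun x => M * h x - g x) x.
rewrite TTB' // mulrBr [_^-1 * (M * _)]mulrCA mulKf ?gt_eqF //.
move=> /(_ (cont_sub (@cont_scale M _ h_cont) cg) _ xD) H.
rewrite mulrBl lerBrDr -lerBrDl; apply: H => y /gmM /andP[_ ?].
by rewrite subr_ge0.
Qed.

(** Iterating the two-step contraction squeezes the ratio of [iter n T f] and
    [lam ^+ n * h]; the first application of [T] is there because it bounds any
    continuous function by a multiple of [h], also where [h] vanishes. *)
Theorem transfer_converges f : continuous f ->
  exists L : R, exists2 e : nat -> R, e @ \oo --> 0 &
    forall n x, inD x ->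
      `|iter n.+1 T f x / lam ^+ n.+1 - L * h x| <= e n * h x.
Proof.
move=> cf.
have cT k := @transfer_continuous _ theta _ a_gtN1 k.
pose g0 x := lam^-1 * T f x.
have cg0 : continuous g0 by apply: cont_scale; exact: cT.
have [K K0 gK] : exists2 K, 0 <= K & forall x, inD x -> - K * h x <= g0 x <= K * h x.
  have [M M0 fM] := bounded_on_segment (- a) 1 cf.
  have [c c_0 hc] := eigen_lower.
  have a1 : 0 < a + 1 by have := a_gtN1; lra.
  exists (lam^-1 * (M / (a + 1) / c)) => [|x xD].
    by rewrite !mulr_ge0 ?invr_ge0 // ltW.
  have up k : continuous k -> (forall y, inD y -> `|k y| <= M) ->
      lam^-1 * T k x <= lam^-1 * (M / (a + 1) / c) * h x.
    move=> ck kM; rewrite -[leRHS]mulrA ler_pM2l ?invr_gt0 //.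
    apply: le_trans (transfer_upper theta a_gtN1 x ck (ltW M0) _) _.
      by move=> y /kM; apply: le_trans; exact: ler_norm.
    rewrite -[leRHS]mulrA ler_pM2l ?divr_gt0 // [leRHS]mulrC ler_pdivlMr // mulrC.
    exact: hc.
  rewrite up // andbT mulNr lerNl.
  have := up (fun x => -1 * f x) (@cont_scale (-1) _ cf).
  by rewrite transferZ // mulN1r mulrN; apply=> y /fM; rewrite mulN1r normrN.
have [c [c_0 cphi] step] := doeblin_step.
pose g n x := (lam ^+ n)^-1 * iter n T g0 x.
have cg n : continuous (g n) by apply: cont_scale; exact: iter_transfer_continuous.
have gS n x : inD x -> g n.+2 x = (lam ^+ 2)^-1 * T (T (g n)) x.
  move=> xD; rewrite /g.
  have cI := @iter_transfer_continuous _ theta _ a_gtN1 n _ cg0.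
  rewrite (@eq_transfer _ theta _ a_gtN1 _ (fun x => (lam ^+ n)^-1 * T (iter n T g0) x)); last first.
    by move=> y _; rewrite transferZ.
  rewrite transferZ; last exact: cT.
  by rewrite [RHS]mulrA -invfM -exprD.
pose fix m n := if n is n'.+1 then lower_step c (g n'.*2) (m n') else - K.
pose fix M n := if n is n'.+1 then upper_step c (g n'.*2) (M n') else K.
have sq n x : inD x -> m n * h x <= g n.*2 x <= M n * h x.
  elim: n x => [|n IH] x xD; first by rewrite /g /= invr1 mul1r; exact: gK.
  by rewrite doubleS gS //; exact: step.
have core y : core_bound theta a <= y <= 1 -> inD y.
  by move=> /andP[/(le_trans (core_bound_ge _ _)) -> ->].
have mS n : m n <= m n.+1.
  rewrite /= /lower_step lerDl; apply: mulr_ge0; first exact: ltW.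
  by apply: integ_ge0 => y /core/(sq n)/andP[? _]; rewrite subr_ge0.
have MS n : M n.+1 <= M n.
  rewrite /= /upper_step gerBl; apply: mulr_ge0; first exact: ltW.
  by apply: integ_ge0 => y /core/(sq n)/andP[_ ?]; rewrite subr_ge0.
pose q := 1 - c * phi h.
have q0 : 0 <= q by rewrite subr_ge0.
have q1 : q < 1 by rewrite gtrBl mulr_gt0.
have gap n : M n - m n = q ^+ n * (2 * K).
  elim: n => [|n IH]; first by rewrite /=; ring.
  rewrite exprS -mulrA -IH /= /lower_step /upper_step.
  have cs k := @cont_scale k _ h_cont.
  rewrite (core_massB _ _ (cg _) (cs _)) (core_massB _ _ (cs _) (cg _)).
  rewrite /q /core_mass !(@integZ _ _ h _ _ h_cont); ring.
have gap0 n : m n <= M n.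
  by rewrite -subr_ge0 gap mulr_ge0 ?exprn_ge0 ?mulr_ge0.
have mle n k : (n <= k)%N -> m n <= m k.
  by move=> /subnK <-; elim: (k - n)%N => // j IH; rewrite addSn; apply: le_trans IH (mS _).
have Mle n k : (n <= k)%N -> M k <= M n.
  by move=> /subnK <-; elim: (k - n)%N => // j IH; rewrite addSn; apply: le_trans (MS _) IH.
have mM n k : m n <= M k.
  have [nk|/ltnW kn] := leqP n k; first exact: le_trans (mle _ _ nk) (gap0 _).
  exact: le_trans (gap0 _) (Mle _ _ kn).
pose L := sup (range m).
have mL n : m n <= L.
  apply: ub_le_sup; last by exists n.
  by exists (M 0%N) => _ [k _ <-].
have LM n : L <= M n.
  by apply: ge_sup; [exists (m 0%N); exists 0%N|move=> _ [k _ <-]].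
exists L; exists (fun n => q ^+ n./2 * (2 * K)).
  rewrite -(mul0r (2 * K)); apply: cvgM; last exact: cvg_cst.
  have /cvgrPdist_lt H : (fun n => q ^+ n) @ \oo --> 0.
    by apply: cvg_expr; rewrite ger0_norm.
  apply/cvgrPdist_lt => e /H [N _ HN]; exists N.*2 => // n /= Nn.
  by apply: HN => /=; rewrite -(doubleK N); exact: half_leq.
have even n x : inD x -> `|g n.*2 x - L * h x| <= q ^+ n * (2 * K) * h x.
  move=> xD; have /andP[l1 l2] := sq n x xD; have h0 := h_ge0 xD.
  rewrite -gap ler_norml; apply/andP; split.
    by rewrite lerBrDr -mulNr -mulrDl (le_trans _ l1) // ler_wpM2r //; have := LM n; lra.
  by rewrite lerBlDr -mulrDl (le_trans l2) // ler_wpM2r //; have := mL n; lra.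
have gT n x : inD x -> g n.+1 x = lam^-1 * T (g n) x.
  move=> xD; rewrite /g transferZ; last exact: iter_transfer_continuous.
  by rewrite [RHS]mulrA -invfM -exprS.
have all_n n x : inD x -> `|g n x - L * h x| <= q ^+ n./2 * (2 * K) * h x.
  move=> xD; have [odd_n|even_n] := boolP (odd n); last first.
    by rewrite -{1}(even_halfK even_n); exact: even.
  rewrite -{1}(odd_double_half n) odd_n add1n gT //.
  set k := n./2; set d := _ * (2 * K).
  have bnd y : inD y -> `|g k.*2 y - L * h y| <= d * h y by exact: even.
  have cs j := @cont_scale j _ h_cont.
  have Tle s y : continuous s -> (forall z, inD z -> s z <= d * h z) -> inD y ->
      lam^-1 * T s y <= d * h y.
    move=> cS sd yD; rewrite mulrC ler_pdivrMr // -mulrA [h y * _]mulrC -h_eigen //.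
    by rewrite -transferZ //; exact: le_transfer.
  rewrite ler_norml; apply/andP; split.
    have := Tle (fun y => L * h y - g k.*2 y) x (cont_sub (cs L) (cg _)).
    rewrite (transferB _ _ _ (cs L) (cg _)) (@transferZ _ _ _ _ h _ h_cont) h_eigen // mulrBr [_^-1 * (L * _)]mulrCA mulKf // => H.
    rewrite -opprB lerN2; apply: H => // y /bnd.
    by rewrite distrC; apply: le_trans; exact: ler_norm.
  have := Tle (fun y => g k.*2 y - L * h y) x (cont_sub (cg _) (cs L)).
  rewrite (transferB _ _ _ (cg _) (cs L)) (@transferZ _ _ _ _ h _ h_cont) h_eigen // mulrBr [_^-1 * (L * _)]mulrCA mulKf // => H.
  by apply: H => // y /bnd; apply: le_trans; exact: ler_norm.
move=> n x xD; rewrite (_ : _ / _ = g n x); first exact: all_n.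
rewrite /g /g0 iter_transferZ //; last exact: cT.
by rewrite -iterSr mulrA -invfM -exprSr mulrC.
Qed.

End Doeblin.

(** * Resolvent families and their first zero *)

Section Family.
Variable R : realType.
Variables theta a t : R.
Hypothesis theta_range : -1 <= theta < 1.
Hypothesis a_gtN1 : -1 < a.
Hypothesis t_gtN1 : -1 < t.
Hypothesis clampE : forall x : R, - a <= x <= 1 ->
  clamp a (theta * x) = clamp t (theta * x).

Local Notation T := (transfer theta a).
Local Notation inD x := (- a <= x <= 1).
Local Notation x0 := (Num.max 0 (- a) : R).

(** At most geometric growth, the condition under which the series used below
    converge. *)
Definition geo (r : nat -> R) : Prop :=
  exists C K : R, forall n, `|r n| <= C * K ^+ n.

Definition shift (r : nat -> R) n := r n.+1.

Lemma geo_shift r : geo r -> geo (shift r).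
Proof.
by move=> [C [K rK]]; exists (C * K), K => n; rewrite -mulrA -exprS; exact: rK.
Qed.

Lemma geo_expr (z : R) : geo (fun n => z ^+ n).
Proof. by exists 1, `|z| => n; rewrite mul1r normrX. Qed.

(** Sequences [r] play the role of the powers of the spectral parameter, so that
    real powers and the real and imaginary parts of complex powers are treated
    at once. [shift] is then multiplication by the parameter, and [fam_step] says
    that the resolvent equation holds up to a constant. *)
Record family (Phi : (nat -> R) -> R -> R) : Prop := Family {
  fam_cont : forall r, geo r -> continuous (Phi r);
  fam_lin : forall k l r q s, geo r -> geo q ->
    Phi (fun n => k * r n + l * q n) s = k * Phi r s + l * Phi q s;
  fam_step : forall r s, geo r -> - t <= s <= 1 ->
    Phi r s = Phi r 1 +
      (a + 1)^-1 * integ (fun y => Phi (shift r) (clamp t (theta * y))) s 1;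
  fam_base : forall r, geo r -> Phi r (clamp t (theta * x0)) = r 0%N;
  fam_bound : forall K, exists C, forall r, (forall n, `|r n| <= K ^+ n) ->
    forall s, - t <= s <= 1 -> `|Phi r s| <= C }.

Variable Phi : (nat -> R) -> R -> R.
Hypothesis PhiF : family Phi.

Definition pull (r : nat -> R) x := Phi r (clamp t (theta * x)).
Definition pw (z : R) : nat -> R := fun n => z ^+ n.
Definition charac (z : R) : R := Phi (pw z) 1.

Let a1 : 0 < a + 1. Proof. by have := a_gtN1; lra. Qed.
Let clb s : - t <= clamp t s <= 1. Proof. exact: clamp_bounds. Qed.

Lemma clamp_continuous (k : R) : continuous (clamp k).
Proof.
by apply: (@lipschitz_continuous_real _ _ 1) => x y; rewrite mul1r clamp_lip.
Qed.

Lemma clamp_comp_continuous (th k : R) (f : R -> R) : continuous f ->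
  continuous (fun y => f (clamp k (th * y))).
Proof.
move=> cf x; apply: continuous_comp; last exact: cf.
apply: continuous_comp; last exact: clamp_continuous.
by apply: cvgM; [exact: cvg_cst|exact: cvg_id].
Qed.

Lemma pull_cont r : geo r -> continuous (pull r).
Proof. by move=> gr; apply: clamp_comp_continuous; exact: (fam_cont PhiF). Qed.

Lemma pull_step r x : geo r -> inD x ->
  pull r x = Phi r 1 + T (pull (shift r)) x.
Proof. by move=> gr xD; rewrite /pull (fam_step PhiF) // /transfer clampE. Qed.

Lemma pull_lin k l r q x : geo r -> geo q ->
  pull (fun n => k * r n + l * q n) x = k * pull r x + l * pull q x.
Proof. exact: (fam_lin PhiF). Qed.

Lemma PhiZ k r s : geo r -> Phi (fun n => k * r n) s = k * Phi r s.
Proof.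
move=> gr; rewrite -[RHS]addr0 -(mul0r (Phi r s)) -(fam_lin PhiF) //.
by congr (Phi _ _); apply: funext => n; rewrite mul0r addr0.
Qed.

Lemma shift_pw z : shift (pw z) = fun n => z * pw z n.
Proof. by apply: funext => n; rewrite /shift /pw exprS. Qed.

Lemma resolvent z x : inD x ->
  pull (pw z) x = charac z + z * T (pull (pw z)) x.
Proof.
move=> xD; rewrite {1}pull_step ?shift_pw //; last exact: geo_expr.
rewrite (_ : pull _ = fun x => z * pull (pw z) x) ?transferZ //.
- exact: pull_cont (geo_expr z).
- by apply: funext => y; exact: PhiZ (geo_expr z).
Qed.

Lemma x0D : inD x0.
Proof. by rewrite le_max lexx orbT /= ge_max ler01 /=; have := a_gtN1; lra. Qed.

Lemma pull_base r : geo r -> pull r x0 = r 0%N.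
Proof. exact: (fam_base PhiF). Qed.

(** The divided differences of the powers form an admissible sequence, on which
    the family is bounded. *)
Lemma charac_lipschitz Z : exists2 K, 0 < K &
  forall z z' s, 0 <= z <= Z -> 0 <= z' <= Z -> - t <= s <= 1 ->
    `|Phi (pw z) s - Phi (pw z') s| <= K * `|z - z'|.
Proof.
have [C CK] := fam_bound PhiF (Z + 1).
exists (`|C| + 1) => [|z z' s /andP[z0 zZ] /andP[z0' zZ'] st]; first by rewrite ltr_wpDl.
pose q n := \sum_(i < n) z ^+ (n.-1 - i) * z' ^+ i.
have Z0 : 0 <= Z by exact: le_trans zZ.
have Z1 n : n%:R * Z ^+ n.-1 <= (Z + 1) ^+ n.
  elim: n => [|n IH]; first by rewrite mul0r expr0.
  have ZZ : Z ^+ n <= (Z + 1) ^+ n by rewrite lerXn2r ?nnegrE ?lerDl // addr_ge0.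
  rewrite exprS mulrDl mul1r -natr1 mulrDl mul1r /=; apply: lerD => //.
  apply: le_trans (ler_wpM2l Z0 IH); case: (n) => [|m] /=; first by rewrite !mul0r mulr0.
  by rewrite exprS mulrCA.
have qZ n : `|q n| <= (Z + 1) ^+ n.
  apply: le_trans (Z1 n); rewrite ger0_norm; last first.
    by apply: sumr_ge0 => i _; rewrite mulr_ge0 ?exprn_ge0.
  apply: le_trans (_ : \sum_(i < n) Z ^+ n.-1 <= _); last first.
    by rewrite sumr_const card_ord mulr_natl.
  apply: ler_sum => i _.
  have -> : Z ^+ n.-1 = Z ^+ (n.-1 - i) * Z ^+ i.
    by rewrite -exprD subnK // -ltnS (leq_trans (ltn_ord i)) // leqSpred.
  by apply: ler_pM; rewrite ?exprn_ge0 // lerXn2r ?nnegrE.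
have gq : geo q by exists 1, (Z + 1) => n; rewrite mul1r.
have -> : Phi (pw z) s - Phi (pw z') s = (z - z') * Phi q s.
  rewrite -PhiZ // -[X in X - _]mul1r -mulN1r -(fam_lin PhiF); try exact: geo_expr.
  congr (Phi _ _); apply: funext => n; rewrite mul1r mulN1r /pw subrXX /q.
  by [].
rewrite normrM mulrC ler_wpM2r // (le_trans (CK q qZ s st)) //.
by rewrite (le_trans (ler_norm C)) // lerDl.
Qed.

Lemma charac0 x : inD x -> charac 0 = 1 /\ pull (pw 0) x = 1.
Proof.
move=> xD.
have e y : inD y -> pull (pw 0) y = charac 0.
  by move=> yD; rewrite resolvent // mul0r addr0.
have c1 : charac 0 = 1.
  by rewrite -(e _ x0D) pull_base ?/pw ?expr0 //; exact: geo_expr.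
by rewrite e.
Qed.

Let good z := 0 < charac z /\ forall x, inD x -> 0 <= pull (pw z) x.

Let good_ge z x : 0 <= z -> good z -> inD x -> charac z <= pull (pw z) x.
Proof.
move=> z0 [_ gz] xD; rewrite resolvent // lerDl mulr_ge0 //.
exact: transfer_ge0.
Qed.

(** The lower bound [charac z] of a good member of the family leaves room for a
    small change of [z]. *)
Let good_open z : 0 <= z -> good z ->
  exists2 d, 0 < d & forall z', 0 <= z' -> `|z - z'| <= d -> good z'.
Proof.
move=> z0 gz; have [uz _] := gz.
have [K K0 lip] := charac_lipschitz (z + 1).
exists (Num.min 1 (charac z / 2 / K)).
  by rewrite lt_min ltr01 !divr_gt0.
move=> z' z0'; rewrite le_min => /andP[d1 d2].
have zZ : 0 <= z <= z + 1 by rewrite z0 lerDl ler01.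
have zZ' : 0 <= z' <= z + 1.
  by rewrite z0' /=; move: d1; rewrite ler_norml => /andP[]; lra.
have close s : - t <= s <= 1 -> `|Phi (pw z) s - Phi (pw z') s| <= charac z / 2.
  move=> st; apply: le_trans (lip _ _ s zZ zZ' st) _.
  by rewrite mulrC -ler_pdivlMr.
split.
  have /close : - t <= (1 : R) <= 1 by rewrite lexx andbT; have := t_gtN1; lra.
  by rewrite -/(charac z) -/(charac z') ler_norml => /andP[_]; move: uz; lra.
move=> x xD; have := good_ge z0 gz xD; have := close _ (clb (theta * x)).
by rewrite -/(pull (pw z) x) -/(pull (pw z') x) ler_norml => /andP[_]; move: uz; lra.
Qed.

(** For large [z], two steps of the resolvent equation would multiply the core
    mass by more than one. *)
Let good_bounded : exists Z, forall z, 0 <= z -> good z -> z <= Z.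
Proof.
pose s := core_bound theta a; pose rho := 1 - Num.max theta 0.
have s1 : s < 1 by exact: core_bound_lt1.
have rho0 : 0 < rho.
  by rewrite subr_gt0 gt_max ltr01 andbT; case/andP: theta_range.
have c0 := minorization_const_gt0 a_gtN1.
pose k := minorization_const a * rho * (1 - s).
have k0 : 0 < k by apply: mulr_gt0; [exact: mulr_gt0|rewrite subr_gt0].
exists (Num.max 1 k^-1) => z z0 gz; rewrite leNgt; apply/negP.
rewrite gt_max => /andP[z1 zk].
have [uz g0] := gz.
have cg := pull_cont (geo_expr z : geo (pw z)).
have cT f := @transfer_continuous _ theta _ a_gtN1 f.
have sD y : s <= y <= 1 -> inD y.
  by move=> /andP[/(le_trans (core_bound_ge _ _)) -> ->].
have phi0 : 0 < core_mass theta a (pull (pw z)).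
  apply: (@integ_gt0 _ _ _ _ 1) => //; first by move=> y /sD; exact: g0.
    by rewrite lexx andbT ltW.
  by apply: lt_le_trans (good_ge z0 gz (sD _ _)) => //; rewrite lexx ltW.
have gTT x : inD x -> z ^+ 2 * T (T (pull (pw z))) x <= pull (pw z) x.
  move=> xD; rewrite resolvent // expr2 -mulrA.
  apply: ler_wpDl; first exact: ltW.
  rewrite ler_pM2l ?(lt_trans _ z1) //.
  rewrite -transferZ; last exact: cT.
  apply: le_transfer => //; first exact: (cont_scale (cT _ cg)).
  by move=> y yD; rewrite [leRHS]resolvent //; apply: ler_wpDl => //; exact: ltW.
have : z ^+ 2 * k * core_mass theta a (pull (pw z)) <= core_mass theta a (pull (pw z)).
  rewrite {2}/core_mass /k -/s.
  apply: le_trans (integ_ge_cst (k := z ^+ 2 * (minorization_const a * rho *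
     core_mass theta a (pull (pw z)))) cg (ltW s1) _).
    by rewrite le_eqVlt; apply/orP; left; apply/eqP; ring.
  move=> y ys; apply: le_trans (gTT y (sD _ ys)).
  rewrite ler_pM2l ?exprn_gt0 ?(lt_trans _ z1) //.
  apply: le_trans (transfer2_lower theta_range a_gtN1 cg g0 (sD _ ys)).
  rewrite ler_pM2r // ler_pM2l // /rho /room.
  case/andP: ys => sy y1; rewrite le_max; apply/orP; right.
  rewrite lerD2l lerN2 le_max; have [th|th] := leP theta 0.
    apply/orP; right; rewrite mulr_le0_ge0 //.
    by apply: le_trans sy; rewrite /s /core_bound !le_max lexx !orbT.
  by apply/orP; left; rewrite ler_piMr // ltW.
rewrite -[leRHS]mul1r ler_pM2r // leNgt => /negP; apply.
rewrite -(mulVf (lt0r_neq0 k0)) ltr_pM2r //.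
by rewrite (lt_trans zk) // expr2 ltr_pMl // (lt_trans _ z1).
Qed.

(** The first parameter at which the resolvent family stops being positive is a
    zero of the characteristic function, and there the family is an eigenfunction. *)
Theorem first_zero : exists z0, [/\ 0 < z0, charac z0 = 0,
  forall x, inD x -> 0 <= pull (pw z0) x &
  forall z, 0 <= z < z0 -> 0 < charac z].
Proof.
pose A := [set z | 0 <= z /\ forall z', 0 <= z' <= z -> good z'].
have [Z hZ] := good_bounded.
have g0 : good 0.
  split; first by have [-> _] := charac0 x0D.
  by move=> x xD; have [_ ->] := charac0 xD.
have A0 : A 0.
  by split => // z'; rewrite -eq_le => /eqP <-.
have supA : has_sup A.
  split; first by exists 0.
  by exists Z => z [z_ge0 zg]; apply: hZ => //; apply: zg; rewrite z_ge0 lexx.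
pose z0 := sup A.
have Ale z : A z -> z <= z0 by move=> Az; apply: ub_le_sup => //; case: supA.
have below z : 0 <= z < z0 -> good z.
  move=> /andP[z_ge0 zz0].
  have e0 : 0 < z0 - z by rewrite subr_gt0.
  have [z1 [z1_ge0 hz1] zz1] := sup_adherent e0 supA.
  by apply: hz1; rewrite z_ge0 /=; move: zz1; rewrite -/z0; lra.
have grow z d : 0 <= z -> 0 < d -> (forall z', 0 <= z' < z -> good z') ->
   (forall z', 0 <= z' -> `|z - z'| <= d -> good z') -> z + d <= z0.
  move=> z_ge0 d0 hb hd; apply: Ale; split; first by rewrite addr_ge0 // ltW.
  move=> z' /andP[z0' zd]; have [lt|ge] := ltP z' z; first by apply: hb; rewrite z0'.
  by apply: hd => //; rewrite ler_norml; lra.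
have z0_gt0 : 0 < z0.
  have [d d0 hd] := good_open (lexx 0) g0.
  apply: lt_le_trans (grow 0 d (lexx 0) d0 _ hd); first by rewrite add0r.
  by move=> z' /andP[h1 h2]; move: (le_lt_trans h1 h2); rewrite ltxx.
have [K K0 lip] := charac_lipschitz z0.
have lim_ge0 s : - t <= s <= 1 -> (forall z, 0 <= z < z0 -> 0 <= Phi (pw z) s) ->
    0 <= Phi (pw z0) s.
  move=> st pos; rewrite leNgt; apply/negP => neg.
  pose e := Num.min z0 (- Phi (pw z0) s / 2 / K).
  have e0 : 0 < e by rewrite lt_min z0_gt0 !divr_gt0 // oppr_gt0.
  have ez0 : e <= z0 by rewrite ge_min lexx.
  have zb : 0 <= z0 - e <= z0 by rewrite subr_ge0 ez0 gerBl ltW.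
  have zb' : 0 <= z0 <= z0 by rewrite lexx ltW.
  have := lip _ _ s zb zb' st.
  rewrite (_ : z0 - e - z0 = - e) ?normrN ?(gtr0_norm e0); last by ring.
  move=> hl.
  have : K * e <= - Phi (pw z0) s / 2.
    by rewrite mulrC -ler_pdivlMr // ge_min lexx orbT.
  have := pos (z0 - e); rewrite subr_ge0 ez0 gtrBl e0 => /(_ isT).
  by move: hl; rewrite ler_norml => /andP[_]; move: neg; lra.
have t1 : - t <= (1 : R) <= 1 by rewrite lexx andbT; have := t_gtN1; lra.
have u_ge0 : 0 <= charac z0 by apply: lim_ge0 => // z /below[/ltW].
have g_ge0 x : inD x -> 0 <= pull (pw z0) x.
  by move=> xD; apply: lim_ge0 => // z /below[_]; exact.
exists z0; split => //; last by move=> z /below[].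
apply/eqP; rewrite eq_le u_ge0 andbT leNgt; apply/negP => u_gt0.
have [d d0 hd] := good_open (ltW z0_gt0) (conj u_gt0 g_ge0).
have := grow z0 d (ltW z0_gt0) d0 below hd.
by rewrite gerDl leNgt d0.
Qed.

End Family.

(** * The first zero dominates the spectrum *)

Section Spectrum.
Variable R : realType.
Variables theta a t : R.
Hypothesis theta_range : -1 <= theta < 1.
Hypothesis a_gtN1 : -1 < a.
Hypothesis t_gtN1 : -1 < t.
Hypothesis t_le_a : t <= a.
Hypothesis clampE : forall x : R, - a <= x <= 1 ->
  clamp a (theta * x) = clamp t (theta * x).
Variable Phi : (nat -> R) -> R -> R.
Hypothesis PhiF : family theta a t Phi.
Variable z0 : R.
Hypothesis z0_gt0 : 0 < z0.
Hypothesis z0_root : charac Phi z0 = 0.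
Hypothesis z0_pos : forall x, - a <= x <= 1 -> 0 <= pull theta t Phi (pw z0) x.

Local Notation T := (transfer theta a).
Local Notation inD x := (- a <= x <= 1).
Local Notation x0 := (Num.max 0 (- a) : R).
Local Notation pull := (pull theta t Phi).
Local Notation lam := z0^-1.
Local Notation h := (pull (pw z0)).

Let a1 : 0 < a + 1. Proof. by have := a_gtN1; lra. Qed.
Let lam_gt0 : 0 < lam. Proof. by rewrite invr_gt0. Qed.

Let h_cont : continuous h.
Proof. exact: (pull_cont PhiF (geo_expr z0)). Qed.

Lemma first_eigen x : inD x -> T h x = lam * h x.
Proof.
move=> xD; rewrite (resolvent t_gtN1 clampE PhiF) // z0_root add0r.
by rewrite mulKf // gt_eqF.
Qed.

Let h_base : h x0 = 1.
Proof. by rewrite (pull_base PhiF) ?/pw ?expr0 //; exact: geo_expr. Qed.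

Let x0D : inD x0. Proof. exact: x0D. Qed.

Let vanish b : -a <= b -> b < 1 -> integ h b 1 = 0 ->
  forall x, b <= x <= 1 -> h x = 0.
Proof.
move=> ab b1 hb x bx; apply/eqP/negPn/negP => hx0.
have hD y : b <= y <= 1 -> inD y by move=> /andP[by_ ->]; rewrite (le_trans ab).
have hx : 0 < h x by rewrite lt_def hx0 z0_pos // hD.
have := integ_gt0 h_cont b1 (fun y yb => z0_pos (hD y yb)) bx hx.
by rewrite hb ltxx.
Qed.

(** The eigenfunction equals 1 at [x0]; were it to vanish near 1, the equation
    would propagate the zero from each point to [theta] times it, hence down to
    [x0]. *)
Lemma first_core : 0 < core_mass theta a h.
Proof.
have cD y : core_bound theta a <= y <= 1 -> inD y.
  by move=> /andP[/(le_trans (core_bound_ge _ _)) -> ->].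
have c1 := core_bound_lt1 theta_range a_gtN1.
rewrite lt_def; apply/andP; split; last first.
  by apply: integ_ge0 => y /cD; exact: z0_pos.
apply/eqP => core0.
have zero := vanish (core_bound_ge theta a) c1 core0.
have x01 : x0 < 1 by rewrite gt_max ltr01 /=; have := a_gtN1; lra.
have [th|th] := leP theta 0.
  have := zero x0; rewrite h_base /core_bound ge_max.
  have -> : theta <= x0 by rewrite le_max th.
  by rewrite lexx ltW //= => /(_ isT)/eqP; rewrite oner_eq0.
have th1 : theta < 1 by case/andP: theta_range.
have down n x : Num.max (theta ^+ n.+1) x0 <= x <= 1 -> h x = 0.
  elim: n x => [|n IH] x xb.
    by apply: zero; rewrite /core_bound -[X in Num.max X _]expr1.
  have tn1 : theta ^+ n.+1 < 1 by rewrite exprn_ilt1 // ltW.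
  pose s := Num.max (theta ^+ n.+1) x0.
  have s1 : s < 1 by rewrite gt_max tn1.
  have sD : inD s by rewrite (ltW s1) andbT !le_max lexx !orbT.
  have hs : h s = 0 by apply: IH; rewrite lexx ltW.
  have := first_eigen sD; rewrite hs mulr0 => /eqP.
  rewrite mulf_eq0 invr_eq0 gt_eqF //= => /eqP int0.
  have /andP[cl1 cl2] := clamp_bounds (theta * s) a_gtN1.
  have ts1 : theta * s < 1.
    apply: le_lt_trans (_ : theta * 1 < 1); last by rewrite mulr1.
    by rewrite ler_pM2l // ltW.
  apply: (vanish cl1 _ int0).
    by rewrite /clamp gt_min gt_max ts1; have := a_gtN1; lra.
  case/andP: xb => xb ->; rewrite andbT; apply: le_trans xb.
  have x00 : 0 <= x0 by rewrite le_max lexx.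
  have ts : theta * s <= Num.max (theta ^+ n.+2) x0.
    rewrite le_max /s; have [_|_] := leP (theta ^+ n.+1) x0.
      by apply/orP; right; rewrite ler_piMl // ltW.
    by rewrite -exprS lexx.
  by rewrite /clamp ge_min ge_max ts /= !le_max lexx !orbT.
have /cvgrPdist_lt /(_ (1 / 2)) := @h_cont x0.
case; first by rewrite divr_gt0.
move=> e /= e0 he.
pose y := x0 + Num.min (e / 2) ((1 - x0) / 2).
have m0 : 0 < Num.min (e / 2) ((1 - x0) / 2).
  by rewrite lt_min !divr_gt0 // subr_gt0.
have me : Num.min (e / 2) ((1 - x0) / 2) <= e / 2 by rewrite ge_min lexx.
have m1 : Num.min (e / 2) ((1 - x0) / 2) <= (1 - x0) / 2 by rewrite ge_min lexx orbT.
have yx : x0 < y by rewrite ltrDl.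
have y0 : 0 < y by apply: le_lt_trans yx; rewrite le_max lexx.
have : `|h x0 - h y| < 1 / 2.
  apply: he; rewrite /ball_ /= /y opprD addrA subrr add0r normrN gtr0_norm //.
  by apply: le_lt_trans me _; move: e0; lra.
have /cvgrPdist_lt/(_ y y0) [N _ /(_ N.+1)] : (fun n => theta ^+ n) @ \oo --> 0.
  by apply: cvg_expr; rewrite gtr0_norm.
rewrite /= sub0r normrN gtr0_norm ?exprn_gt0 // => /(_ (leqnSn N)) ty.
rewrite h_base (down N y); first by rewrite subr0 normr1; lra.
by rewrite ge_max !ltW //=; move: m1 x01; rewrite /y; lra.
Qed.

Lemma first_pos x : inD x -> theta * x < 1 -> 0 < h x.
Proof.
move=> xD tx; have [c c0 hc] := eigen_lower theta_range a_gtN1 lam_gt0 h_cont z0_pos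
  first_eigen first_core.
apply: lt_le_trans (hc x xD); rewrite mulr_gt0 // /room lt_max subr_gt0 tx.
by rewrite orbT.
Qed.

Lemma first_Phi_pos s : - t <= s < 1 -> 0 < Phi (pw z0) s.
Proof.
move=> /andP[ts s1].
rewrite (fam_step PhiF) ?ts ?ltW //; last exact: geo_expr.
rewrite -/(charac Phi z0) z0_root add0r mulr_gt0 ?invr_gt0 //.
have -> : (fun y => Phi (shift (pw z0)) (clamp t (theta * y))) = fun y => z0 * h y.
  by apply: funext => y; rewrite shift_pw (PhiZ PhiF) //; exact: geo_expr.
rewrite integZ // mulr_gt0 //; apply: (integ_gt0 (c := 1)) => //.
- move=> y /andP[sy y1]; apply: z0_pos; rewrite y1 andbT (le_trans _ sy) //.
  by rewrite (le_trans _ ts) // lerN2.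
- by rewrite lexx andbT ltW.
- apply: first_pos; last by rewrite mulr1; case/andP: theta_range.
  by rewrite lexx andbT; have := a_gtN1; lra.
Qed.

(** The multiple of [h] to which the normalized iterates of [f] converge, read
    off at [x0], where [h] is 1. *)
Definition coeff_seq (f : R -> R) n := iter n.+1 T f x0 / lam ^+ n.+1.
Definition spectral_coeff (f : R -> R) := limn (coeff_seq f).
Local Notation L := spectral_coeff.

Lemma coeff_cvg (f : R -> R) : continuous f -> coeff_seq f @ \oo --> L f.
Proof.
move=> cf; have [l [e e0 he]] := transfer_converges theta_range a_gtN1 lam_gt0
  h_cont z0_pos first_eigen first_core cf.
have H : coeff_seq f @ \oo --> l.
  apply: (cvg_of_bound (k := 1) e0) => n; have := he n x0 x0D.
  by rewrite h_base !mulr1.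
by rewrite /L (cvg_lim _ H).
Qed.

Lemma coeffD (k l : R) (f g : R -> R) : continuous f -> continuous g ->
  L (fun x => k * f x + l * g x) = k * L f + l * L g.
Proof.
move=> cf cg; apply: cvg_lim => //.
have -> : coeff_seq (fun x => k * f x + l * g x) =
    fun n => k * coeff_seq f n + l * coeff_seq g n.
  apply: funext => n; rewrite /coeff_seq iter_transferD ?iter_transferZ //.
  - by rewrite mulrDl !mulrA.
  - exact: cont_scale.
  - exact: cont_scale.
by apply: cvgD; apply: cvgM; (exact: cvg_cst || exact: coeff_cvg).
Qed.

Lemma coeff_transfer (f : R -> R) : continuous f -> L (T f) = lam * L f.
Proof.
move=> cf; apply: cvg_lim => //.
have -> : coeff_seq (T f) = fun n => lam * coeff_seq f n.+1.
  apply: funext => n; rewrite /coeff_seq -iterSr [lam ^+ n.+2]exprS invfM.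
  by rewrite mulrCA mulVKf // gt_eqF.
apply: cvgM; first exact: cvg_cst.
have := coeff_cvg cf; rewrite -(cvg_shiftS (coeff_seq f)); exact.
Qed.

Lemma coeff_eq (f g : R -> R) : (forall x, inD x -> f x = g x) -> L f = L g.
Proof.
move=> fg; congr (limn _); apply: funext => n.
by rewrite /coeff_seq (eq_iter_transfer theta a_gtN1 _ fg).
Qed.

Lemma coeff_le (f g : R -> R) : continuous f -> continuous g ->
  (forall x, inD x -> f x <= g x) -> L f <= L g.
Proof.
move=> cf cg fg; apply: ler_cvg_to (coeff_cvg cf) (coeff_cvg cg) _.
near=> n; rewrite /coeff_seq ler_pM2r ?invr_gt0 ?exprn_gt0 //.
elim: n.+1 x0 x0D => [|k IH] x xD /=; first exact: fg.
by apply: le_transfer => //; exact: iter_transfer_continuous.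
Unshelve. all: by end_near. Qed.

Lemma coeff_eigen : L h = 1.
Proof.
apply: cvg_lim => //; have -> : coeff_seq h = fun=> 1; last exact: cvg_cst.
apply: funext => n; rewrite /coeff_seq (iter_eigen a_gtN1 h_cont first_eigen) //.
by rewrite h_base mulr1 divff // expf_neq0 // gt_eqF.
Qed.

Let cst_cont (k : R) : continuous (fun _ : R => k).
Proof. by move=> x; exact: cvg_cst. Qed.

(** The eigenfunction has coefficient 1 and lies below a constant. *)
Lemma coeff1_gt0 : 0 < L (fun=> 1).
Proof.
have [M M0 hM] := bounded_on_segment (- a) 1 h_cont.
have : L h <= L (fun x => M * 1 + 0 * 1).
  apply: (coeff_le h_cont (@cst_cont _)) => x /hM.
  by rewrite mulr1 mul0r addr0; apply: le_trans; exact: ler_norm.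
rewrite coeffD // coeff_eigen mul0r addr0 => H.
by rewrite -(pmulr_rgt0 _ M0) (lt_le_trans ltr01).
Qed.

(** Two real functions are the real and imaginary parts of a complex one. The
    iterates of the latter are powers of a complex number, and they converge only
    if that number is 1 or smaller than 1 in modulus. *)
Theorem root_modulus (al be : R) (p q : nat -> R) :
  p 0%N = 1 -> q 0%N = 0 ->
  (forall n, p n.+1 = al * p n - be * q n) ->
  (forall n, q n.+1 = be * p n + al * q n) ->
  Phi p 1 = 0 -> Phi q 1 = 0 ->
  (al = z0 /\ be = 0) \/ z0 ^+ 2 < al ^+ 2 + be ^+ 2.
Proof.
move=> p0 q0 pS qS rp rq.
have pq_bound n : `|p n| <= (`|al| + `|be|) ^+ n /\ `|q n| <= (`|al| + `|be|) ^+ n.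
  elim: n => [|n [IHp IHq]]; first by rewrite p0 q0 expr0 normr1 normr0 ler01.
  rewrite pS qS exprS mulrDl; split.
    by rewrite (le_trans (ler_normB _ _)) // !normrM lerD // ler_wpM2l.
  by rewrite (le_trans (ler_normD _ _)) // !normrM addrC lerD // ler_wpM2l.
have gp : geo p by exists 1, (`|al| + `|be|) => n; rewrite mul1r; case: (pq_bound n).
have gq : geo q by exists 1, (`|al| + `|be|) => n; rewrite mul1r; case: (pq_bound n).
have cp := pull_cont PhiF gp; have cq := pull_cont PhiF gq.
have ep x : inD x -> pull p x = al * T (pull p) x + (- be) * T (pull q) x.
  move=> xD; rewrite (pull_step t_gtN1 clampE PhiF) // rp add0r.
  rewrite -!transferZ // -transferD; try exact: cont_scale.
  apply: eq_transfer => // y _; rewrite -(pull_lin PhiF) //.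
  by congr (pull _ _); apply: funext => n; rewrite /shift pS mulNr.
have eq_ x : inD x -> pull q x = be * T (pull p) x + al * T (pull q) x.
  move=> xD; rewrite (pull_step t_gtN1 clampE PhiF) // rq add0r.
  rewrite -!transferZ // -transferD; try exact: cont_scale.
  apply: eq_transfer => // y _; rewrite -(pull_lin PhiF) //.
  by congr (pull _ _); apply: funext => n; rewrite /shift qS.
have cT f := @transfer_continuous _ theta _ a_gtN1 f.
pose A := al * lam; pose B := be * lam.
have L1 : L (pull p) = A * L (pull p) - B * L (pull q).
  rewrite {1}(coeff_eq ep) (@coeffD _ _ _ _ (cT _ cp) (cT _ cq)).
  by rewrite (coeff_transfer cp) (coeff_transfer cq) /A /B; ring.
have L2 : L (pull q) = B * L (pull p) + A * L (pull q).
  rewrite {1}(coeff_eq eq_) (@coeffD _ _ _ _ (cT _ cp) (cT _ cq)).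
  by rewrite (coeff_transfer cp) (coeff_transfer cq) /A /B; ring.
have [[A1 B0]|AB] := pselect (A = 1 /\ B = 0).
  have zn : z0 != 0 by rewrite gt_eqF.
  left; split; first by rewrite -[al](mulfVK zn) -/A A1 mul1r.
  by rewrite -[be](mulfVK zn) -/B B0 mul0r.
right.
have D0 : 0 < (1 - A) ^+ 2 + B ^+ 2.
  rewrite lt_def addr_ge0 ?sqr_ge0 // andbT paddr_eq0 ?sqr_ge0 //.
  rewrite !sqrf_eq0; apply/negP => /andP[/eqP h1 /eqP h2]; apply: AB; split => //.
  by move: h1; lra.
have Lp0 : L (pull p) = 0.
  apply/eqP; rewrite -(mulrI_eq0 _ (@lregP _ _ (lt0r_neq0 D0))); apply/eqP.
  move: L1 L2; move: (L (pull p)) (L (pull q)) => u v e1 e2.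
  have -> : ((1 - A) ^+ 2 + B ^+ 2) * u =
     (1 - A) * (u - (A * u - B * v)) - B * (v - (B * u + A * v)) by ring.
  by rewrite -e1 -e2; ring.
have Lq0 : L (pull q) = 0.
  apply/eqP; rewrite -(mulrI_eq0 _ (@lregP _ _ (lt0r_neq0 D0))); apply/eqP.
  move: L1 L2; move: (L (pull p)) (L (pull q)) => u v e1 e2.
  have -> : ((1 - A) ^+ 2 + B ^+ 2) * v =
     (1 - A) * (v - (B * u + A * v)) + B * (u - (A * u - B * v)) by ring.
  by rewrite -e1 -e2; ring.
rewrite ltNge; apply/negP => small.
pose N n := coeff_seq (pull p) n ^+ 2 + coeff_seq (pull q) n ^+ 2.
have AB1 : A ^+ 2 + B ^+ 2 <= 1.
  rewrite /A /B !exprMn -mulrDl exprVn ler_pdivrMr ?exprn_gt0 // mul1r.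
  exact: small.
have iterE n f g k l : continuous f -> continuous g ->
    forall s, (forall x, inD x -> s x = k * T f x + l * T g x) ->
    forall x, inD x -> iter n T s x = k * iter n.+1 T f x + l * iter n.+1 T g x.
  move=> cf cg s se x xD; rewrite (eq_iter_transfer theta a_gtN1 n se xD).
  rewrite (iter_transferD theta a_gtN1 n (@cont_scale _ k _ (cT _ cf)) (@cont_scale _ l _ (cT _ cg)) xD).
  rewrite (iter_transferZ theta a_gtN1 n k (cT _ cf) xD).
  by rewrite (iter_transferZ theta a_gtN1 n l (cT _ cg) xD) -!iterSr.
have NE n : N n = (A ^+ 2 + B ^+ 2) * N n.+1.
  rewrite /N /coeff_seq (iterE n.+1 _ _ _ _ cp cq _ ep x0 x0D).
  rewrite (iterE n.+1 _ _ _ _ cp cq _ eq_ x0 x0D).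
  rewrite [lam ^+ n.+2]exprSr !invfM /A /B.
  move: (iter n.+2 T (pull p) x0) (iter n.+2 T (pull q) x0) => u v.
  rewrite invrK; move: ((lam ^+ n.+1)^-1) => l.
  by field; rewrite gt_eqF.
have N0 : 1 <= N 0%N.
  have := iterE 0%N _ _ _ _ cp cq _ ep x0 x0D.
  have := iterE 0%N _ _ _ _ cp cq _ eq_ x0 x0D.
  rewrite /N /coeff_seq /= !(pull_base PhiF) // p0 q0 !expr1.
  move: (T (pull p) x0) (T (pull q) x0) => u v e2 e1.
  have <- : (A ^+ 2 + B ^+ 2) * ((u / lam) ^+ 2 + (v / lam) ^+ 2) = 1.
    have -> : (A ^+ 2 + B ^+ 2) * ((u / lam) ^+ 2 + (v / lam) ^+ 2) =
       (lam / lam) ^+ 2 * ((al * u + - be * v) ^+ 2 + (be * u + al * v) ^+ 2).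
      by rewrite /A /B; ring.
    by rewrite -e1 -e2 divff ?gt_eqF // !expr1n; ring.
  by rewrite ler_piMl // addr_ge0 ?sqr_ge0.
have N1 n : 1 <= N n.
  elim: n => // n IH; apply: le_trans IH _; rewrite NE.
  by rewrite ler_piMl // addr_ge0 ?sqr_ge0.
have : N @ \oo --> L (pull p) * L (pull p) + L (pull q) * L (pull q).
  have -> : N = fun n => coeff_seq (pull p) n * coeff_seq (pull p) n +
                         coeff_seq (pull q) n * coeff_seq (pull q) n.
    by apply: funext => n; rewrite /N !expr2.
  by apply: cvgD; apply: cvgM; exact: coeff_cvg.
rewrite Lp0 Lq0 mulr0 addr0 => /cvgrPdist_lt/(_ 1 ltr01)[K _ /(_ K (leqnn K))] /=.
rewrite sub0r normrN ger0_norm; first by rewrite ltNge N1.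
exact: le_trans (N1 _).
Qed.

(** Applying the spectral coefficient to the resolvent equation turns it into
    [(1 - z lam) L(g_z) = u(z) L(1)], so the zero of [u] is simple. *)
Theorem root_simple : exists2 c, 0 < c &
  exists2 d, 0 < d <= z0 & forall z, z0 - d <= z <= z0 -> c * (z0 - z) <= charac Phi z.
Proof.
have L10 := coeff1_gt0.
have [K K0 lip] := charac_lipschitz PhiF z0.
pose l1 := L (fun=> 1).
pose d := Num.min z0 (1 / (2 * K * l1)).
have d0 : 0 < d by rewrite lt_min z0_gt0 divr_gt0 // !mulr_gt0.
have dz : d <= z0 by rewrite ge_min lexx.
exists (lam / (2 * l1)); first by rewrite divr_gt0 // mulr_gt0.
exists d; first by rewrite d0.
move=> z /andP[zl zz0].
have z_ge0 : 0 <= z by move: dz; lra.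
have cz := pull_cont PhiF (geo_expr z : geo (pw z)).
have cT f := @transfer_continuous _ theta _ a_gtN1 f.
have e1 : (1 - z * lam) * L (pull (pw z)) = charac Phi z * l1.
  have : L (pull (pw z)) = L (fun x => charac Phi z * 1 + z * T (pull (pw z)) x).
    apply: coeff_eq => x xD; rewrite mulr1.
    exact: (resolvent t_gtN1 clampE PhiF).
  rewrite coeffD ?coeff_transfer //; last exact: cT.
  rewrite -/l1; move: (L (pull _)) => v ev.
  by rewrite mulrBl mul1r {1}ev; ring.
have e2 : 1 / 2 <= L (pull (pw z)).
  have : L (fun x => 1 * h x + (- (K * d)) * 1) <= L (pull (pw z)).
    apply: coeff_le => //.
      move=> x; apply: cvgD; last exact: cst_cont.
      by apply: cvgM; [exact: cst_cont|exact: h_cont].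
    move=> x xD; rewrite mul1r mulr1.
    have := lip z z0 (clamp t (theta * x)).
    rewrite z_ge0 zz0 ltW // lexx clamp_bounds // => /(_ isT isT isT).
    rewrite -/(pull (pw z) x) -/(h x) ler_norml => /andP[+ _].
    have : K * `|z - z0| <= K * d by rewrite ler_pM2l // ler_norml; lra.
    lra.
  rewrite coeffD // coeff_eigen -/l1 mul1r; apply: le_trans.
  have : d <= 1 / (2 * K * l1) by rewrite ge_min lexx orbT.
  rewrite ler_pdivlMr ?mulr_gt0 // => H.
  have -> : 1 + - (K * d) * l1 = 1 - d * (2 * K * l1) / 2 by field.
  lra.
have zl0 : 0 <= 1 - z * lam by rewrite subr_ge0 ler_pdivrMr // mul1r.
rewrite -(ler_pM2r L10) -/l1 -e1.
have -> : lam / (2 * l1) * (z0 - z) * l1 = (1 - z * lam) * (1 / 2).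
  by field; rewrite !gt_eqF.
by rewrite ler_wpM2l.
Qed.

End Spectrum.

(** * Deformed exponential series *)

Section ExpSeries.
Variable R : realType.
Variables theta a : R.
Hypothesis theta_range : -1 <= theta < 1.
Hypothesis a_gtN1 : -1 < a.
Implicit Types (r q : nat -> R) (s : R).

Local Notation B := (a + 1)^-1.
Let a1 : 0 < a + 1. Proof. by have := a_gtN1; lra. Qed.
Let B_gt0 : 0 < B. Proof. by rewrite invr_gt0. Qed.

Definition ecoef r n : R := theta ^+ 'C(n, 2) / n`!%:R * (- B) ^+ n * r n.

(** The deformed exponential of [- z s / (a + 1)], with the powers of [z]
    replaced by an arbitrary sequence. *)
Definition eseries r s : R := limn (pseries (ecoef r) s).

Let theta_norm : `|theta| <= 1.
Proof. by case/andP: theta_range => h1 h2; rewrite ler_norml h1 ltW. Qed.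

Lemma ecoef_bound r C K n s : (forall n, `|r n| <= C * K ^+ n) ->
  `|ecoef r n * s ^+ n| <= `|C| * exp_coeff (`|K| * B * `|s|) n.
Proof.
move=> rK; rewrite /ecoef /exp_coeff /= !normrM !normrX normrN normfV.
rewrite (gtr0_norm B_gt0) normr_nat !exprMn.
have rn : `|r n| <= `|C| * `|K| ^+ n.
  by rewrite (le_trans (rK n)) // (le_trans (ler_norm _)) // normrM normrX.
have th1 : `|theta| ^+ 'C(n, 2) <= 1 by rewrite exprn_ile1.
have f0 : 0 < n`!%:R^-1 :> R by rewrite invr_gt0 ltr0n fact_gt0.
have -> : `|C| * (`|K| ^+ n * B ^+ n * `|s| ^+ n / n`!%:R) =
  1 / n`!%:R * B ^+ n * (`|C| * `|K| ^+ n) * `|s| ^+ n by ring.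
have Bn : 0 < B ^+ n by rewrite exprn_gt0.
apply: ler_wpM2r; first exact: exprn_ge0.
apply: ler_pM => //.
  by apply: mulr_ge0; [apply: mulr_ge0; [exact: exprn_ge0|exact: ltW]|exact: ltW].
by rewrite ler_pM2r // ler_pM2r.
Qed.

Lemma eseries_cvg_norm r s : geo r ->
  cvgn [normed series (fun n => ecoef r n * s ^+ n)].
Proof.
move=> [C [K rK]].
apply: (@series_le_cvg _ _ (`|C| *: exp_coeff (`|K| * B * `|s|))) => [n|n|n|].
- exact: normr_ge0.
- by rewrite /= mulr_ge0 // exp_coeff_ge0 // !mulr_ge0 // ltW.
- exact: ecoef_bound.
- by apply: is_cvg_seriesZ; exact: is_cvg_series_exp_coeff.
Qed.

Lemma eseries_cvg r s : geo r -> cvgn (pseries (ecoef r) s).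
Proof. by move=> gr; apply: normed_cvg; exact: eseries_cvg_norm. Qed.

Definition dshift r n : R := - B * theta ^+ n * r n.+1.

Lemma geo_dshift r : geo r -> geo (dshift r).
Proof.
move=> [C [K rK]]; exists (B * (`|C| * `|K|)), `|K| => n; rewrite /dshift !normrM normrN.
rewrite (gtr0_norm B_gt0) normrX -!mulrA ler_pM2l //.
rewrite -[leRHS]mul1r; apply: ler_pM => //; rewrite ?exprn_ge0 ?exprn_ile1 //.
by rewrite -exprS (le_trans (rK _)) // (le_trans (ler_norm _)) // normrM normrX.
Qed.

Lemma pseries_diffs_ecoef r : pseries_diffs (ecoef r) = ecoef (dshift r).
Proof.
apply: funext => n; rewrite /pseries_diffs /ecoef /dshift binS bin1 exprD exprS factS.
rewrite natrM invfM; have n0 : n.+1%:R != 0 :> R by rewrite pnatr_eq0.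
move: (n`!%:R^-1 : R) => f; field; by rewrite nat1r n0 gt_eqF.
Qed.

Lemma eseries_dshift r s : geo r ->
  eseries (dshift r) s = - B * eseries (shift r) (theta * s).
Proof.
move=> gr; rewrite /eseries -[RHS]/(_ *: limn _) /pseries -lim_seriesZ; last first.
  exact/eseries_cvg/geo_shift.
congr (limn (series _)); apply: funext => n /=.
transitivity (- B * (ecoef (shift r) n * (theta * s) ^+ n)) => //.
by rewrite /ecoef /dshift /shift exprMn; ring.
Qed.

Lemma eseries_derive r s : geo r ->
  is_derive s (1 : R) (eseries r) (- B * eseries (shift r) (theta * s)).
Proof.
move=> gr; rewrite -eseries_dshift // /eseries -pseries_diffs_ecoef.
apply: (@pseries_snd_diffs _ _ (`|s| + 1)); rewrite ?pseries_diffs_ecoef.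
- exact: eseries_cvg.
- by apply: eseries_cvg; exact: geo_dshift.
- by apply: eseries_cvg; do 2 apply: geo_dshift.
- by rewrite [ltRHS]gtr0_norm ?ltrDl // ltr_wpDl.
Qed.

Lemma eseries_continuous r : geo r -> continuous (eseries r).
Proof.
move=> gr s; apply/differentiable_continuous/derivable1_diffP.
by have := @eseries_derive r s gr; case.
Qed.

Lemma eseries_lin k l r q s : geo r -> geo q ->
  eseries (fun n => k * r n + l * q n) s = k * eseries r s + l * eseries q s.
Proof.
move=> gr gq; rewrite /eseries -[X in X + _]/(_ *: limn _) -[X in _ + X]/(_ *: limn _).
rewrite /pseries -!lim_seriesZ; try exact: eseries_cvg.
rewrite -lim_seriesD; try by apply: is_cvg_seriesZ; exact: eseries_cvg.
congr (limn (series _)); apply: funext => n.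
transitivity (k * (ecoef r n * s ^+ n) + l * (ecoef q n * s ^+ n)) => //.
rewrite /ecoef /= ; set A := theta ^+ _; set D := n`!%:R; set F := (- B) ^+ n; set G := s ^+ n; ring.
Qed.

Lemma eseries0 r : eseries r 0 = r 0%N.
Proof.
apply: lim_near_cst => //; near=> m; rewrite -[m]prednK; last by near: m.
rewrite /pseries /series /= big_nat_recl // big1 ?addr0; last first.
  by move=> i _; rewrite exprS mul0r mulr0.
by rewrite /ecoef /= fact0 !expr0 !mul1r invr1 !mulr1 mul1r.
Unshelve. all: by end_near. Qed.

Lemma eseries_bound K S : exists C, forall r, (forall n, `|r n| <= K ^+ n) ->
  forall s, `|s| <= S -> `|eseries r s| <= C.
Proof.
exists (expR (`|K| * B * S)) => r rK s sS.
have rK' n : `|r n| <= 1 * K ^+ n by rewrite mul1r.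
have gr : geo r by exists 1, K.
have cn := @eseries_cvg_norm r s gr.
apply: (le_trans (@lim_series_norm R R^o _ cn)).
apply: le_trans (_ : expR (`|K| * B * `|s|) <= _); last first.
  by rewrite ler_expR ler_wpM2l // mulr_ge0 // ltW.
rewrite /expR; apply: lim_series_le.
- exact: eseries_cvg_norm.
- exact: is_cvg_series_exp_coeff.
- move=> n; have := ecoef_bound n s rK'.
  by rewrite normr1 mul1r.
Qed.

Lemma eseries_step r s1 s2 : geo r -> s1 <= s2 ->
  eseries r s1 = eseries r s2 +
    B * integ (fun y => eseries (shift r) (theta * y)) s1 s2.
Proof.
move=> gr s12.
have cE : continuous (fun y => eseries (shift r) (theta * y)).
  move=> y; apply: continuous_comp; last exact/eseries_continuous/geo_shift.
  by apply: cvgM; [exact: cvg_cst|exact: cvg_id].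
have := integ_FTC s12 (cont_scale cE) (fun s => @eseries_derive r s gr).
by rewrite integZ // => /eqP; rewrite mulNr eqr_oppLR opprB => /eqP ->; rewrite subrKC.
Qed.

Lemma itv_norm_bound t s : - t <= s <= 1 -> `|s| <= Num.max 1 `|t|.
Proof.
move=> /andP[ts s1]; rewrite ler_norml; apply/andP; split; last by rewrite le_max s1.
rewrite lerNl le_max; apply/orP; right; apply: le_trans (ler_norm t).
by rewrite lerNl.
Qed.

(** When [theta] maps [- t, 1] into itself the truncation is invisible, and the
    differential equation of the deformed exponential integrates to the resolvent
    equation. *)
Lemma eseries_family t : -1 < t ->
  (forall s, - t <= s <= 1 -> - t <= theta * s <= 1) ->
  clamp t (theta * Num.max 0 (- a)) = 0 ->
  family theta a t eseries.
Proof.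
move=> t1 stab base; split.
- exact: eseries_continuous.
- exact: eseries_lin.
- move=> r s gr /andP[ts s1]; rewrite (eseries_step gr s1); congr (_ + _ * _).
  apply: eq_integ => y /andP[sy y1]; rewrite clamp_id //; apply: stab.
  by rewrite y1 (le_trans ts).
- by move=> r gr; rewrite base eseries0.
- move=> K; have [C hC] := eseries_bound K (Num.max 1 `|t|).
  by exists C => r rK s /itv_norm_bound; exact: hC.
Qed.

(** For negative [theta] and small [a], points above [b = - a / theta] see the
    whole interval in one step, so the solution is affine there. *)
Definition bent_series r s : R :=
  let b := - a / theta in
  eseries r (Num.min s b) - B * Num.max 0 (s - b) * eseries (shift r) (- a).

Lemma bent_family : theta < 0 -> 0 < a -> a < - theta ->
  family theta a a bent_series.
Proof.
move=> th0 a0 ath; set b := - a / theta.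
have thb : theta * b = - a by rewrite /b mulrC divfK // lt_eqF.
have b0 : 0 < b by rewrite /b -mulrN1 -mulrA mulN1r -invrN pmulr_rgt0 // invr_gt0 oppr_gt0.
have b1 : b < 1.
  by rewrite -(ltr_nM2l th0) thb mulr1 ltrNr.
have thN1 : -1 <= theta by case/andP: theta_range.
have min_cont : continuous (fun s => Num.min s b : R).
  apply: (@lipschitz_continuous_real _ _ 1) => x y; rewrite mul1r.
  wlog xy : x y / x <= y => [hw|].
    by have [/hw //|/ltW/hw] := leP x y; rewrite distrC (distrC y).
  rewrite (distrC x) (ger0_norm (_ : 0 <= y - x)) ?subr_ge0 //.
  by rewrite ler_norml; apply/andP; split; minmax_lra.
have max_cont : continuous (fun s => Num.max 0 (s - b) : R).
  apply: (@lipschitz_continuous_real _ _ 1) => x y; rewrite mul1r.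
  wlog xy : x y / x <= y => [hw|].
    by have [/hw //|/ltW/hw] := leP x y; rewrite distrC (distrC y).
  rewrite (distrC x) (ger0_norm (_ : 0 <= y - x)) ?subr_ge0 //.
  by rewrite ler_norml; apply/andP; split; minmax_lra.
have bent_low r s : s <= b -> bent_series r s = eseries r s.
  by move=> sb; rewrite /bent_series -/b min_l // max_l ?subr_le0 // mulr0 mul0r subr0.
have bent_high r s : b <= s ->
    bent_series r s = eseries r b - B * (s - b) * eseries (shift r) (- a).
  by move=> sb; rewrite /bent_series -/b min_r // max_r ?subr_ge0.
have bent_cont r : geo r -> continuous (bent_series r).
  move=> gr s; apply: cvgB.
    by apply: continuous_comp; [exact: min_cont|exact: eseries_continuous].
  by apply: cvgM; last exact: cvg_cst; apply: cvgM; [exact: cvg_cst|exact: max_cont].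
split => //.
- move=> k l r q s gr gq; rewrite /bent_series -/b eseries_lin //.
  rewrite [eseries (shift _) _](@eseries_lin k l (shift r) (shift q)) //; try exact: geo_shift.
  by ring.
- move=> r s gr /andP[as_ s1]; set g := fun y => _.
  have aN1 : -1 < a := a_gtN1.
  have cg : continuous g.
    exact: (clamp_comp_continuous (bent_cont _ (geo_shift gr))).
  have high s' : b <= s' -> s' <= 1 -> bent_series r s' = bent_series r 1 + B * integ g s' 1.
    move=> bs' s1'; rewrite !bent_high ?(ltW b1) //.
    rewrite (@eq_integ _ _ (fun=> eseries (shift r) (- a))); last first.
      move=> y /andP[sy _]; rewrite /g clamp_low //; last first.
        by rewrite -thb ler_nM2l // (le_trans bs').
      by rewrite bent_low //; lra.
    by rewrite integ_cst //; ring.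
  have [bs|/ltW sb] := leP b s; first exact: high.
  rewrite (integ_split cg sb (ltW b1)) mulrDr addrCA -(high b) ?(ltW b1) //.
  rewrite !bent_low // (eseries_step gr sb) [LHS]addrC; congr (_ * _ + _).
  apply: eq_integ => y /andP[sy yb]; rewrite /g.
  have ya : - a <= theta * y by rewrite -thb ler_nM2l.
  have yb' : theta * y <= b.
    apply: le_trans (_ : theta * - a <= _).
      by rewrite ler_nM2l // (le_trans as_).
    rewrite mulrN -mulNr -(ler_nM2l th0) thb mulrA.
    have : theta * - theta >= -1.
      rewrite mulrN lerN2 -[leRHS]mulr1 -mulrNN ; nra.
    nra.
  by rewrite clamp_id ?bent_low // ya (le_trans yb') // ltW.
- move=> r gr; rewrite max_l; last by lra.
  rewrite mulr0 clamp_id; last by apply/andP; split; lra.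
  by rewrite bent_low ?eseries0 // ltW.
- move=> K; have [C hC] := eseries_bound K (Num.max 1 `|a|).
  have [C' hC'] := eseries_bound (`|K| + 1) (Num.max 1 `|a|).
  exists (`|C| + B * (1 - b + `|b| + `|a|) * (`|C'| * (`|K| + 1))) => r rK s sD.
  have sb_norm : `|Num.min s b| <= Num.max 1 `|a|.
    apply: itv_norm_bound; case/andP: sD => as_ s1.
    by rewrite le_min as_ ge_min s1 /=; lra.
  have C1 : `|eseries r (Num.min s b)| <= `|C|.
    exact: le_trans (hC r rK _ sb_norm) (ler_norm _).
  have gr : geo r by exists 1, K => n; rewrite mul1r.
  pose r1 n := (`|K| + 1)^-1 * shift r n.
  have K1 : 0 < `|K| + 1 by rewrite ltr_wpDl.
  have r1K n : `|r1 n| <= (`|K| + 1) ^+ n.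
    rewrite /r1 normrM gtr0_norm ?invr_gt0 // mulrC ler_pdivrMr // -exprSr.
    apply: le_trans (rK _) _; apply: le_trans (ler_norm _) _.
    by rewrite normrX lerXn2r ?nnegrE ?lerDl // ltW.
  have rE : eseries (shift r) (- a) = (`|K| + 1) * eseries r1 (- a).
    have gs := geo_shift gr.
    have gr1 : geo r1 by exists 1, (`|K| + 1) => n; rewrite mul1r.
    rewrite -[RHS]addr0 -(mul0r (eseries r1 (- a))) -eseries_lin //.
    congr (eseries _ _); apply: funext => n.
    by rewrite mul0r addr0 /r1 mulVKf // gt_eqF.
  have C2 : `|eseries (shift r) (- a)| <= `|C'| * (`|K| + 1).
    rewrite rE normrM (gtr0_norm K1) mulrC ler_wpM2r ?(ltW K1) //.
    apply: le_trans (hC' r1 r1K _ _) (ler_norm _).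
    by rewrite normrN le_max lexx orbT.
  rewrite /bent_series -/b; apply: le_trans (ler_normB _ _) _.
  apply: lerD => //; rewrite normrM; apply: ler_pM => //.
  rewrite normrM (gtr0_norm B_gt0) ler_pM2l // ger0_norm ?le_max ?lexx //.
  case/andP: sD => as_ s1; rewrite ge_max; apply/andP; split.
    by have := normr_ge0 b; have := normr_ge0 a; lra.
  by have := normr_ge0 b; have := normr_ge0 a; lra.
Qed.

End ExpSeries.

(** * Complex spectral parameters *)

Section ComplexRoots.
Variable R : realType.
Local Open Scope complex_scope.
Implicit Types (w z : R[i]).

Definition re_pow w n : R := complex.Re (w ^+ n).
Definition im_pow w n : R := complex.Im (w ^+ n).

Lemma re_powS w n :
  re_pow w n.+1 = complex.Re w * re_pow w n - complex.Im w * im_pow w n.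
Proof. by rewrite /re_pow /im_pow exprS; case: w (w ^+ n) => x y [u v]. Qed.

Lemma im_powS w n :
  im_pow w n.+1 = complex.Im w * re_pow w n + complex.Re w * im_pow w n.
Proof. by rewrite /re_pow /im_pow exprS; case: w (w ^+ n) => x y [u v] /=; rewrite addrC. Qed.

Lemma re_pow0 w : re_pow w 0 = 1. Proof. by []. Qed.
Lemma im_pow0 w : im_pow w 0 = 0. Proof. by []. Qed.

Lemma pow_geo w : geo (re_pow w) /\ geo (im_pow w).
Proof.
suff H n : `|re_pow w n| <= (`|complex.Re w| + `|complex.Im w|) ^+ n /\
           `|im_pow w n| <= (`|complex.Re w| + `|complex.Im w|) ^+ n.
  by split; exists 1, (`|complex.Re w| + `|complex.Im w|) => n; rewrite mul1r;
    case: (H n).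
elim: n => [|n [IHp IHq]]; first by rewrite re_pow0 im_pow0 expr0 normr1 normr0 ler01.
rewrite re_powS im_powS exprS mulrDl; split.
  by rewrite (le_trans (ler_normB _ _)) // !normrM lerD // ler_wpM2l.
by rewrite (le_trans (ler_normD _ _)) // !normrM addrC lerD // ler_wpM2l.
Qed.

Lemma re_pow_real (x : R) : re_pow x%:C = pw x.
Proof. by apply: funext => n; rewrite /re_pow /pw -rmorphXn. Qed.

Lemma im_pow_real (x : R) n : im_pow x%:C n = 0.
Proof. by rewrite /im_pow -rmorphXn. Qed.

Lemma sum_complex N (x y : nat -> R) :
  \sum_(0 <= i < N) (x i +i* y i) =
  (\sum_(0 <= i < N) x i) +i* (\sum_(0 <= i < N) y i).
Proof.
elim: N => [|N IH]; first by rewrite !big_nil.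
by rewrite !big_nat_recr //= IH.
Qed.

Lemma cvg_complex (x y : nat -> R) (l m : R) : x @ \oo --> l -> y @ \oo --> m ->
  (fun n => x n +i* y n : (R[i] : numFieldType)) @ \oo --> (l +i* m : (R[i] : numFieldType)).
Proof.
move=> /cvgrPdist_lt hx /cvgrPdist_lt hy; apply/cvgrPdist_lt => e.
rewrite ltcE /= => /andP[/eqP ie re].
have e2 : 0 < complex.Re e / 2 by rewrite divr_gt0.
near=> n.
have hxn : `|l - x n| < complex.Re e / 2 by near: n; exact: hx.
have hyn : `|m - y n| < complex.Re e / 2 by near: n; exact: hy.
have -> : e = (complex.Re e)%:C by move: ie; case: (e) => u v /= ->.
rewrite normc_def ltcR /=.
have rE : complex.Re e = Num.sqrt (complex.Re e ^+ 2) by rewrite sqrtr_sqr gtr0_norm.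
rewrite [ltRHS]rE ltr_sqrt ?exprn_gt0 //.
rewrite -(real_normK (num_real (l - _))) -(real_normK (num_real (m - _))).
clear rE.
move: hxn hyn; move: (normr_ge0 (l - x n)) (normr_ge0 (m - y n)).
move: (`|l - x n|) (`|m - y n|) (complex.Re e) => u v r u0 v0 ur vr.
have : u ^+ 2 < (r / 2) ^+ 2 by rewrite ltrXn2r ?nnegrE // (le_trans _ (ltW ur)).
have : v ^+ 2 < (r / 2) ^+ 2 by rewrite ltrXn2r ?nnegrE // (le_trans _ (ltW vr)).
have : 0 <= r ^+ 2 by exact: sqr_ge0.
rewrite !expr2; lra.
Unshelve. all: by end_near. Qed.

Lemma real_mul_complex (k u v : R) : k%:C * (u +i* v) = (k * u) +i* (k * v).
Proof. by apply/eqP; rewrite eq_complex /= !mul0r subr0 addr0 !eqxx. Qed.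

Variables theta a : R.
Hypothesis theta_range : -1 <= theta < 1.
Hypothesis a_gtN1 : -1 < a.

Local Notation B := (a + 1)^-1.

(** The complex series is thus a pair of values of the real family, which is how
    complex zeros enter the real theory. *)
Lemma cdeformed_eseries w (s : R) :
  cdeformed_exp theta (- (w * (s * B)%:C)) =
  eseries theta a (re_pow w) s +i* eseries theta a (im_pow w) s.
Proof.
have [gp gq] := pow_geo w.
rewrite /cdeformed_exp /deformed_exp.
apply: (@cvg_lim (R[i] : numFieldType)); first exact: norm_hausdorff.
have := cvg_complex (@eseries_cvg _ _ _ theta_range a_gtN1 _ s gp)
  (@eseries_cvg _ _ _ theta_range a_gtN1 _ s gq).
rewrite (_ : (fun n => _) = series (fun n : nat => theta%:C ^+ 'C(n, 2) / (n`!)%:R *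
  (- (w * (s * B)%:C)) ^+ n)) //.
apply: funext => N; rewrite -sum_complex; apply: eq_bigr => n _.
have -> : - (w * (s * B)%:C) = (- B * s)%:C * w.
  by rewrite mulNr rmorphN mulNr mulrC [s * B]mulrC.
rewrite exprMn -!rmorphXn.
rewrite -[n`!%:R]/((n`!%:R : R[i])) -(rmorph_nat (real_complex R)) -fmorphV -rmorphM mulrA -rmorphM.
rewrite /re_pow /im_pow /ecoef exprMn /=; case: (w ^+ n) => u v /=.
rewrite real_mul_complex.
by set A := theta ^+ _; set D := n`!%:R; set F := (- B) ^+ n; set G := s ^+ n;
  congr (_ +i* _); ring.
Qed.

End ComplexRoots.

(** * The geometry of the regions *)

Section RegionGeometry.
Variable R : realType.
Variables theta a : R.
Hypothesis theta_range : -1 <= theta < 1.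
Hypothesis a_gtN1 : -1 < a.

(** What the probabilistic and the analytic arguments need to know of a region:
    the points below [- t] are out of reach of the conditioned walk. *)
Record region_geometry (t : R) : Prop := RegionGeometry {
  geom_gtN1 : -1 < t;
  geom_le : t <= a;
  geom_clamp : forall x : R, - a <= x <= 1 ->
    clamp a (theta * x) = clamp t (theta * x);
  geom_space : forall x : R, state_space theta t x -> theta * x < 1;
  geom_stable : forall x1 x2 : R, state_space theta t x1 ->
    - a <= x2 <= 1 -> theta * x1 < x2 -> state_space theta t x2 }.

Lemma geometryP r : in_region r theta a -> region_geometry (region_t r theta a).
Proof.
have thN1 : -1 <= theta by case/andP: theta_range.
have th1 : theta < 1 by case/andP: theta_range.
have aN1 := a_gtN1.
(* regions with t = a: only the point 1 / theta can break stability *)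
have self : (forall x, state_space theta a x -> theta * x < 1) ->
    region_geometry a.
  move=> sp; split => // x1 x2 [/andP[ax1 x11] _] x2D tx; split => // th0 ath.
  have thn : theta < 0.
    rewrite lt_neqAle th0 leNgt; apply/negP => thp.
    have : theta * - a = 1 by rewrite ath divff.
    by nra.
  apply/eqP; rewrite gt_eqF //; apply: le_lt_trans tx.
  rewrite ath -(ler_nM2l thn) divff //.
  nra.
have neg x : theta < 0 -> a <= -1 / theta -> state_space theta a x -> theta * x < 1.
  move=> thn at_ [/andP[ax x1] xn]; have th0 : theta != 0 by rewrite lt_eqF.
  have e : -1 / theta * theta = -1 by rewrite divfK.
  have [xa|xa] := eqVneq x (- a).
    have : - a <> theta^-1 by move=> ae; apply: xn.
    move=> /eqP ane; have : a < -1 / theta.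
      by rewrite lt_neqAle at_ andbT; apply: contra_neq ane => ->; field.
    by rewrite xa -(ltr_nM2r thn) e; nra.
  have : - a < x by rewrite lt_neqAle eq_sym xa.
  by move: at_; rewrite -(ler_nM2r thn) e; nra.
case: r => /=.
- move=> [[/andP[th0 _] a0]|[/andP[_ thn] /andP[_ at_]]]; apply: self.
    by move=> x [/andP[ax x1] _]; nra.
  by move=> x; exact: neg.
- move=> [/andP[_ thn] at_].
  have th0 : theta != 0 by rewrite lt_eqF.
  have e : -1 / theta * theta = -1 by rewrite divfK.
  have e' : - (-1 / theta) = theta^-1 by rewrite mulN1r opprK.
  have i1 : theta^-1 <= theta by rewrite -(ler_nM2l thn) divff //; nra.
  have i0 : theta^-1 < 0 by rewrite invr_lt0.
  have t1 : 1 <= -1 / theta by rewrite -(ler_nM2r thn) e; nra.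
  split => //; first by lra.
  + move=> x /andP[ax x1]; rewrite /clamp e'.
    have tx : theta^-1 <= theta * x by nra.
    by rewrite (max_l tx) max_l //; apply: le_trans tx; rewrite -e' lerN2.
  + move=> x []; rewrite e' => /andP[tx _] xn.
    have {xn} : theta^-1 < x by rewrite lt_neqAle tx andbT eq_sym; apply/eqP; exact: xn.
    by rewrite -(ltr_nM2l thn) divff.
  + move=> x1 x2 []; rewrite e' => /andP[tx1 x11] _ /andP[ax2 x21] tx.
    have : theta^-1 < x2 by nra.
    by split; rewrite e'; [rewrite ltW|move=> _ _; apply/eqP; rewrite gt_eqF].
- move=> [/andP[_ thn] /andP[a0 ath]]; apply: self => x; apply: neg => //.
  by rewrite -(ler_nM2r thn) divfK ?lt_eqF //; nra.
- by move=> [/andP[th0 _] /andP[ath a0]]; apply: self => x [/andP[ax x1] _]; nra.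
- move=> [_ /andP[_]]; rewrite le_min => /andP[ath a0]; apply: self => x [/andP[ax x1] _].
  by have [?|?] := leP theta 0; nra.
- move=> [th0 a0]; split; [by rewrite ltrN10|by []| | | ].
  + by move=> x _; rewrite th0 mul0r !clamp_id ?oppr0 ?lexx ?ler01 ?oppr_le0 ?a0.
  + by move=> x _; rewrite th0 mul0r ltr01.
  + move=> x1 x2 _ /andP[_ x21]; rewrite th0 mul0r => x20.
    by split; rewrite ?oppr0 ?eqxx // ltW.
Qed.

(** [h] is prescribed on the whole line and may jump, whereas the operator acts on
    continuous functions; [g] is the continuous function that [h] agrees with on
    the state space. *)
Definition spectral_data (t lam : R) (h : R -> R) : Prop :=
  exists2 g : R -> R,
    [/\ 0 < lam, continuous g, forall x, - a <= x <= 1 -> 0 <= g x,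
        forall x, - a <= x <= 1 -> transfer theta a g x = lam * g x &
        0 < core_mass theta a g] &
    forall x, state_space theta t x -> h x = g x /\ 0 < h x.

Lemma trivial_spectral_data t lam (h : R -> R) : 0 < lam ->
  (forall x, - a <= x <= 1 -> (a + 1)^-1 * (1 - clamp a (theta * x)) = lam) ->
  (forall x, state_space theta t x -> h x = 1) -> spectral_data t lam h.
Proof.
move=> lam0 hT h1; have c1 : continuous (fun _ : R => 1 : R) by move=> x; exact: cvg_cst.
exists (fun=> 1); last by move=> x /h1 ->.
split => //.
  move=> x xD; rewrite /transfer integ_cst ?mul1r ?hT ?mulr1 //.
  by case/andP: (clamp_bounds (theta * x) a_gtN1).
have cb := core_bound_lt1 theta_range a_gtN1.
by rewrite /core_mass integ_cst ?mul1r ?subr_gt0 // ltW.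
Qed.

Section FromFamily.
Variables (t : R) (Phi : (nat -> R) -> R -> R).
Hypothesis geom : region_geometry t.
Hypothesis PhiF : family theta a t Phi.
Hypothesis theta_neq0 : theta != 0.
Hypothesis t_high : - t < 1.

(** The factor [k] allows for the normalization that is imposed on [h]. *)
Lemma family_spectral : exists z0, [/\ 0 < z0, charac Phi z0 = 0,
  forall s, - t <= s < 1 -> 0 < Phi (pw z0) s,
  (forall k, 0 < k -> spectral_data t z0^-1
     (fun x => k * pull theta t Phi (pw z0) x)) &
  (forall w : R[i], Phi (re_pow w) 1 = 0 -> Phi (im_pow w) 1 = 0 ->
     w <> z0%:C%C -> `|(z0%:C)%C : R[i]| < `|w|) /\
  (exists2 c, 0 < c & exists2 d, 0 < d <= z0 &
     forall z, z0 - d <= z <= z0 -> c * (z0 - z) <= charac Phi z)].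
Proof.
have [tN1 ta clampE space stable] := geom.
have [z0 [z0_gt0 root pos _]] := first_zero theta_range a_gtN1 tN1 clampE PhiF.
exists z0; split => //.
- exact: (first_Phi_pos theta_range a_gtN1 tN1 ta clampE PhiF z0_gt0 root pos).
- move=> k k0; have c := pull_cont PhiF (geo_expr z0).
  exists (fun x => k * pull theta t Phi (pw z0) x).
    split; rewrite ?invr_gt0 //.
    + exact: cont_scale.
    + by move=> x /pos ?; rewrite mulr_ge0 // ltW.
    + move=> x xD; rewrite (@transferZ _ _ _ k _ x c) [RHS]mulrCA; congr (_ * _).
      exact: (first_eigen tN1 clampE PhiF z0_gt0 root).
    + rewrite /core_mass integZ // mulr_gt0 //.
      exact: (first_core theta_range a_gtN1 tN1 clampE PhiF z0_gt0 root pos).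
  move=> x xE; split => //; rewrite mulr_gt0 //.
  apply: (first_pos theta_range a_gtN1 tN1 clampE PhiF z0_gt0 root pos).
    by case: xE => /andP[tx ->] _; rewrite andbT (le_trans _ tx) // lerN2.
  exact: space.
split.
  move=> w rp rq wz.
  have := root_modulus theta_range a_gtN1 tN1 clampE PhiF z0_gt0 root pos (re_pow0 w)
    (im_pow0 w) (re_powS w) (im_powS w) rp rq.
  case=> [[re im]|lt].
    by exfalso; apply: wz; move: re im; case: (w) => u v /= -> ->.
  rewrite !normc_def ltcR /= expr0n /= addr0 ltr_sqrt //.
  by apply: le_lt_trans lt; exact: sqr_ge0.
exact: (root_simple theta_range a_gtN1 tN1 clampE PhiF z0_gt0 root pos).
Qed.

Lemma pull_h_shape z0 k : 0 < k -> charac Phi z0 = 0 ->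
  (forall s, - t <= s < 1 -> 0 < Phi (pw z0) s) ->
  let h := fun x => k * pull theta t Phi (pw z0) x in
  [/\ forall x, 1 <= theta * x -> h x = 0,
      forall x, - t <= theta * x < 1 -> 0 < h x &
      forall x, theta * x < - t -> h x = h (- t / theta)].
Proof.
move=> k0 root pos h; have [tN1 _ _ _ _] := geom.
split=> x tx; rewrite /h /pull.
- by rewrite clamp_high // -/(charac Phi z0) root mulr0.
- by rewrite mulr_gt0 // clamp_id ?pos //; case/andP: tx => -> /ltW ->.
- have -> : theta * (- t / theta) = - t by rewrite mulrC divfK.
  by rewrite (clamp_low tN1 (ltW tx)) (clamp_low tN1 (lexx _)).
Qed.

End FromFamily.
End RegionGeometry.

(** * Eigenfunctions in the regions B, G, Y, W and T *)

Section SeriesRegions.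
Variable R : realType.
Variables theta a : R.
Hypothesis theta_range : -1 <= theta < 1.
Hypothesis a_gtN1 : -1 < a.
Local Open Scope complex_scope.

Local Notation B := (a + 1)^-1.
Local Notation E := (eseries theta a).

Definition region_spectrum r := exists (lam : R) (h : R -> R),
  [/\ lambda_spec r theta a lam, h_spec r theta a lam h &
      spectral_data theta a (region_t r theta a) lam h].

Lemma eseries_pw (z s : R) : E (pw z) s = deformed_exp theta (- (z * (s * B))).
Proof.
rewrite /eseries /deformed_exp /pseries; congr (limn (series _)); apply: funext => n.
have -> : - (z * (s * B)) = (- B) * z * s by ring.
by rewrite /ecoef /pw 2!exprMn !mulrA.
Qed.

Lemma complex_eq0 (x y : R) : x +i* y = 0 -> x = 0 /\ y = 0.
Proof. by case. Qed.

Lemma im_pow_real_series (z s : R) : E (im_pow z%:C) s = 0.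
Proof.
have -> : im_pow z%:C = fun n => 0 * pw z n + 0 * pw z n.
  by apply: funext => n; rewrite im_pow_real mul0r addr0.
rewrite eseries_lin ?mul0r ?addr0 //; exact: geo_expr.
Qed.

Lemma char_arg (w : R[i]) : - w / (a + 1)%:C = - (w * (1 * B)%:C).
Proof. by rewrite mul1r mulNr fmorphV. Qed.

Lemma series_spectrum r (t := region_t r theta a) :
  (r = RegB \/ r = RegG) -> in_region r theta a -> region_geometry theta a t ->
  theta != 0 -> - t < 1 ->
  (forall s, - t <= s <= 1 -> - t <= theta * s <= 1) ->
  clamp t (theta * Num.max 0 (- a)) = 0 ->
  region_spectrum r.
Proof.
move=> rBG reg geom th0 t1 stab base.
have tN1 := geom_gtN1 geom.
have PhiF := eseries_family theta_range a_gtN1 tN1 stab base.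
have [z0 [z0_gt0 root pos data [roots _]]] :=
  family_spectral theta_range a_gtN1 geom PhiF.
have lamS : smallest_abs [set z | cdeformed_exp theta (- z / (a + 1)%:C) = 0] (z0^-1^-1)%:C.
  rewrite invrK; split.
    rewrite /= char_arg cdeformed_eseries // im_pow_real_series re_pow_real.
    by rewrite [E _ _]root.
  move=> w /=; rewrite char_arg cdeformed_eseries // => /complex_eq0[rp rq].
  exact: roots.
exists z0^-1, (fun x => 1 * pull theta t E (pw z0) x); split.
- by case: rBG => ->.
- have [h1 h2 h3] := pull_h_shape geom th0 ltr01 root pos.
  split => //.
  have hf : forall x, - t <= theta * x < 1 ->
      1 * pull theta t E (pw z0) x = deformed_exp theta (- theta * x / (z0^-1 * (a + 1))).
    move=> x /andP[tx1 tx2]; rewrite mul1r /pull clamp_id ?tx1 ?ltW // eseries_pw.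
    by congr (deformed_exp _ _); rewrite invfM invrK; ring.
  by rewrite /t in hf *; case: rBG hf => ->.
- exact: data.
Qed.

Lemma spectrum_B : in_region RegB theta a -> region_spectrum RegB.
Proof.
move=> reg; have geom := geometryP theta_range a_gtN1 reg.
have thN1 : -1 <= theta by case/andP: theta_range.
have a0 : 0 <= a by case: reg => [[_ //]|[/andP[_ thn] /andP[at_ _]]]; lra.
apply: series_spectrum => //=; first by left.
- by case: reg => [[/andP[th0 _] _]|[/andP[_ thn] _]]; [rewrite gt_eqF|rewrite lt_eqF].
- by have := a_gtN1; lra.
- move=> s /andP[as_ s1].
  case: reg => [[/andP[th0 th1] _]|[/andP[_ thn] /andP[at1 at2]]].
    by apply/andP; split; nra.
  have : a * theta >= -1.
    by have := ler_nM2r thn (-1 / theta) a; rewrite divfK ?lt_eqF // at2 => ->.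
  by move=> ?; apply/andP; split; nra.
- rewrite max_l ?mulr0 ?clamp_id ?oppr_le0 ?a0 ?ler01 //.
Qed.

Lemma spectrum_G : in_region RegG theta a -> region_spectrum RegG.
Proof.
move=> reg; have geom := geometryP theta_range a_gtN1 reg.
have [/andP[thN1 thn] at_] := reg.
have th0 : theta != 0 by rewrite lt_eqF.
have e : -1 / theta * theta = -1 by rewrite divfK.
have t1 : 1 <= -1 / theta by rewrite -(ler_nM2r thn) e; nra.
apply: series_spectrum => //=; first by right.
- by lra.
- move=> s /andP[ts s1].
  move: (-1 / theta) e t1 ts => u e u1 us; apply/andP; split; nra.
- rewrite max_l ?mulr0 ?clamp_id ?ler01 ?andbT //; last by lra.
  by rewrite oppr_le0; lra.
Qed.

Lemma spectrum_Y : in_region RegY theta a -> region_spectrum RegY.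
Proof.
move=> reg; have geom := geometryP theta_range a_gtN1 reg.
have [/andP[thN1 thn] /andP[a0 ath]] := reg.
have th0 : theta != 0 by rewrite lt_eqF.
have PhiF := bent_family theta_range a_gtN1 thn a0 ath.
have aN1 := a_gtN1; have a1 : a + 1 != 0 by rewrite gt_eqF //; lra.
have a1C : (a + 1)%:C != 0 :> R[i] by rewrite fmorph_eq0.
have th0C : theta%:C != 0 :> R[i] by rewrite fmorph_eq0.
set b := - a / theta.
have thb : theta * b = - a by rewrite /b mulrC divfK.
have b0 : 0 < b by rewrite -(ltr_nM2l thn) thb mulr0; lra.
have b1 : b < 1 by rewrite -(ltr_nM2l thn) thb mulr1; lra.
have [z0 [z0_gt0 root pos data [roots _]]] :=
  family_spectral theta_range a_gtN1 geom PhiF.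
have low r s : s <= b -> bent_series theta a r s = E r s.
  by move=> sb; rewrite /bent_series -/b min_l // max_l ?subr_le0 // mulr0 mul0r subr0.
have top r : bent_series theta a r 1 = E r b - B * (1 - b) * E (shift r) (- a).
  by rewrite /bent_series -/b min_r ?(ltW b1) // max_r // subr_ge0 ltW.
have Dpos : 0 < E (pw z0) (- a).
  by rewrite -low; [apply: pos; rewrite /= lexx; lra|lra].
have argD (w : R[i]) : w * a%:C / (a + 1)%:C = - (w * (- a * B)%:C).
  by rewrite mulNr rmorphN mulrN opprK rmorphM fmorphV mulrA.
have argN (w : R[i]) : w * a%:C / (theta * (a + 1))%:C = - (w * (b * B)%:C).
  rewrite /b mulNr mulNr rmorphN mulrN opprK !rmorphM !fmorphV invfM.
  by rewrite !mulrA.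
have kap : (theta + a) / (theta * (a + 1)) = B * (1 - b).
  by rewrite /b; field; rewrite a1 th0.
have shift_re w : shift (re_pow w) =
    fun n => complex.Re w * re_pow w n + (- complex.Im w) * im_pow w n.
  by apply: funext => n; rewrite /shift re_powS mulNr.
have shift_im w : shift (im_pow w) =
    fun n => complex.Im w * re_pow w n + complex.Re w * im_pow w n.
  by apply: funext => n; rewrite /shift im_powS.
(* the numerator minus the right-hand side times the denominator *)
have key (w : R[i]) : cdeformed_exp theta (w * a%:C / (theta * (a + 1))%:C) -
    w * ((theta + a) / (theta * (a + 1)))%:C * cdeformed_exp theta (w * a%:C / (a + 1)%:C) =
    bent_series theta a (re_pow w) 1 +i* bent_series theta a (im_pow w) 1.
  have [gp gq] := pow_geo w.
  rewrite argD argN !cdeformed_eseries // !top kap shift_re shift_im.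
  rewrite !eseries_lin //; case: (w) => x y /=.
  move: (E _ b) (E _ b) (E _ (- a)) (E _ (- a)) => e1 e2 e3 e4.
  apply/eqP; rewrite eq_complex /=; apply/andP; split; apply/eqP; ring.
have lamS : smallest_abs
        [set z | cdeformed_exp theta (z * a%:C / (a + 1)%:C) <> 0 /\
                 cdeformed_exp theta (z * a%:C / (theta * (a + 1))%:C) /
                 cdeformed_exp theta (z * a%:C / (a + 1)%:C) =
                 z * ((theta + a) / (theta * (a + 1)))%:C] (z0^-1^-1)%:C.
  rewrite invrK; split => /=.
    have D0 : cdeformed_exp theta (z0%:C * a%:C / (a + 1)%:C) <> 0.
      rewrite argD cdeformed_eseries // re_pow_real => /complex_eq0[e _].
      by move: Dpos; rewrite e ltxx.
    split => //; apply/eqP; rewrite -subr_eq0; apply/eqP.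
    have := key z0%:C; rewrite re_pow_real [bent_series _ _ (pw _) _]root.
    have -> : bent_series theta a (im_pow z0%:C) 1 = 0.
      rewrite top im_pow_real_series.
      have -> : shift (im_pow z0%:C) = im_pow z0%:C.
        by apply: funext => n; rewrite /shift !im_pow_real.
      by rewrite im_pow_real_series mulr0 subr0.
    move=> /eqP; rewrite subr_eq0 => /eqP ->.
    by rewrite mulfK ?subrr //; apply/eqP.
  move=> w [D0 we] wz; apply: roots => //; have := key w; move/eqP: D0 => D0.
  - by rewrite -we divfK // subrr => /esym/complex_eq0[].
  - by rewrite -we divfK // subrr => /esym/complex_eq0[].
exists z0^-1, (fun x => 1 * pull theta a (bent_series theta a) (pw z0) x); split => //.
- have [h1 h2 h3] := pull_h_shape geom th0 ltr01 root pos.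
  split => //; split=> x /andP[tx1 tx2]; rewrite mul1r /pull.
    rewrite clamp_id ?tx1 /= ?(le_trans tx2) ?(ltW b1) // low // eseries_pw.
    by congr (deformed_exp _ _); rewrite invfM invrK; ring.
  rewrite clamp_id; last by rewrite (ltW tx2) andbT (le_trans _ (ltW tx1)) // -/b; lra.
  have := root; rewrite /charac top => root'.
  rewrite /bent_series -/b min_r ?(ltW tx1) // max_r ?subr_ge0 ?(ltW tx1) //.
  have -> : E (pw z0) b = B * (1 - b) * E (shift (pw z0)) (- a) by move: root'; lra.
  rewrite shift_pw; have -> : E (fun n => z0 * pw z0 n) (- a) = z0 * E (pw z0) (- a).
    rewrite -[RHS]addr0 -(mul0r (E (pw z0) (- a))) -eseries_lin //; try exact: geo_expr.
    by congr (eseries _ _ _ _); apply: funext => n; rewrite mul0r addr0.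
  rewrite eseries_pw; have -> : - (z0 * (- a * B)) = a / (z0^-1 * (a + 1)).
    by rewrite invfM invrK; ring.
  rewrite invfM invrK; ring.
- exact: data.
Qed.

Lemma spectrum_W : in_region RegW theta a -> region_spectrum RegW.
Proof.
move=> reg; have geom := geometryP theta_range a_gtN1 reg.
have [_ /andP[_]] := reg; rewrite le_min => /andP[ath a0].
have aN1 := a_gtN1; case/andP: theta_range => thN1 th1.
exists 1, (fun x => if theta * x < 1 then 1 else 0); split => //.
- split => /=.
  + by move=> x; rewrite ltNge => ->.
  + by move=> x /andP[_ ->].
  + move=> x tx; have -> : theta * x < 1 by lra.
    suff -> : theta * (- a / theta) < 1 by [].
    have [->|th0] := eqVneq theta 0; first by rewrite mul0r.
    by rewrite mulrC divfK //; lra.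
  + by move=> x ->.
- apply: trivial_spectral_data => //.
    move=> x /andP[ax x1]; rewrite clamp_low ?opprK 1?addrC ?mulVf //.
      by rewrite gt_eqF //; lra.
    by have [?|?] := leP theta 0; nra.
  by move=> x /(geom_space geom) ->.
Qed.

Lemma spectrum_T : in_region RegT theta a -> region_spectrum RegT.
Proof.
move=> [th0 a0]; have a1 : 0 < a + 1 by lra.
exists (1 / (a + 1)), (fun=> 1); split => //.
- split => //= x; first by rewrite th0 mul0r => /le_lt_trans/(_ ltr01); rewrite ltxx.
- apply: trivial_spectral_data => //; first by rewrite divr_gt0.
  move=> x _; rewrite th0 mul0r clamp_id ?oppr_le0 ?a0 ?ler01 //.
  by rewrite subr0 mulr1 mul1r.
Qed.

End SeriesRegions.

(** * The nested sums of region O *)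

Lemma bin2_shift (i k : nat) : ('C(i.+1, 2) + 'C(i + k, 2) = (i + k) * i + 'C(k, 2))%N.
Proof.
elim: i => [|i IH]; first by rewrite add0n muln0.
rewrite [in LHS]binS bin1 addSn [X in (_ + X)%N]binS bin1.
have : ((i.+1 + k) * i.+1 = (i + k) * i + (i + k) + i.+1)%N by lia.
by move: IH; lia.
Qed.

Lemma bin2_shift_diag (i j : nat) : (i <= j)%N ->
  ('C(j.+1, 2) + 'C(j - i, 2) = 'C(i.+1, 2) + j * (j - i))%N.
Proof.
move=> ij; have := bin2_shift i (j - i); rewrite subnKC //.
have := bin2_shift j 0; rewrite (_ : 'C(0, 2) = 0)%N // !addn0.
rewrite mulnBr; have : (j * i <= j * j)%N by rewrite leq_mul2l ij orbT.
move: (j * j)%N (j * i)%N => u v; lia.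
Qed.

Section Compositions.
Variable R : realType.
Variables (theta lam a : R).
Hypothesis theta_neq0 : theta != 0.
Hypothesis mu_neq0 : lam * (a + 1) != 0.
Hypothesis a_neq0 : a != 0.

Local Notation beta := (a / (lam * (a + 1))).
Local Notation s := (O_s theta lam a).

Let beta_neq0 : beta != 0.
Proof. by rewrite mulf_neq0 // invr_neq0. Qed.

Definition telescoped (N i : nat) : R :=
  theta ^ ('C(i.+1, 2)%:Z - (N * i)%:Z) * beta ^+ i / i`!%:R.

Definition wcoef (k : nat) : R := (- beta) ^+ k / theta ^+ 'C(k, 2) / k`!%:R.
Definition wsum (n : nat) : R := \sum_(k < n.+1) wcoef k.

(** The factors of the nested sum telescope. Summation by parts then reduces the
    recursion for the partial sums [wsum] to the vanishing of the binomial sum for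
    [(1 - 1) ^ N]. *)
Lemma O_sE N i : s N i = telescoped N i - telescoped N i.+1.
Proof.
rewrite /O_s /telescoped.
have -> : lam * (a + 1) * i.+1%:R / a = i.+1%:R / beta.
  by rewrite invf_div mulrAC mulrC mulrA.
have -> : theta ^ ('C(i.+2, 2)%:Z - (N * i.+1)%:Z) =
    theta ^ ('C(i.+1, 2)%:Z - (N * i)%:Z) * theta ^ (i.+1%:Z - N%:Z).
  by rewrite -expfzDr //; congr (_ ^ _); rewrite [in LHS]binS bin1; lia.
have b0 := beta_neq0; rewrite factS natrM.
have i1 : i.+1%:R != 0 :> R by rewrite pnatr_eq0.
have f1 : i`!%:R != 0 :> R by rewrite pnatr_eq0 -lt0n fact_gt0.
move: (beta) b0 => b b0; rewrite exprS; move: (b ^+ i) (i`!%:R) f1 (i.+1%:R : R) i1.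
move: (theta ^ _) (theta ^ _) => x y bi f f0 n n0.
by field; rewrite ?b0 ?n0 ?f0.
Qed.

Lemma telescoped_wcoef N i : (i <= N)%N ->
  telescoped N i * wcoef (N - i) =
  (theta ^+ 'C(N, 2))^-1 / N`!%:R * ((- beta) ^+ (N - i) * beta ^+ i *+ 'C(N, i)).
Proof.
move=> iN; rewrite /telescoped /wcoef.
have e := bin2_shift i (N - i); rewrite subnKC // in e.
have -> : theta ^ ('C(i.+1, 2)%:Z - (N * i)%:Z) =
    theta ^+ 'C(N - i, 2) / theta ^+ 'C(N, 2).
  have -> : 'C(i.+1, 2)%:Z - (N * i)%:Z = 'C(N - i, 2)%:Z - 'C(N, 2)%:Z by lia.
  by rewrite expfzDr // -exprnN.
have fE : ('C(N, i)%:R : R) / N`!%:R = 1 / (i`!%:R * (N - i)`!%:R).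
  rewrite -(bin_fact iN) natrM natrM; field.
  by rewrite !pnatr_eq0 -!lt0n !fact_gt0 bin_gt0 iN.
rewrite -[X in _ = _ * X]mulr_natr.
have -> : (theta ^+ 'C(N, 2))^-1 / N`!%:R * ((- beta) ^+ (N - i) * beta ^+ i * 'C(N, i)%:R) =
  (theta ^+ 'C(N, 2))^-1 * ((- beta) ^+ (N - i) * beta ^+ i) * ('C(N, i)%:R / N`!%:R).
  by ring.
rewrite fE [(i`!%:R * _)^-1]invfM.
have t0 : theta ^+ 'C(N - i, 2) != 0 by rewrite expf_neq0.
move: (theta ^+ 'C(N - i, 2)) t0 ((theta ^+ 'C(N, 2))^-1) (i`!%:R^-1 : R)
  ((N - i)`!%:R^-1 : R) ((- beta) ^+ _) (beta ^+ _) => x x0 y f g u v.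
by field.
Qed.

Lemma sum_telescoped_wcoef N : (0 < N)%N ->
  \sum_(i < N.+1) telescoped N i * wcoef (N - i) = 0.
Proof.
move=> N0; under eq_bigr => i _ do rewrite telescoped_wcoef -1?ltnS //.
by rewrite -mulr_sumr -exprDn addNr expr0n gtn_eqF // mulr0.
Qed.

Lemma wsum_rec N : (0 < N)%N ->
  wsum N = \sum_(i < N) s N i * wsum (N.-1 - i).
Proof.
move=> N0; have A0 : telescoped N 0 = 1.
  by rewrite /telescoped muln0 bin_small // subrr expr0z fact0 expr0 invr1 !mulr1.
under eq_bigr => i _ do rewrite O_sE mulrBl.
rewrite sumrB.
have -> : \sum_(i < N) telescoped N i.+1 * wsum (N.-1 - i) =
    \sum_(i < N.+1) telescoped N i * wsum (N - i) - wsum N.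
  rewrite big_ord_recl subn0 A0 mul1r addrAC subrr add0r.
  apply: eq_bigr => i _; rewrite lift0; congr (_ * wsum _); have := ltn_ord i; lia.
have -> : \sum_(i < N) telescoped N i * wsum (N.-1 - i) =
    \sum_(i < N.+1) telescoped N i * (wsum (N - i) - wcoef (N - i)).
  rewrite [RHS]big_ord_recr /= subnn.
  rewrite {3}/wsum big_ord_recl big_ord0 addr0 subrr mulr0 addr0.
  apply: eq_bigr => i _; congr (_ * _).
  have -> : (N - i = (N.-1 - i).+1)%N by have := ltn_ord i; lia.
  by rewrite {2}/wsum big_ord_recr /= addrK.
under [X in X - _]eq_bigr => i _ do rewrite mulrBr.
by rewrite sumrB sum_telescoped_wcoef // subr0 opprB addrC subrK.
Qed.

Definition comp_sum (K N l : nat) : R :=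
  \sum_(f : {ffun 'I_l -> 'I_K} | (\sum_j f j + l == N)%N)
    \prod_(r < l) s (N - r - \sum_(j < l | (j < r)%N) f j)%N (f r).

Lemma comp_sum0 K N : comp_sum K N 0 = (N == 0%N)%:R.
Proof.
rewrite /comp_sum; have [->|N0] := eqVneq N 0%N.
  rewrite (eq_bigl xpredT); last by move=> f; rewrite big_ord0.
  rewrite (eq_bigr (fun=> 1)); last by move=> f _; rewrite big_ord0.
  by rewrite sumr_const (_ : #|_| = 1%N) // -[RHS](expn0 K) -[X in (K ^ X)%N]card_ord -[X in (X ^ _)%N]card_ord -card_ffun; apply: eq_card.
by rewrite big_pred0 // => f; rewrite big_ord0 addn0 eq_sym (negbTE N0).
Qed.

Definition ffun_cons (K l : nat) (u : 'I_K * {ffun 'I_l -> 'I_K}) : {ffun 'I_l.+1 -> 'I_K} :=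
  [ffun r => if unlift ord0 r is Some r' then u.2 r' else u.1].

Definition ffun_uncons (K l : nat) (f : {ffun 'I_l.+1 -> 'I_K}) :
  'I_K * {ffun 'I_l -> 'I_K} := (f ord0, [ffun r => f (lift ord0 r)]).

Lemma ffun_consK K l : cancel (@ffun_cons K l) (@ffun_uncons K l).
Proof.
case=> i f; rewrite /ffun_uncons /ffun_cons ffunE unlift_none; congr (_, _).
by apply/ffunP => r; rewrite !ffunE liftK.
Qed.

Lemma ffun_unconsK K l : cancel (@ffun_uncons K l) (@ffun_cons K l).
Proof.
move=> f; apply/ffunP => r; rewrite ffunE /=.
by case: unliftP => [j ->|->]; rewrite ?ffunE.
Qed.

Lemma comp_sumS K N l :
  comp_sum K N l.+1 = \sum_(i < K | (i < N)%N) s N i * comp_sum K (N.-1 - i) l.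
Proof.
rewrite /comp_sum (reindex (@ffun_cons K l)); last first.
  by exists (@ffun_uncons K l) => u _; [exact: ffun_consK|exact: ffun_unconsK].
under [RHS]eq_bigr => i _ do rewrite mulr_sumr.
rewrite [RHS]pair_big_dep /=; apply: eq_big => [[i f]|[i f]] /=.
  rewrite big_ord_recl /ffun_cons ffunE unlift_none /=.
  under eq_bigr => j _ do rewrite ffunE liftK /=.
  by apply/idP/andP => [/eqP e|[h /eqP e]]; [split; [|apply/eqP]|apply/eqP]; lia.
move=> _; rewrite big_ord_recl /ffun_cons ffunE unlift_none /= subn0.
rewrite big1 ?subn0 //.
congr (_ * _); apply: eq_bigr => r _; rewrite ffunE liftK /=; congr (s _ _).
rewrite big_mkcond big_ord_recl ffunE unlift_none /= [in RHS]big_mkcond /=.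
have bE k : bump 0 k = k.+1 by [].
rewrite bE; under eq_bigr => j _ do rewrite bE ffunE liftK ltnS.
by move: (\sum_(_ < l) _)%N => S; lia.
Qed.

Lemma comp_sum_large K N l : (N < l)%N -> comp_sum K N l = 0.
Proof.
by move=> Nl; rewrite /comp_sum big_pred0 // => f; apply/eqP; lia.
Qed.

(** Splitting a composition of [N] at its first part gives the recursion that
    [wsum] satisfies. *)
Lemma sum_comp_sum K N M : (N < K)%N -> (N <= M)%N ->
  \sum_(l < M.+1) comp_sum K N l = wsum N.
Proof.
elim/ltn_ind: N M => N IH M NK NM.
rewrite big_ord_recl comp_sum0; have [N0|N0] := posnP N.
  rewrite N0 big1 => [|l _]; last by apply: comp_sum_large; rewrite lift0.
  by rewrite /wsum big_ord_recl big_ord0 /wcoef fact0 !expr0 !invr1 !mulr1.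
rewrite add0r wsum_rec //.
under eq_bigr => l _ do rewrite lift0 comp_sumS.
rewrite exchange_big /=.
rewrite (big_ord_widen K (fun i => s N i * wsum (N.-1 - i))) ?(ltnW NK) //.
apply: eq_bigr => i iN; rewrite -mulr_sumr; congr (_ * _).
have := IH (N.-1 - i)%N _ M.-1; case: M NM => [|M] NM; first by lia.
by move=> /= -> //; lia.
Qed.

Local Notation nu := (-1 / (lam * (a + 1))).

Definition dcoef (i : nat) : R := nu ^+ i * (theta ^+ 'C(i.+1, 2) / i`!%:R).

Lemma O_cE (m i : nat) : (i <= m)%N ->
  O_c theta lam a m i = -1 / (O_u theta a)^`().[1 / lam] *
    (dcoef i * wsum (m - i)).
Proof.
move=> im; rewrite /O_c /dcoef -!mulrA; congr (_ * (_ * (_ * (_ * (_ * _))))).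
rewrite -(@sum_comp_sum m.+1 (m - i) (m - i)) ?ltnS ?leq_subr //.
apply: eq_bigr => l _; apply: eq_bigl => f.
by rewrite -[RHS](eqn_add2r i) subnK.
Qed.

Lemma dcoef_wcoef (i j : nat) : (i <= j)%N ->
  dcoef i * wcoef (j - i) = dcoef j * ((a / theta ^+ j) ^+ (j - i) *+ 'C(j, i)).
Proof.
move=> ij; rewrite /dcoef /wcoef -[(a / _) ^+ _ *+ _]mulr_natr.
have fE : ('C(j, i)%:R : R) / j`!%:R = 1 / (i`!%:R * (j - i)`!%:R).
  rewrite -(bin_fact ij) natrM natrM; field.
  by rewrite !pnatr_eq0 -!lt0n !fact_gt0 bin_gt0 ij.
have nuE : nu ^+ j = nu ^+ i * nu ^+ (j - i) by rewrite -exprD subnKC.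
have be : - beta = nu * a by rewrite mulN1r mulNr mulrC.
have t1 : theta ^+ 'C(j - i, 2) != 0 by rewrite expf_neq0.
have t2 : theta ^+ (j * (j - i)) != 0 by rewrite expf_neq0.
have te : theta ^+ 'C(j.+1, 2) =
    theta ^+ 'C(i.+1, 2) * theta ^+ (j * (j - i)) / theta ^+ 'C(j - i, 2).
  by rewrite -exprD -(bin2_shift_diag ij) exprD mulfK.
rewrite be nuE te; move: (nu) => v; rewrite !exprMn exprVn -exprM.
transitivity (v ^+ i * v ^+ (j - i) * (theta ^+ 'C(i.+1, 2) * theta ^+ (j * (j - i)) /
   theta ^+ 'C(j - i, 2)) * (a ^+ (j - i) / theta ^+ (j * (j - i))) *
   ('C(j, i)%:R / j`!%:R)); last first.
  move: (v ^+ _) (v ^+ _) (theta ^+ _) (theta ^+ _) ((theta ^+ _)^-1) ((theta ^+ _)^-1).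
  by move: (a ^+ _) (j`!%:R^-1) ('C(j, i)%:R : R) => *; ring.
rewrite fE [(i`!%:R * _)^-1]invfM.
move: (theta ^+ (j * _)) t2 => y y0.
move: ((theta ^+ 'C(j - i, 2))^-1) (theta ^+ 'C(i.+1, 2)) (v ^+ i) (v ^+ _) (a ^+ _).
move: (i`!%:R^-1 : R) ((j - i)`!%:R^-1 : R) => *.
by field.
Qed.

(** The same polynomial in expanded form, centred at the breakpoints
    [- a / theta ^+ j]. *)
Lemma O_c_poly (m : nat) (x : R) :
  \sum_(i < m.+1) O_c theta lam a m i * x ^+ i = -1 / (O_u theta a)^`().[1 / lam] *
  \sum_(j < m.+1) dcoef j * (x + a / theta ^+ j) ^+ j.
Proof.
rewrite (eq_bigr (fun i : 'I_m.+1 => -1 / (O_u theta a)^`().[1 / lam] *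
    (dcoef i * (wsum (m - i) * x ^+ i)))); last first.
  by move=> i _; rewrite (O_cE (ltn_ord i : i <= m)%N) -!mulrA.
rewrite -mulr_sumr; congr (_ * _).
have term j : \sum_(i < j.+1) dcoef i * (wcoef (j - i) * x ^+ i) =
    dcoef j * (x + a / theta ^+ j) ^+ j.
  rewrite [x + _]addrC exprDn mulr_sumr; apply: eq_bigr => i _.
  by rewrite mulrA dcoef_wcoef -1?ltnS // -mulrA -mulrnAl.
elim: m => [|m IH].
  by rewrite !big_ord_recl !big_ord0 !addr0 -term big_ord_recl big_ord0 addr0
     /wsum big_ord_recl big_ord0 addr0.
rewrite [RHS]big_ord_recr /= -IH -term !big_ord_recr /= subnn addrA; congr (_ + _).
  have wS n : wsum n.+1 = wsum n + wcoef n.+1 by rewrite /wsum big_ord_recr.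
  rewrite addrACA -big_split /=; congr (_ + _).
    by apply: eq_bigr => i _; rewrite subSn ?(ltnW (ltn_ord i)) // wS mulrDl mulrDr.
  by rewrite subSn // wS mulrDl mulrDr.
by rewrite /wsum big_ord_recl big_ord0 addr0.
Qed.

End Compositions.

(** * The piecewise polynomial family of region O *)

Section PolynomialFamily.
Variable R : realType.
Variables theta a : R.
Hypothesis theta_gt0 : 0 < theta.
Hypothesis theta_lt1 : theta < 1.
Hypothesis a_ge : - theta <= a.
Hypothesis a_lt0 : a < 0.

Local Notation B := (a + 1)^-1.
Local Notation p := (O_p theta a).

Let a_gtN1 : -1 < a. Proof. by have := a_ge; have := theta_lt1; lra. Qed.
Let a1 : 0 < a + 1. Proof. by have := a_gtN1; lra. Qed.
Let B_gt0 : 0 < B. Proof. by rewrite invr_gt0. Qed.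
Let theta0 : theta != 0. Proof. by rewrite gt_eqF. Qed.
Let theta_range : -1 <= theta < 1.
Proof. by rewrite theta_lt1 andbT; have := theta_gt0; lra. Qed.

Lemma O_pP : - a <= theta ^+ p /\ theta ^+ p.+1 < - a.
Proof.
have na : 0 < - a by rewrite oppr_gt0.
have [N small] : exists N, theta ^+ N < - a.
  have /cvgrPdist_lt/(_ _ na) [N _ /(_ N (leqnn N))] : (fun n => theta ^+ n) @ \oo --> 0.
    by apply: cvg_expr; rewrite gtr0_norm.
  by rewrite /= sub0r normrN gtr0_norm ?exprn_gt0 // => ?; exists N.
pose q := ex_minn (ex_intro (fun n => theta ^+ n < - a) N small).
have [hq qmin] : theta ^+ q < - a /\ forall m, theta ^+ m < - a -> (q <= m)%N.
  by rewrite /q; case: ex_minnP.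
have q0 : (0 < q)%N.
  rewrite lt0n; apply/eqP => q0; move: hq; rewrite q0 expr0.
  by have := a_gtN1; lra.
have H : [set n | - a <= theta ^+ n /\ forall m : nat, - a <= theta ^+ m -> (m <= n)%N] q.-1.
  split.
    by rewrite leNgt; apply/negP => /qmin; rewrite -ltnS prednK // ltnn.
  move=> m hm; rewrite -ltnS prednK // ltnNge; apply/negP => qm.
  have : theta ^+ m <= theta ^+ q by rewrite ler_wiXn2l // ltW.
  by move: hm hq; lra.
have [h1 h2] := xgetPex 0%N (ex_intro _ _ H).
split; first exact: h1.
by rewrite ltNge; apply/negP => /h2; rewrite ltnn.
Qed.

Lemma O_p_gt0 : (0 < p)%N.
Proof.
rewrite lt0n; apply/eqP => p0; have [_] := O_pP; rewrite p0 expr1.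
by have := a_ge; lra.
Qed.

Definition break j : R := a * theta / theta ^+ j.
Definition oterm j (s : R) : R := Num.max 0 (s + break j) ^+ j.
Definition ocoef j : R := (- B) ^+ j * theta ^+ 'C(j, 2) / j`!%:R.
(** The terms of the deformed exponential, each centred at its own breakpoint: the
    truncation of the walk at [- a] switches a new term on at each of them. *)
Definition oseries (r : nat -> R) (s : R) : R :=
  \sum_(j < p.+2) ocoef j * r j * oterm j s.

Lemma breakS j : break j.+1 = a / theta ^+ j.
Proof. by rewrite /break exprS invfM mulrA mulfK. Qed.

Lemma break_le j : (0 < j)%N -> break j <= a.
Proof.
case: j => // j _; rewrite breakS -[leRHS]mulr1 ler_nM2l //.
by rewrite invf_ge1 ?exprn_gt0 // exprn_ile1 ?ltW.
Qed.

Lemma break_in j : (j <= p)%N -> 0 <= 1 + break j.+1.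
Proof.
move=> jp; rewrite breakS.
have tj : 0 < theta ^+ j by rewrite exprn_gt0.
have -> : 1 + a / theta ^+ j = (theta ^+ j + a) / theta ^+ j by rewrite mulrDl divff // gt_eqF.
apply: divr_ge0; last exact: ltW.
have [h _] := O_pP.
have : theta ^+ p <= theta ^+ j by rewrite ler_wiXn2l // ltW.
by move: h; lra.
Qed.

Lemma break_out : 1 + break p.+2 < 0.
Proof.
rewrite breakS; have tj : 0 < theta ^+ p.+1 by rewrite exprn_gt0.
have -> : 1 + a / theta ^+ p.+1 = (theta ^+ p.+1 + a) / theta ^+ p.+1.
  by rewrite mulrDl divff // gt_eqF.
by rewrite pmulr_llt0 ?invr_gt0 //; have [_ h] := O_pP; lra.
Qed.

Lemma pos_part_continuous (c : R) k : continuous (fun y : R => Num.max 0 (y + c) ^+ k).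
Proof.
move=> y; apply: (@continuous_comp _ _ _ (fun y => Num.max 0 (y + c)) (fun x => x ^+ k));
  last exact: exprn_continuous.
move: y; apply: (@lipschitz_continuous_real _ _ 1) => x y; rewrite mul1r.
wlog xy : x y / x <= y => [hw|].
  by have [/hw //|/ltW/hw] := leP x y; rewrite distrC (distrC y).
rewrite (distrC x) (ger0_norm (_ : 0 <= y - x)) ?subr_ge0 //.
by rewrite ler_norml; apply/andP; split; minmax_lra.
Qed.

Lemma oterm_continuous j : continuous (oterm j).
Proof. exact: pos_part_continuous. Qed.

Lemma sum_continuous n (f : 'I_n -> R -> R) : (forall i, continuous (f i)) ->
  continuous (fun y => \sum_(i < n) f i y).
Proof.
elim: n f => [|n IH] f cf.
  by rewrite (_ : (fun _ => _) = fun=> 0); [move=> y; exact: cvg_cst|apply: funext => y; rewrite big_ord0].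
rewrite (_ : (fun _ => _) = fun y => \sum_(i < n) f (widen_ord (leqnSn n) i) y + f ord_max y).
  by move=> y; apply: cvgD; [exact: (IH (fun i => f (widen_ord (leqnSn n) i)))|exact: cf].
by apply: funext => y; rewrite big_ord_recr.
Qed.

Lemma integ_sum n (f : 'I_n -> R -> R) (u v : R) : (forall i, continuous (f i)) ->
  integ (fun y => \sum_(i < n) f i y) u v = \sum_(i < n) integ (f i) u v.
Proof.
elim: n f => [|n IH] f cf.
  rewrite big_ord0 (@eq_integ _ _ (fun=> 0)); last by move=> x _; rewrite big_ord0.
  by rewrite /integ Rintegral_cst //= mul0r.
rewrite big_ord_recr /= -(IH (fun i => f (widen_ord (leqnSn n) i))) //.
rewrite -integD //; last exact: (sum_continuous (f := fun i => f (widen_ord (leqnSn n) i))).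
by apply: eq_integ => x _; rewrite big_ord_recr.
Qed.

Lemma shift_pow_continuous (c : R) k : continuous (fun y : R => (y + c) ^+ k).
Proof.
move=> y; apply: (@continuous_comp _ _ _ (fun y => y + c) (fun x => x ^+ k)).
  by apply: cvgD; [exact: cvg_id|exact: cvg_cst].
exact: exprn_continuous.
Qed.

Lemma integ_shift_pow (c u v : R) k : u <= v ->
  integ (fun y => (y + c) ^+ k) u v = ((v + c) ^+ k.+1 - (u + c) ^+ k.+1) / k.+1%:R.
Proof.
move=> uv; have k0 : k.+1%:R != 0 :> R by rewrite pnatr_eq0.
have cY := @shift_pow_continuous c k.
have dY (y : R) : is_derive y (1 : R) (fun y : R => (y + c) ^+ k.+1) (k.+1%:R * (y + c) ^+ k).
  have H : is_derive y (1 : R) (fun y : R => y + c) (1 + 0).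
    exact: is_deriveD.
  have := @is_deriveX R R (fun y => y + c) k.+1 y 1 (1 + 0) H.
  rewrite addr0 [X in is_derive _ _ X](_ : _ = fun y : R => (y + c) ^+ k.+1).
    by rewrite /GRing.scale /= mulr1.
  by apply: funext => z; rewrite exprfctE.
rewrite -[RHS]mulrC; apply: (mulfI k0); rewrite mulrA mulfV // mul1r -integZ //.
exact: (integ_FTC uv (cont_scale cY) dY).
Qed.

(** Integrating a positive part raises its power, whichever side of the interval
    the breakpoint lies on. *)
Lemma integ_pos_part (c u v : R) k : u <= v ->
  integ (fun y => Num.max 0 (y + c) ^+ k.+1) u v =
  (Num.max 0 (v + c) ^+ k.+2 - Num.max 0 (u + c) ^+ k.+2) / k.+2%:R.
Proof.
move=> uv; have cP := @pos_part_continuous c k.+1.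
have pos x y : x <= y -> 0 <= x + c -> integ (fun y => Num.max 0 (y + c) ^+ k.+1) x y =
   (Num.max 0 (y + c) ^+ k.+2 - Num.max 0 (x + c) ^+ k.+2) / k.+2%:R.
  move=> xy xc; rewrite !max_r ?(le_trans xc) ?lerD2r // -integ_shift_pow //.
  apply: eq_integ => z /andP[xz _]; rewrite max_r //.
  by rewrite (le_trans xc) // lerD2r.
have neg x y : x <= y -> y + c <= 0 -> integ (fun y => Num.max 0 (y + c) ^+ k.+1) x y = 0.
  move=> xy yc; rewrite (@eq_integ _ _ (fun=> 0)) ?integ_cst ?mul0r //.
  move=> z /andP[_ zy]; rewrite max_l ?expr0n //.
  by rewrite (le_trans _ yc) // lerD2r.
have [uc|] := boolP (0 <= u + c); first exact: pos.
rewrite -ltNge => uc; have [vc|] := boolP (v + c <= 0).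
  by rewrite neg // !max_l ?(ltW uc) // subrr mul0r.
rewrite -ltNge => vc.
rewrite (@integ_split _ _ u (- c) v) //; try by lra.
rewrite neg ?addNr //; last by lra.
rewrite pos ?addNr //; last by lra.
by rewrite add0r maxxx [Num.max 0 (u + c)]max_l // ltW.
Qed.

Lemma oterm_step j s : - a <= s <= 1 -> (j <= p)%N ->
  oterm j.+1 1 - oterm j.+1 s =
  j.+1%:R / theta ^+ j * integ (fun y => oterm j (clamp a (theta * y))) s 1.
Proof.
move=> /andP[as_ s1] jp; have tj : theta ^+ j != 0 by rewrite expf_neq0.
case: j jp tj => [|j] jp tj.
  rewrite /oterm breakS expr0 !expr1 (@eq_integ _ _ (fun=> 1)); last by move=> y _; rewrite expr0.
  rewrite integ_cst // !divr1 !mul1r !max_r; [by ring|by lra|].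
  by have := a_gtN1; lra.
rewrite (@eq_integ _ _ (fun y => theta ^+ j.+1 * Num.max 0 (y + break j.+2) ^+ j.+1)); last first.
  move=> y /andP[sy y1]; rewrite /oterm -exprMn; congr (_ ^+ _).
  have bj := break_le (ltn0Sn j).
  have y0 : - a <= y by lra.
  have -> : theta * Num.max 0 (y + break j.+2) = Num.max 0 (theta * y + break j.+1).
    rewrite maxr_pMr ?ltW // mulr0 mulrDr; congr (Num.max 0 (_ + _)).
    by rewrite !breakS exprS invfM; field; rewrite expf_neq0.
  have ty1 : theta * y <= 1 by have := theta_gt0; have := theta_lt1; have := a_lt0; nra.
  have ty : clamp a (theta * y) = Num.max (theta * y) (- a) by rewrite /clamp min_r // ge_max ty1; have := a_gtN1; lra.
  by rewrite ty; minmax_lra.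
rewrite integZ; last exact: pos_part_continuous.
rewrite integ_pos_part // /oterm.
have : j.+2%:R != 0 :> R by rewrite pnatr_eq0.
by move: (j.+2%:R : R) => n n0; field; rewrite tj n0.
Qed.

Lemma ocoefS j : ocoef j.+1 * j.+1%:R = - B * theta ^+ j * ocoef j.
Proof.
rewrite /ocoef binS bin1 exprD [(- B) ^+ j.+1]exprS factS natrM.
have n0 : j.+1%:R != 0 :> R by rewrite pnatr_eq0.
have f0 : j`!%:R != 0 :> R by rewrite pnatr_eq0 -lt0n fact_gt0.
move: (j`!%:R : R) f0 (j.+1%:R : R) n0 (theta ^+ 'C(j, 2)) (theta ^+ j) ((- B) ^+ j).
by move: (B) => b f f0 n n0 x y z; field; rewrite f0 n0.
Qed.

Lemma oseries_family : family theta a a oseries.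
Proof.
have aN1 := a_gtN1.
split.
- move=> r _; apply: sum_continuous => i; apply: cont_scale; exact: oterm_continuous.
- move=> k l r q s _ _; rewrite /oseries !mulr_sumr -big_split /=.
  by apply: eq_bigr => i _; ring.
- move=> r s _ sD.
  have cO i : continuous (fun y => oterm i (clamp a (theta * y))).
    by apply: clamp_comp_continuous; exact: oterm_continuous.
  rewrite (_ : integ _ s 1 = \sum_(i < p.+2) ocoef i * r i.+1 *
      integ (fun y => oterm i (clamp a (theta * y))) s 1); last first.
    rewrite integ_sum => [|i]; last by apply: cont_scale.
    by apply: eq_bigr => i _; rewrite integZ.
  rewrite [in X in _ + X]big_ord_recr /=.
  have -> : integ (fun y => oterm p.+1 (clamp a (theta * y))) s 1 = 0.
    rewrite (@eq_integ _ _ (fun=> 0)) ?integ_cst ?mul0r //; first by case/andP: sD.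
    move=> y /andP[sy y1]; rewrite /oterm.
    have -> : Num.max 0 (clamp a (theta * y) + break p.+1) = 0; last by rewrite expr0n.
    have b1 := break_le (ltn0Sn p).
    have : theta * y + break p.+1 <= 0.
      have -> : theta * y + break p.+1 = theta * (y + break p.+2).
        by rewrite mulrDr !breakS exprS invfM; congr (_ + _); field; rewrite expf_neq0.
      by rewrite pmulr_rle0 //; have := break_out; lra.
    by rewrite /clamp; minmax_lra.
  rewrite mulr0 addr0 /oseries big_ord_recl [X in _ = X + _]big_ord_recl.
  rewrite /oterm !expr0 -addrA; congr (_ + _); rewrite mulr_sumr -big_split /=.
  apply: eq_bigr => i _; rewrite /bump leq0n !add1n -/(oterm _ _) -/(oterm _ _).
  have ip : (i <= p)%N by rewrite -ltnS.
  have st := oterm_step sD ip; have oc := ocoefS i.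
  have tj : theta ^+ i != 0 by rewrite expf_neq0.
  have -> : oterm i.+1 s = oterm i.+1 1 - i.+1%:R / theta ^+ i *
     integ (fun y => oterm i (clamp a (theta * y))) s 1 by rewrite -st; ring.
  move: (integ _ s 1) => I.
  have -> : ocoef i.+1 * r i.+1 * (oterm i.+1 1 - i.+1%:R / theta ^+ i * I) =
    ocoef i.+1 * r i.+1 * oterm i.+1 1 - (ocoef i.+1 * i.+1%:R) * (r i.+1 / theta ^+ i * I).
    by ring.
  rewrite oc; congr (_ + _).
  by move: (ocoef i) (theta ^+ i) tj => o t t0; field; rewrite t0 gt_eqF.
- move=> r _; rewrite max_r; last by rewrite oppr_ge0 ltW.
  rewrite clamp_low //; last by rewrite ler_piMl ?oppr_ge0 ?(ltW theta_lt1) ?(ltW a_lt0).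
  rewrite /oseries big_ord_recl big1 ?addr0; last first.
    move=> i _; rewrite /oterm max_l ?lift0 ?expr0n ?mulr0 //.
    by have := break_le (ltn0Sn i); lra.
  by rewrite /oterm /ocoef /= expr0 bin_small // !expr0 fact0 invr1 !mulr1 mul1r.
- move=> K; exists (\sum_(j < p.+2) `|ocoef j| * `|K| ^+ j) => r rK s /andP[as_ s1].
  apply: le_trans (ler_norm_sum _ _ _) _; apply: ler_sum => j _.
  rewrite !normrM -[leRHS]mulr1.
  apply: ler_pM; [exact: mulr_ge0|exact: normr_ge0| | ].
    by rewrite ler_wpM2l // (le_trans (rK j)) // -normrX ler_norm.
  rewrite /oterm normrX ger0_norm ?le_max ?lexx // exprn_ile1 ?le_max ?lexx //.
  rewrite ge_max ler01 /=; have [->|j0] := posnP (nat_of_ord j).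
    by rewrite /break expr0 divr1; have := theta_gt0; have := a_lt0; nra.
  by have := break_le j0; have := a_lt0; lra.
Qed.

End PolynomialFamily.

(** * The eigenfunction in region O *)

Section RegionO.
Variable R : realType.
Variables theta a : R.
Hypothesis theta_gt0 : 0 < theta.
Hypothesis theta_lt1 : theta < 1.
Hypothesis a_ge : - theta <= a.
Hypothesis a_lt0 : a < 0.
Local Open Scope complex_scope.

Local Notation B := (a + 1)^-1.
Local Notation p := (O_p theta a).
Local Notation Phi := (oseries theta a).

Let a_gtN1 : -1 < a. Proof. by have := a_ge; have := theta_lt1; lra. Qed.
Let a1 : 0 < a + 1. Proof. by have := a_gtN1; lra. Qed.
Let B_gt0 : 0 < B. Proof. by rewrite invr_gt0. Qed.
Let theta0 : theta != 0. Proof. by rewrite gt_eqF. Qed.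
Let theta_range : -1 <= theta < 1.
Proof. by rewrite theta_lt1 andbT; have := theta_gt0; lra. Qed.

Definition ucoef j : R := ocoef theta a j * oterm theta a j 1.

Lemma ucoefS j : (j <= p)%N -> ucoef j.+1 =
  - ((theta ^+ j + a) ^+ j.+1 /
     ((j.+1)`!%:R * theta ^+ 'C(j.+1, 2) * (a + 1) ^+ j.+1) * (-1) ^+ j).
Proof.
move=> jp; rewrite /ucoef /oterm max_r; last exact: break_in.
rewrite (breakS _ theta_gt0).
have tj : theta ^+ j != 0 by rewrite expf_neq0.
have -> : 1 + a / theta ^+ j = (theta ^+ j + a) / theta ^+ j by rewrite mulrDl divff.
rewrite exprMn exprVn -exprM.
have -> : (j * j.+1 = 'C(j.+1, 2) + 'C(j.+1, 2))%N.
  have e := bin2_shift j 0; rewrite (_ : 'C(0, 2) = 0)%N // !addn0 in e.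
  have e2 : 'C(j.+1, 2) = ('C(j, 2) + j)%N by rewrite binS bin1 addnC.
  by rewrite mulnS; lia.
rewrite exprD /ocoef [(- B) ^+ _]exprNn exprVn [(-1) ^+ j.+1]exprS.
have t0 : theta ^+ 'C(j.+1, 2) != 0 by rewrite expf_neq0.
have f0 : (j.+1)`!%:R != 0 :> R by rewrite pnatr_eq0 -lt0n fact_gt0.
have b0 : (a + 1) ^+ j.+1 != 0 by rewrite expf_neq0 // gt_eqF.
move: ((a + 1) ^+ j.+1) b0 ((theta ^+ j + a) ^+ j.+1) ((-1) ^+ j)
  (theta ^+ 'C(j.+1, 2)) t0 ((j.+1)`!%:R : R) f0 => b b0 x y t t0 f f0.
by field; rewrite b0 t0 f0.
Qed.

Lemma O_uE : O_u theta a = \sum_(j < p.+2) ucoef j *: 'X^j.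
Proof.
rewrite [RHS]big_ord_recl /O_u; congr (_ + _).
  by rewrite /ucoef /ocoef /oterm /= !expr0 fact0 invr1 !mulr1 scale1r.
rewrite mulr_sumr -sumrN; apply: eq_bigr => i _.
rewrite lift0 ucoefS -1?ltnS // scaleNr; congr (- _).
rewrite [(- 'X) ^+ _]exprNn -mul_polyC; set c := _ / _.
clearbody c; rewrite polyCM polyC_exp polyCN [in RHS]exprS.
by move: (c%:P) ((- 1%:P) ^+ i) ('X^i) => u e x; rewrite mulrCA mulrA [e * x]mulrC; ring.
Qed.

Lemma O_u_real z : (O_u theta a).[z] = charac Phi z.
Proof.
rewrite O_uE horner_sum /charac /oseries; apply: eq_bigr => i _.
by rewrite hornerZ hornerXn /ucoef /pw; ring.
Qed.

Lemma O_u_complex (w : R[i]) : (map_poly (real_complex R) (O_u theta a)).[w] =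
  Phi (re_pow w) 1 +i* Phi (im_pow w) 1.
Proof.
rewrite O_uE rmorph_sum horner_sum /oseries.
rewrite -!(big_mkord xpredT (fun j => ocoef theta a j * _ j * oterm theta a j 1)).
rewrite -sum_complex big_mkord; apply: eq_bigr => i _.
rewrite /= map_polyZ map_polyXn hornerZ hornerXn /ucoef /re_pow /im_pow.
case: (w ^+ i) => x y; rewrite real_mul_complex /=; congr (_ +i* _); ring.
Qed.

Lemma region_O_geometry : region_geometry theta a a.
Proof.
by apply: (@geometryP _ _ _ theta_range a_gtN1 RegO); split; apply/andP.
Qed.

(** To the left of the zero the polynomial lies above a line of negative slope. *)
Lemma O_u_deriv_lt0 z0 : 0 < z0 -> charac Phi z0 = 0 ->
  (exists2 c, 0 < c & exists2 d, 0 < d <= z0 &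
     forall z, z0 - d <= z <= z0 -> c * (z0 - z) <= charac Phi z) ->
  (O_u theta a)^`().[z0] < 0.
Proof.
move=> z0_gt0 zr [c c0 [d /andP[d0 dz] H]].
have /factor_theorem[q qE] : root (O_u theta a) z0 by rewrite rootE O_u_real zr.
rewrite qE derivM derivXsubC mulr1 hornerD hornerM hornerXsubC subrr mulr0 add0r.
rewrite ltNge; apply/negP => q0.
have cq : continuous (fun z => q.[z]).
  exact: continuous_horner.
have c2 : 0 < c / 2 by rewrite divr_gt0.
have /cvgrPdist_lt/(_ _ c2)[e /= e0 he] := cq z0.
pose z := z0 - Num.min d (e / 2).
have m0 : 0 < Num.min d (e / 2) by rewrite lt_min d0 divr_gt0.
have md : Num.min d (e / 2) <= d by rewrite ge_min lexx.
have me : Num.min d (e / 2) <= e / 2 by rewrite ge_min lexx orbT.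
have zb : z0 - d <= z <= z0 by rewrite /z; apply/andP; split; lra.
have : `|q.[z0] - q.[z]| < c / 2.
  apply: he; rewrite /ball_ /= /z opprB addrC subrK gtr0_norm //.
  by apply: le_lt_trans me _; move: e0; lra.
have := H z zb; rewrite -O_u_real qE hornerM hornerXsubC.
have zz : z0 - z = Num.min d (e / 2) by rewrite /z opprB addrC subrK.
rewrite -[z - z0]opprB zz mulrN -mulNr ler_pM2r // => cq_.
by rewrite ltr_norml => /andP[_]; lra.
Qed.

Lemma spectrum_O : region_spectrum theta a RegO.
Proof.
have geom := region_O_geometry.
have PhiF := oseries_family theta_gt0 theta_lt1 a_ge a_lt0.
have [z0 [z0_gt0 root pos data [roots simple]]] :=
  family_spectral theta_range a_gtN1 geom PhiF.
have du := O_u_deriv_lt0 z0_gt0 root simple.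
pose k := -1 / (O_u theta a)^`().[z0].
have k0 : 0 < k by rewrite /k mulN1r oppr_gt0 invr_lt0.
have lamS : lambda_spec RegO theta a z0^-1.
  rewrite /= invrK; split => /=.
    rewrite O_u_complex re_pow_real [Phi (pw z0) 1]root.
    rewrite (_ : Phi _ 1 = 0) // /oseries big1 // => i _.
    by rewrite im_pow_real mulr0 mul0r.
  move=> w; rewrite O_u_complex => /complex_eq0[rp rq].
  exact: roots.
have mu0 : z0^-1 * (a + 1) != 0 by rewrite mulf_neq0 ?invr_eq0 // gt_eqF.
have a0 : a != 0 by rewrite lt_eqF.
have na : 0 <= - a by rewrite oppr_ge0 ltW.
have nuE : -1 / (z0^-1 * (a + 1)) = - B * z0.
  by rewrite invfM invrK; ring.
(* between two breakpoints the positive parts of the first terms are active *)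
have piece M x : (M <= p.+1)%N -> - a <= theta * x <= 1 ->
    ((0 < M)%N -> - a / theta ^+ M.-1 <= theta * x) ->
    ((M <= p)%N -> theta * x < - a / theta ^+ M) ->
    Phi (pw z0) (theta * x) =
    \sum_(j < M.+1) dcoef theta z0^-1 a j * (x + a / theta ^+ j) ^+ j.
  move=> Mp /andP[txa tx1] lo hi; rewrite /oseries.
  rewrite -(big_mkord xpredT (fun j => ocoef theta a j * pw z0 j * oterm theta a j (theta * x))).
  rewrite (big_cat_nat (n := M.+1)) //= [X in _ + X]big1_seq ?addr0; last first.
    move=> j /=; rewrite mem_index_iota => /andP[Mj jp].
    case: j Mj jp => // j Mj jp.
    have -> : oterm theta a j.+1 (theta * x) = 0; last by rewrite mulr0.
    rewrite /oterm (breakS _ theta_gt0) max_l ?expr0n //.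
    have Mp' : (M <= p)%N by rewrite -ltnS (leq_trans Mj) // -ltnS.
    have := hi Mp'; have : - a / theta ^+ M <= - a / theta ^+ j.
      rewrite ler_wpM2l // lef_pV2 ?posrE ?exprn_gt0 //.
      by rewrite ler_wiXn2l // ltW.
    by rewrite mulNr; lra.
  rewrite big_mkord; apply: eq_bigr => -[j jM] _ /=.
  have -> : oterm theta a j (theta * x) = theta ^+ j * (x + a / theta ^+ j) ^+ j.
    rewrite /oterm -exprMn mulrDr (_ : theta * (a / theta ^+ j) = break theta a j); last first.
      by rewrite /break; ring.
    case: j jM => [|j] jM; first by rewrite !expr0.
    rewrite max_r // (breakS _ theta_gt0).
    have M0 : (0 < M)%N by move: jM; case: (M).
    have := lo M0; have : - a / theta ^+ M.-1 >= - a / theta ^+ j.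
      rewrite ler_wpM2l // lef_pV2 ?posrE ?exprn_gt0 //.
      rewrite ler_wiXn2l //; [exact: ltW|exact: ltW|by rewrite -ltnS prednK].
    by rewrite mulNr; lra.
  rewrite /dcoef nuE /ocoef /pw exprMn binS bin1 exprD.
  by move: (_ ^+ j) => z; ring.
have kE : k = -1 / (O_u theta a)^`().[1 / z0^-1] by rewrite mul1r invrK.
have bp m : (m <= p)%N -> - a / theta ^+ m <= 1.
  move=> mp; rewrite ler_pdivrMr ?exprn_gt0 // mul1r.
  by have [h _] := O_pP theta_gt0 theta_lt1 a_ge a_lt0; rewrite (le_trans h) // ler_wiXn2l // ltW.
have ba m : - a <= - a / theta ^+ m.
  rewrite -[leLHS]mulr1 ler_wpM2l // invf_ge1 ?exprn_gt0 //.
  by rewrite exprn_ile1 // ltW.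
have p0 := O_p_gt0 theta_gt0 theta_lt1 a_ge a_lt0.
exists z0^-1, (fun x => k * pull theta a Phi (pw z0) x); split => //; last exact: data.
have [h1 h2 h3] := pull_h_shape geom theta0 k0 root pos.
split => //; split.
  move=> m x mp /andP[xm xm1]; rewrite (@O_c_poly _ _ _ _ theta0 mu0 a0) -kE; congr (_ * _).
  have x1 : theta * x <= 1 by rewrite (le_trans (ltW xm1)) // bp.
  have xa : - a <= theta * x by rewrite (le_trans (ba m)).
  by rewrite /pull clamp_id ?xa //; apply: piece; rewrite ?xa // ltnW.
move=> x /andP[xp x1].
have xa : - a <= theta * x by rewrite (le_trans (ba p)).
rewrite /pull clamp_id ?xa ?(ltW x1) //.
rewrite (fam_step PhiF (geo_expr z0)) ?xa ?(ltW x1) //.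
rewrite [Phi _ 1]root add0r shift_pw.
rewrite (@eq_integ _ _ (fun y => z0 / k * \sum_(i < p.+1) O_c theta z0^-1 a p i * (y + 0) ^+ i)); last first.
  move=> y /andP[xy y1].
  have ty : - a / theta ^+ p.-1 <= theta * y.
    have := le_trans xp xy; rewrite -{1}(prednK p0) exprS invfM mulrCA.
    by rewrite -(ler_pM2l theta_gt0) mulVKf //.
  have tya : - a <= theta * y by rewrite (le_trans (ba p.-1)).
  have ty1 : theta * y <= 1 by have := theta_gt0; have := theta_lt1; nra.
  rewrite clamp_id ?tya // (PhiZ PhiF) ?geo_expr //; last exact: geo_expr.
  rewrite addr0 (@O_c_poly _ _ _ _ theta0 mu0 a0) -kE -mulrA; congr (_ * _).
  rewrite mulKf ?gt_eqF // (piece p) ?tya ?leqnSn // => _.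
  have [_ h] := O_pP theta_gt0 theta_lt1 a_ge a_lt0.
  rewrite ltr_pdivlMr ?exprn_gt0 //; apply: le_lt_trans h.
  rewrite exprS ler_pM2r ?exprn_gt0 //; have := theta_gt0; nra.
have cS (i : 'I_p.+1) : continuous (fun y : R => O_c theta z0^-1 a p i * (y + 0) ^+ i).
  by apply: cont_scale; exact: shift_pow_continuous.
rewrite integZ; last exact: sum_continuous.
rewrite integ_sum //.
rewrite (eq_bigr (fun i : 'I_p.+1 => O_c theta z0^-1 a p i * (1 / i.+1%:R) * (1 - (theta * x) ^+ i.+1))).
  have -> : 1 / (z0^-1 * (a + 1)) = z0 * B by rewrite invfM invrK mul1r.
  move: (\sum_(i < _) _) => S; transitivity ((k / k) * (z0 * B * S)); first by ring.
  by rewrite divff ?mul1r // gt_eqF.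
move=> i _; rewrite integZ; last exact: shift_pow_continuous.
rewrite integ_shift_pow ?ltW // !addr0 expr1n -mulrA; congr (_ * _).
by rewrite mulrC mul1r.
Qed.

End RegionO.

Theorem region_spectra (R : realType) (theta a : R) (r : region) :
  -1 <= theta < 1 -> -1 < a -> in_region r theta a -> region_spectrum theta a r.
Proof.
move=> th a1; case: r => reg.
- exact: spectrum_B.
- exact: spectrum_G.
- exact: spectrum_Y.
- by case: reg => /andP[? ?] /andP[? ?]; exact: spectrum_O.
- exact: spectrum_W.
- exact: spectrum_T.
Qed.

(** * The past and the next variable *)

Lemma section_measurable (d1 d2 d3 : measure_display) (T1 : measurableType d1)
    (T2 : measurableType d2) (T3 : measurableType d3) (f : T1 * T2 -> T3) (z : T1) :
  measurable_fun setT f -> measurable_fun setT (fun v => f (z, v)).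
Proof. by move=> mf; apply: (measurableT_comp mf); exact: pair1_measurable. Qed.

Section Independence.
Context (d : measure_display) (T : measurableType d) (R : realType).
Variables (P : probability T R) (X : nat -> {RV P >-> R}).
Variables (l u : R) (lu : l < u).
Hypothesis X_iid : iid_uniform X lu.

Local Notation U := (distribution P (X 1%N)).

(** A pi-system that generates the information carried by [X 1, ..., X n]. *)
Definition cylinders (n : nat) : set (set T) :=
  [set A | exists B : nat -> set R, (forall i, measurable (B i)) /\
     A = \bigcap_(i in [set i | (0 < i <= n)%N]) (X i @^-1` B i)].

(** [T] with the sigma-algebra of [X 1, ..., X n], so that a function of the past
    is a measurable function on [past n]. *)
Definition past (n : nat) := g_sigma_algebraType (cylinders n).

Lemma X_measurable i (B : set R) : measurable B -> measurable (X i @^-1` B).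
Proof. by move=> mB; rewrite -[_ @^-1` _]setTI; exact: measurable_funP. Qed.

Lemma set_iota1 n : [set` iota 1 n] = [set i | (0 < i <= n)%N].
Proof.
by apply/seteqP; split => i; rewrite -[[set` _] i]/(is_true (i \in iota 1 n))
  mem_iota add1n ltnS.
Qed.

Lemma cylinders_measurable n : cylinders n `<=` @measurable d T.
Proof.
move=> _ [B [mB ->]]; apply: fin_bigcap_measurable.
  by rewrite -set_iota1; exact: finite_seq.
by move=> i _; exact: X_measurable.
Qed.

Lemma cylinders_setI n : setI_closed (cylinders n).
Proof.
move=> _ _ [B [mB ->]] [C [mC ->]]; exists (fun i => B i `&` C i); split.
  by move=> i; exact: measurableI.
by rewrite -bigcapI; apply: eq_bigcapr => i _; rewrite preimage_setI.
Qed.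

Lemma cylinders_setT n : cylinders n setT.
Proof.
exists (fun=> setT); split => //.
by apply/esym; rewrite -subTset => w _ i _.
Qed.

Lemma past_sub_measurable n (A : set T) :
  measurable (A : set (past n)) -> measurable A.
Proof.
move=> h; apply: (smallest_sub (@sigma_algebra_measurable _ T)) h.
exact: cylinders_measurable.
Qed.

Lemma past_X n i : (0 < i <= n)%N ->
  measurable_fun (setT : set (past n)) (X i : past n -> R).
Proof.
move=> iN _ B mB; rewrite setTI; apply: sub_sigma_algebra.
exists (fun j => if j == i then B else setT); split; first by move=> j; case: ifP.
apply/seteqP; split => w.
  by move=> Bw j _ /=; case: eqP => // ->.
by move/(_ i) => /=; rewrite eqxx; apply.
Qed.

Lemma past_mono n (d' : measure_display) (T' : measurableType d') (f : T -> T') :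
  measurable_fun (setT : set (past n)) (f : past n -> T') ->
  measurable_fun (setT : set (past n.+1)) (f : past n.+1 -> T').
Proof.
move=> mf _ A mA; have := mf measurableT A mA; rewrite !setTI => h.
apply: (smallest_sub (@sigma_algebra_measurable _ (past n.+1)) _ h).
move=> _ [B [mB ->]]; apply: sub_sigma_algebra.
exists (fun j => if (j <= n)%N then B j else setT); split.
  by move=> j; case: ifP.
apply/seteqP; split => w /= h' i /= /andP[i0 iN].
  by case: leqP => // iN'; apply: h'; rewrite /= i0.
by have := h' i; rewrite /= i0 (leqW iN) iN; exact.
Qed.

Lemma past_measurable n (d' : measure_display) (T' : measurableType d') (f : T -> T') :
  measurable_fun (setT : set (past n)) (f : past n -> T') ->
  measurable_fun (setT : set T) f.
Proof.
move=> mf _ A mA; have := mf measurableT A mA; rewrite !setTI.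
exact: past_sub_measurable.
Qed.

Lemma past_independent n (A : set T) (B : set R) :
  measurable (A : set (past n)) -> measurable B ->
  P (A `&` X n.+1 @^-1` B) = (P A * U B)%E.
Proof.
move=> mA mB; have [indep unif] := X_iid.
have mXB := X_measurable n.+1 mB.
have UB : P (X n.+1 @^-1` B) = U B by rewrite [RHS](unif 1%N isT) // -(unif n.+1 isT).
have fU : U B \is a fin_num by exact: fin_num_measure.
pose k : {nonneg R} := NngNum (fine_ge0 (measure_ge0 U B)).
have -> : (P A * U B)%E = mscale k P A.
  transitivity (U B * P A)%E; first exact: muleC.
  by rewrite /mscale; congr (_ * _)%E; rewrite /= fineK.
have -> : P (A `&` X n.+1 @^-1` B) = mrestr P mXB A by [].
apply: (@g_sigma_algebra_measure_unique _ _ _ (cylinders n) (@cylinders_measurable n)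
  (fun=> setT)) => //.
- by move=> _; exact: cylinders_setT.
- by rewrite bigcup_const.
- exact: cylinders_setI.
- move=> _ [C [mC ->]]; transitivity (P (\bigcap_(i in [set i | (0 < i <= n)%N]) (X i @^-1` C i)) * U B)%E; last first.
    transitivity (U B * P (\bigcap_(i in [set i | (0 < i <= n)%N]) (X i @^-1` C i)))%E.
      exact: muleC.
    by rewrite /mscale; congr (_ * _)%E; rewrite /= fineK.
  have CB : \bigcap_(i in [set i | (0 < i <= n)%N]) (X i @^-1` C i) `&` X n.+1 @^-1` B =
     \bigcap_(i in [set` iota 1 n.+1]) (X i @^-1` (if i == n.+1 then B else C i)).
    rewrite set_iota1; apply/seteqP; split => w /=.
      move=> [h1 h2] i /= /andP[i1 iN].
      case: eqP => [->//|/eqP ni]; apply: h1.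
      by rewrite /= i1 -ltnS ltn_neqAle ni.
    move=> h; split; last first.
      by have := h n.+1; rewrite /= eqxx leqnn; exact.
    move=> i /= /andP[i1 iN].
    have := h i; rewrite /= i1 (leqW iN) ltn_eqF ?ltnS //; exact.
  rewrite -[LHS]/(P ((\bigcap_(i in [set i | (0 < i <= n)%N]) (X i @^-1` C i)) `&` X n.+1 @^-1` B)) CB.
  rewrite indep ?iota_uniq //; last 2 first.
  + by move=> i; rewrite mem_iota => /andP[].
  + by move=> i; case: ifP.
  have -> : iota 1 n.+1 = iota 1 n ++ [:: n.+1] by rewrite -[n.+1 in LHS]addn1 iotaD add1n.
  rewrite big_cat big_seq1 eqxx UB; congr (_ * _)%E.
  rewrite -set_iota1 indep ?iota_uniq //; last by move=> i; rewrite mem_iota => /andP[].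
  rewrite !big_seq; apply: eq_bigr => i; rewrite mem_iota add1n ltnS => /andP[_ iN].
  by rewrite ltn_eqF.
- by move=> _; rewrite /= /mrestr setTI; apply: le_lt_trans (ltry 1); exact: probability_le1.
Qed.

(** Integrating out the next variable: it is uniform and independent of every
    function of the past. *)
Lemma integrate_next n (d' : measure_display) (T' : measurableType d') (V : T -> T')
    (F : T' * R -> \bar R) :
  measurable_fun (setT : set (past n)) (V : past n -> T') ->
  measurable_fun setT F -> (forall z, 0 <= F z)%E ->
  (\int[P]_w F (V w, X n.+1 w) = \int[P]_w \int[U]_v F (V w, v))%E.
Proof.
move=> mV mF F0; have mVT := past_measurable mV.
have mX : measurable_fun setT (X n.+1) by exact: measurable_funP.
have mVX : measurable_fun setT (fun w => (V w, X n.+1 w)) by exact: measurable_fun_pair.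
pose V' : {mfun T >-> T'} := mfun_Sub (mem_set mVT).
pose VX : {mfun T >-> (T' * R)%type} := mfun_Sub (mem_set mVX).
transitivity (\int[distribution P VX]_z F z)%E.
  by rewrite ge0_integral_distribution.
transitivity (\int[(distribution P V' \x U)%E]_z F z)%E.
  apply: (@eq_measure_integral _ _ _ setT (distribution P V' \x U)%E (distribution P VX)) => A mA _; apply/esym.
  apply: product_measure_unique => // B C mB mC.
  have mVB : measurable (V @^-1` B : set (past n)).
    by have := mV measurableT B mB; rewrite setTI.
  by rewrite -[RHS]/(P (V @^-1` B) * U C)%E -(past_independent mVB mC).
rewrite fubini_tonelli1 // ge0_integral_distribution //.
  exact: measurable_fun_fubini_tonelli_F.
by move=> x; exact: integral_ge0.
Qed.

(** The uniform law is taken as the law of [X 1], which lives on the canonical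
    measurable structure of the real line. *)
Lemma integral_law (f : R -> \bar R) : measurable_fun setT f -> (forall x, 0 <= f x)%E ->
  (\int[U]_v f v = (u - l)^-1%:E * \int[lebesgue_measure]_(v in `[l, u]) f v)%E.
Proof.
move=> mf f0; rewrite -(integral_uniform lu) //.
have mi : @measurable_fun _ _ (measurableTypeR R) (R : measurableType _) setT id.
  by move=> _ A mA; rewrite setTI.
pose i := @mfun_Sub _ _ (measurableTypeR R) (R : measurableType _) id (mem_set mi).
transitivity (\int[distribution (uniform_prob lu) i]_v f v)%E; last first.
  by rewrite ge0_integral_distribution.
apply: eq_measure_integral => A mA _.
by have [_ unif] := X_iid; exact: unif.
Qed.

End Independence.

(** * Integrating out the steps of the walk *)

Section Jump.
Context (d : measure_display) (T : measurableType d) (R : realType).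
Variables (P : probability T R) (X : nat -> {RV P >-> R}) (theta a : R).
Hypothesis a_gtN1 : -1 < a.
Hypothesis X_iid : iid_uniform X (ltrN1_ltNr1 a_gtN1).

Local Notation U := (distribution P (X 1%N)).

(** The operator [transfer] is one step of the walk killed on leaving [S]; a
    single point of the integration interval does not matter, which covers both
    strict and large inequalities. *)
Lemma integral_jump (k f : R -> R) s : continuous f ->
  measurable_fun setT k -> (forall v, 0 <= k v) ->
  (forall v, clamp a s < v <= 1 -> k v = f v) ->
  (forall v, - a <= v < clamp a s -> k v = 0) ->
  (\int[U]_v (k v)%:E = ((a + 1)^-1 * integ f (clamp a s) 1)%:E)%E.
Proof.
move=> cf mk k0 k_hi k_lo; set c := clamp a s.
have /andP[ac c1] := clamp_bounds s a_gtN1.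
rewrite (integral_law X_iid); last 2 first.
- exact/measurable_EFinP.
- by move=> v; rewrite lee_fin.
rewrite opprK [1 + a]addrC EFinM; congr (_ * _)%E.
have -> : (integ f c 1)%:E = (\int[lebesgue_measure]_(v in `[c, 1%R]) (f v)%:E)%E.
  by rewrite /integ /Rintegral fineK //; apply: integrable_fin_num => //; exact: integ_integrable.
have -> : `[c, 1]%classic = `[- a, 1]%classic `&` `[c, 1]%classic.
  apply/esym/setIidr => v /=; rewrite !in_itv /= => /andP[cv ->].
  by rewrite (le_trans ac cv).
rewrite integral_mkcondr.
have mf : measurable_fun setT f := continuous_measurable_fun cf.
have mD : measurable (`[- a, 1]%classic `\ c) by apply: measurableD.
rewrite -(@integral_setD1 _ _ c) //; last exact/measurable_funTS/measurable_EFinP.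
rewrite -[RHS](@integral_setD1 _ _ c) //; last first.
  apply: measurable_funTS; apply/measurable_restrict => //.
  exact/measurable_funTS/measurable_EFinP.
apply: eq_integral => v /[!inE] -[] /=; rewrite in_itv /= => /andP[av v1] vc.
rewrite patchE; case: ifPn.
  rewrite inE /= in_itv /= => /andP[cv _]; rewrite k_hi // v1 andbT lt_neqAle cv andbT.
  by apply/eqP => cv'; apply: vc.
rewrite notin_setE /= in_itv /= v1 andbT => /negP; rewrite -ltNge => vc'.
by rewrite k_lo // av.
Qed.

Lemma measurable_S_set : measurable (S_set theta a).
Proof.
have m1 : measurable_fun setT (fst : R * R -> R) by exact: measurable_fst.
have m2 : measurable_fun setT (snd : R * R -> R) by exact: measurable_snd.
have mlt : measurable_fun setT (fun u : R * R => theta * u.2 < u.1).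
  by apply: measurable_fun_ltr => //; exact: measurable_funM.
have -> : S_set theta a = fst @^-1` `[- a, 1]%classic `&` snd @^-1` `[- a, 1]%classic
    `&` (fun u : R * R => theta * u.2 < u.1) @^-1` [set true].
  apply/seteqP; split => u /=; rewrite !in_itv /=.
    by case=> h1 h2 h3; split; [split|].
  by case=> -[h1 h2] h3; split.
by apply: measurableI; [apply: measurableI|]; rewrite -[_ @^-1` _]setTI;
  [exact: m1|exact: m2|exact: mlt].
Qed.

Lemma integral_strict_jump (f : R -> R) (x : R) : continuous f ->
  (forall v, - a <= v <= 1 -> 0 <= f v) -> - a <= x <= 1 ->
  (\int[U]_v (\1_(S_set theta a) (v, x) * f v)%:E = (transfer theta a f x)%:E)%E.
Proof.
move=> cf f0 xD; apply: integral_jump => //.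
- apply: measurable_funM; last exact: continuous_measurable_fun.
  have mS : measurable_fun setT (\1_(S_set theta a) : R * R -> R).
    by apply: measurable_indic; exact: measurable_S_set.
  by apply: (measurableT_comp mS); exact: pair2_measurable.
- move=> v; rewrite indicE; case: (boolP (_ \in _)); last by rewrite mul0r.
  by rewrite inE mul1r => -[/= vD _ _]; exact: f0.
- move=> v vc; rewrite indicE mem_set ?mul1r //; split => //=; move: vc; rewrite /clamp; minmax_lra.
- move=> v vc; rewrite indicE memNset ?mul0r //; case=> /= _ _; move: vc; rewrite /clamp; minmax_lra.
Qed.

Lemma integral_large_jump (f : R -> R) (x : R) : continuous f -> (forall v, 0 <= f v) ->
  (\int[U]_v ((theta * x <= v)%R%:R * f v)%:E = (transfer theta a f x)%:E)%E.
Proof.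
move=> cf f0; apply: integral_jump => //.
- apply: measurable_funM; last exact: continuous_measurable_fun.
  have -> : (fun v : R => (theta * x <= v)%R%:R : R) =
      (fun v => if theta * x <= v then 1 else 0).
    by apply/funext => v; case: ifP.
  by apply: measurable_fun_ifT => //; exact: measurable_fun_ler.
- by move=> v; rewrite mulr_ge0.
- move=> v vc; have -> : theta * x <= v by move: vc; rewrite /clamp; minmax_lra.
  by rewrite mul1r.
- move=> v vc; have -> : (theta * x <= v) = false.
    by apply/negbTE; rewrite -ltNge; move: vc; rewrite /clamp; minmax_lra.
  by rewrite mul0r.
Qed.

End Jump.

Section Peel.
Context (d : measure_display) (T : measurableType d) (R : realType).
Variables (P : probability T R) (X : nat -> {RV P >-> R}) (theta a : R).
Hypothesis a_gtN1 : -1 < a.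
Hypothesis X_iid : iid_uniform X (ltrN1_ltNr1 a_gtN1).
Variables (J : R -> R -> R) (A : set R) (Z : T -> R).

Local Notation U := (distribution P (X 1%N)).
Local Notation step := (transfer theta a).

Hypothesis mJ : measurable_fun setT (fun z : R * R => J z.1 z.2).
Hypothesis J_ge0 : forall v x, 0 <= J v x.
Hypothesis J_into : forall v x, J v x != 0 -> A v.
Hypothesis J_jump : forall (f : R -> R) (x : R), continuous f -> (forall v, 0 <= f v) -> A x ->
  (\int[U]_v (J v x * f v)%:E = (step f x)%:E)%E.
Hypothesis mZ : measurable_fun (setT : set (past X 1)) (Z : past X 1 -> R).

Local Notation x i w := (start_at (Z w) (fun j => X j w) i).

Lemma past_start_at n i : (0 < i <= n)%N ->
  measurable_fun (setT : set (past X n)) ((fun w => x i w) : past X n -> R).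
Proof.
case/andP; case: i => [//|[|i]] _ iN; last exact: past_X.
by elim: n iN => // -[//|n] IH _; apply: past_mono; exact: IH.
Qed.

Lemma peel_one m (c : T -> R) (f : R -> R) : (0 < m)%N ->
  measurable_fun (setT : set (past X m)) (c : past X m -> R) ->
  (forall w, 0 <= c w) -> (forall w, c w != 0 -> A (x m w)) ->
  continuous f -> (forall v, 0 <= f v) ->
  (\int[P]_w (c w * J (x m.+1 w) (x m w) * f (x m.+1 w))%:E =
   \int[P]_w (c w * step f (x m w))%:E)%E.
Proof.
move=> m0 mc c0 cA cf f0.
have mV : measurable_fun (setT : set (past X m)) ((fun w => (c w, x m w)) : past X m -> (R * R)%type).
  by apply: measurable_fun_pair => //; apply: past_start_at; rewrite m0 leqnn.
pose F := fun z : (R * R) * R => (`|z.1.1| * (J z.2 z.1.2 * f z.2))%:E.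
have mf := continuous_measurable_fun cf.
have m1 : measurable_fun setT (fun z : (R * R) * R => J z.2 z.1.2).
  apply: (@measurableT_comp _ _ _ _ _ _ _ _ (fun z : (R * R) * R => (z.2, z.1.2)) mJ).
  apply: measurable_fun_pair; first exact: measurable_snd.
  by apply: measurableT_comp; [exact: measurable_snd|exact: measurable_fst].
have mF : measurable_fun setT F.
  apply/measurable_EFinP; apply: measurable_funM.
    apply: measurableT_comp => //.
    by apply: measurableT_comp; [exact: measurable_fst|exact: measurable_fst].
  apply: measurable_funM => //.
  by apply: measurableT_comp => //; exact: measurable_snd.
have F0 z : (0 <= F z)%E by rewrite lee_fin !mulr_ge0.
transitivity (\int[P]_w F ((c w, x m w), X m.+1 w))%E.
  apply: eq_integral => w _; rewrite /F /= ger0_norm // mulrA.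
  by case: m m0 {mc cA mV} => //.
rewrite (integrate_next X_iid mV mF F0); apply: eq_integral => w _.
rewrite /F /= ger0_norm //; under eq_integral do rewrite EFinM.
rewrite ge0_integralZl //; last 3 first.
- apply/measurable_EFinP; apply: measurable_funM => //.
  apply: (@measurableT_comp _ _ _ _ _ _ _ _ (fun v : R => (v, x m w)) mJ).
  exact: pair2_measurable.
- by move=> v _; rewrite lee_fin mulr_ge0.
- by rewrite lee_fin.
have [->|/cA xA] := eqVneq (c w) 0; first by rewrite mul0e mul0r.
by rewrite J_jump.
Qed.

(** Integrating the variables out one by one, the last one first, applies the
    operator once for each. The jump function [J] is arbitrary because the
    persistence probability and the conditioning event differ in the strictness of
    the inequality and in the range of the variables. *)
Lemma peel k n m (c : T -> R) : (0 < m)%N ->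
  measurable_fun (setT : set (past X m)) (c : past X m -> R) ->
  (forall w, 0 <= c w) -> (forall w, c w != 0 -> A (x m w)) ->
  (\int[P]_w (c w * (\prod_(m <= i < m + k) J (x i.+1 w) (x i w)) *
              iter n step (fun=> 1) (x (m + k)%N w))%:E =
   \int[P]_w (c w * iter (n + k) step (fun=> 1) (x m w))%:E)%E.
Proof.
elim: k n => [|k IH] n m0 mc c0 cA.
  by rewrite !addn0; under eq_integral do rewrite big_geq // mulr1.
have mJx i : (0 < i < m + k)%N -> measurable_fun (setT : set (past X (m + k)%N))
    ((fun w => J (x i.+1 w) (x i w)) : past X (m + k)%N -> R).
  move=> /andP[i0 iN].
  apply: (@measurableT_comp _ _ _ _ _ _ _ _ (fun w : past X (m + k)%N => (x i.+1 w, x i w)) mJ).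
  by apply: measurable_fun_pair; apply: past_start_at => //; rewrite i0 ltnW.
rewrite addnS.
under eq_integral do rewrite big_nat_recr ?leq_addr //= mulrA.
rewrite (@peel_one (m + k) (fun w => c w * \prod_(m <= i < m + k) J (x i.+1 w) (x i w))).
- by rewrite addnS -addSn -IH.
- by rewrite addn_gt0 m0.
- apply: measurable_funM; first by elim: k {IH mJx} => [|k IH]; rewrite ?addn0 // addnS; exact: past_mono.
  apply: measurable_prod => i; rewrite mem_index_iota => /andP[mi iN].
  by apply: mJx; rewrite iN (leq_trans m0).
- by move=> w; rewrite mulr_ge0 // prodr_ge0.
- move=> w; rewrite mulf_eq0 negb_or => /andP[cw].
  case: k {IH mJx} => [|k]; first by rewrite addn0 => _; exact: cA.
  by rewrite addnS big_nat_recr ?leq_addr //= mulf_eq0 negb_or => /andP[_ /J_into].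
- by apply: iter_transfer_continuous => //; exact: cst_continuous.
- case: n => [|n] v //=; apply: transfer_ge0 => // z zD; exact: iter_transfer_ge0.
Qed.

End Peel.

(** * The persistence exponent *)

Lemma indic_forall (T : Type) (R : pzRingType) (B : nat -> set T) (m n : nat) (w : T) :
  \1_[set w | forall i, (m <= i < n)%N -> B i w] w =
  \prod_(m <= i < n) \1_(B i) w :> R.
Proof.
elim: n => [|n IH].
  by rewrite big_geq // indicE mem_set // => i /= /andP[_]; rewrite ltn0.
have [nm|mn] := ltnP n m.
  rewrite big_geq // indicE mem_set // => i /= /andP[mi iN].
  by have := leq_trans iN nm; rewrite ltnNge mi.
rewrite big_nat_recr //= -IH //.
set A := [set w | _]; set A' := [set w | _].
have -> : A = A' `&` B n.
  apply/seteqP; split => v /=.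
    move=> h; split; last by apply: h; rewrite mn ltnSn.
    by move=> i /andP[mi iN]; apply: h; rewrite mi ltnW.
  move=> [h Bn] i /andP[mi]; rewrite ltnS leq_eqVlt => /predU1P[->//|iN].
  by apply: h; rewrite mi.
by rewrite indicI.
Qed.

Section Persistence.
Context (d : measure_display) (T : measurableType d) (R : realType).
Variables (P : probability T R) (X : nat -> {RV P >-> R}) (theta a : R).
Hypothesis theta_range : -1 <= theta < 1.
Hypothesis a_gtN1 : -1 < a.
Hypothesis X_iid : iid_uniform X (ltrN1_ltNr1 a_gtN1).
Variables (lam : R) (g : R -> R).
Hypothesis lam_gt0 : 0 < lam.
Hypothesis g_cont : continuous g.
Hypothesis g_ge0 : forall x, - a <= x <= 1 -> 0 <= g x.
Hypothesis g_eigen : forall x, - a <= x <= 1 -> transfer theta a g x = lam * g x.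
Hypothesis g_core : 0 < core_mass theta a g.

Local Notation U := (distribution P (X 1%N)).
Local Notation step := (transfer theta a).
Local Notation survival n := (iter n step (fun=> 1)).

Lemma survival_continuous n : continuous (survival n).
Proof. by apply: iter_transfer_continuous => //; exact: cst_continuous. Qed.

Lemma survival_measurable n : measurable_fun setT (survival n).
Proof. exact: (continuous_measurable_fun (@survival_continuous n)). Qed.

Lemma survival_ge0 n x : 0 <= survival n x.
Proof.
by case: n => [|n] //=; apply: transfer_ge0 => // z zD; exact: iter_transfer_ge0.
Qed.

Lemma exists_positive : exists2 x, - a <= x <= 1 & 0 < g x.
Proof.
apply/not_exists2P => no_x; move: g_core; rewrite ltNge => /negP; apply.
have -> : core_mass theta a g = integ (fun=> 0) (core_bound theta a) 1.
  apply: eq_integ => x /andP[cx x1].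
  have xD : - a <= x <= 1 by rewrite (le_trans (core_bound_ge theta a) cx).
  have [//|/negP] := no_x x; rewrite -leNgt => gx.
  by apply/le_anti; rewrite gx g_ge0.
by rewrite integ_cst ?mul0r // ltW // core_bound_lt1.
Qed.

(** Comparing the eigenfunction with a constant shows that the survival
    probabilities are at least of the order of [lam ^+ n]. *)
Lemma survival_asymptotics : exists2 L, 0 < L & exists2 e : nat -> R, e @ \oo --> 0 &
  forall n x, - a <= x <= 1 ->
    `|survival n.+1 x / lam ^+ n.+1 - L * g x| <= e n * g x.
Proof.
have [L [e e0 He]] := transfer_converges theta_range a_gtN1 lam_gt0 g_cont g_ge0
  g_eigen g_core (@cst_continuous _ _ (1 : R)).
exists L; last by exists e.
have [M M0 gM] := bounded_on_segment (- a) 1 g_cont.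
have lower n x : - a <= x <= 1 -> lam ^+ n * g x <= M * survival n x.
  move=> xD; rewrite -(iter_eigen a_gtN1 g_cont g_eigen) // -iter_transferZ //; last exact: cst_continuous.
  elim: n x xD => [|n IH] x xD /=.
    by rewrite mulr1; apply: le_trans (ler_norm _) _; exact: gM.
  apply: le_transfer => //; apply: iter_transfer_continuous => //; exact: cst_continuous.
have [x xD gx0] := exists_positive.
have lowL n : M^-1 - e n <= L.
  have := He n x xD; rewrite ler_distlC => /andP[h _].
  have pl : 0 < lam ^+ n.+1 by exact: exprn_gt0.
  have : M^-1 * g x <= survival n.+1 x / lam ^+ n.+1.
    by rewrite ler_pdivlMr // -mulrA ler_pdivrMl // [leLHS]mulrC; exact: lower.
  by move=> h2; rewrite -(ler_pM2r gx0) mulrBl; lra.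
apply: lt_le_trans (_ : M^-1 <= L); first by rewrite invr_gt0.
have cv : (fun n => M^-1 - e n) @ \oo --> M^-1 - 0 by apply: cvgB => //; exact: cvg_cst.
by rewrite -[M^-1]subr0; apply: (cvgr_to_le cv); exact: nearW.
Qed.

Lemma persistence_probE n : persistence_prob X theta n =
  (a + 1)^-1 * integ (survival n) (- a) 1.
Proof.
pose J v x : R := (theta * x <= v)%R%:R.
have mJ : measurable_fun setT (fun z : R * R => J z.1 z.2).
  have -> : (fun z : R * R => J z.1 z.2) = (fun z => if theta * z.2 <= z.1 then 1 else 0).
    by apply/funext => v; rewrite /J; case: ifP.
  apply: measurable_fun_ifT => //; apply: measurable_fun_ler.
    by apply: measurable_funM => //; exact: measurable_snd.
  exact: measurable_fst.
have mX1 : measurable_fun (setT : set (past X 1)) (X 1%N : past X 1 -> R) by exact: past_X.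
have /= := @peel _ _ _ _ _ theta a a_gtN1 X_iid J setT (X 1%N) mJ (fun _ _ => ler0n _ _)
  (fun _ _ _ => I) (fun f x cf f0 _ => integral_large_jump theta X_iid x cf f0) mX1 n 0 1 (fun=> 1).
have same w i : start_at (X 1%N w) (fun j => X j w) i = X i w.
  by rewrite /start_at; case: eqP => // ->.
under eq_integral do under eq_bigr do rewrite !same.
move=> /(_ isT (measurable_cst _) (fun=> ler01) (fun _ _ => I)).
rewrite add0n => E.
pose B i := [set w | theta * X i w <= X i.+1 w].
have mB i : measurable (B i).
  have : measurable_fun setT (fun w => theta * X i w <= X i.+1 w).
    by apply: measurable_fun_ler => //; exact: measurable_funM.
  by move=> /(_ measurableT [set true]); rewrite setTI; exact.
rewrite /persistence_prob.
rewrite -[X in P X]/(\bigcap_(i in [set i | (1 <= i < n.+1)%N]) B i).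
rewrite -[X in P X]setIT -integral_indic //; last exact: bigcap_measurableType.
transitivity (fine (\int[P]_w (1 * survival n (start_at (X 1%N w) (fun j => X j w) 1))%:E)%E).
  rewrite -E; congr fine; apply: eq_integral => w _.
  rewrite mul1r mulr1 add1n -[X in (\1_X w)%:E]/([set w | forall i, (1 <= i < n.+1)%N -> B i w]).
  rewrite indic_forall; congr (_%:E); apply: eq_bigr => i _.
  by rewrite /J indicE; congr ((nat_of_bool _)%:R); apply/idP/idP; rewrite inE.
under eq_integral do rewrite mul1r same.
have -> : (\int[P]_w (survival n (X 1%N w))%:E = \int[U]_v (survival n v)%:E)%E.
  rewrite [RHS]ge0_integral_distribution //.
    by apply/measurable_EFinP; exact: survival_measurable.
  by move=> v; rewrite lee_fin survival_ge0.
(* the first variable is a jump with the whole segment in reach *)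
have ca : clamp a (- a) = - a by rewrite /clamp; have := a_gtN1; minmax_lra.
rewrite (@integral_jump _ _ _ _ _ _ a_gtN1 X_iid (survival n) (survival n) (- a)) //.
- by rewrite ca.
- exact: survival_continuous.
- exact: survival_measurable.
- exact: survival_ge0.
- by move=> v; rewrite ca => /andP[h1]; rewrite ltNge h1.
Qed.

(** Divided by [lam ^+ n], the persistence probabilities converge to a positive
    limit, which an [n]-th root does not see. *)
Lemma persistence_exponentP : persistence_exponent X theta lam.
Proof.
split => //; have [L L0 [e e0 He]] := survival_asymptotics.
pose G := (a + 1)^-1 * integ g (- a) 1.
have a1 : 0 < (a + 1)^-1 by rewrite invr_gt0; have := a_gtN1; lra.
have a_lt1 : - a < 1 by have := a_gtN1; lra.
have G0 : 0 < G.
  have [x xD gx] := exists_positive.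
  by rewrite mulr_gt0 //; apply: (integ_gt0 g_cont _ g_ge0 xD).
pose q n := persistence_prob X theta n.+1 / lam ^+ n.+1.
have qP n : `|q n - L * G| <= e n * G.
  have sc := @survival_continuous n.+1.
  have csl : continuous (fun x => (lam ^+ n.+1)^-1 * survival n.+1 x) by exact: cont_scale.
  have [lo hi] : (L - e n) * integ g (- a) 1 <= (lam ^+ n.+1)^-1 * integ (survival n.+1) (- a) 1 /\
     (lam ^+ n.+1)^-1 * integ (survival n.+1) (- a) 1 <= (L + e n) * integ g (- a) 1.
    rewrite -!integZ //; split; apply: le_integ => //; try exact: cont_scale.
      by move=> x xD; have := He n x xD; rewrite ler_distl => /andP[h _]; rewrite mulrC [_^-1 * _]mulrC; lra.
    by move=> x xD; have := He n x xD; rewrite ler_distl => /andP[_ h]; rewrite mulrC [(L + _) * _]mulrC; lra.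
  move: (ler_wpM2l (ltW a1) lo) (ler_wpM2l (ltW a1) hi); rewrite /q persistence_probE /G.
  rewrite ler_distl; set I := integ (survival _) _ _; set I' := integ g _ _ => lo' hi'.
  have -> : (a + 1)^-1 * I / lam ^+ n.+1 = (a + 1)^-1 * ((lam ^+ n.+1)^-1 * I) by rewrite -mulrA [I / _]mulrC.
  lra.
have cq : q @ \oo --> L * G := cvg_of_bound e0 qP.
have clq : (fun n => ln (q n)) @ \oo --> ln (L * G).
  by apply: (cvg_comp _ _ cq); apply: continuous_ln; rewrite mulr_gt0.
rewrite -cvg_shiftS /=.
have : (fun n => ln lam + n.+1%:R^-1 * ln (q n)) @ \oo --> ln lam + 0 * ln (L * G).
  by apply: cvgD; [exact: cvg_cst|apply: cvgM => //; exact: cvg_harmonic].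
rewrite mul0r addr0; apply: cvg_trans; apply: near_eq_cvg.
have : \forall n \near \oo, 0 < q n.
  by apply: (cvgr_gt _ cq); rewrite mulr_gt0.
apply: filterS => n qn.
have pn : 0 < persistence_prob X theta n.+1.
  by move: qn; rewrite /q pmulr_lgt0 // invr_gt0 exprn_gt0.
by rewrite /q ln_div ?posrE ?exprn_gt0 // lnXn // mulrBr -[ln lam *+ _]mulr_natl mulrA mulVf ?pnatr_eq0 // mul1r addrC subrK.
Qed.

End Persistence.

(** * Measures with a density *)

Section Density.
Context (d : measure_display) (T : measurableType d) (R : realType).
Variables (mu : {measure set T -> \bar R}) (k : T -> R).
Hypothesis mk : measurable_fun setT k.
Hypothesis k_ge0 : forall x, 0 <= k x.

(** The proofs are arguments so that the measure structure can be inferred from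
    the term. *)
Definition with_density of measurable_fun setT k & (forall x, 0 <= k x) :=
  fun B : set T => (\int[mu]_(x in B) (k x)%:E)%E.

Local Notation nu := (with_density mk k_ge0).

Let with_density0 : nu set0 = 0%E.
Proof. exact: integral_set0. Qed.

Let with_density_ge0 B : (0 <= nu B)%E.
Proof. by apply: integral_ge0 => x _; rewrite lee_fin. Qed.

Let with_density_sigma_additive : semi_sigma_additive nu.
Proof.
by apply: semi_sigma_additive_nng_induced => //; exact/measurable_EFinP.
Qed.

HB.instance Definition _ := isMeasure.Build _ _ _ nu
  with_density0 with_density_ge0 with_density_sigma_additive.

Let integral_density_indic B : measurable B ->
  (\int[nu]_x (\1_B x)%:E = \int[mu]_x (\1_B x * k x)%:E)%E.
Proof.
move=> mB; rewrite integral_indic // setIT /= /with_density integral_mkcond.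
apply: eq_integral => x _; rewrite patchE indicE; case: ifP => _ /=.
  by rewrite mul1r.
by rewrite mul0r.
Qed.

Import HBNNSimple.

Let integral_density_nnsfun (f : {nnsfun T >-> R}) :
  (\int[nu]_x (f x)%:E = \int[mu]_x (f x * k x)%:E)%E.
Proof.
under [LHS]eq_integral do rewrite fimfunE -fsumEFin//.
rewrite [LHS]ge0_integral_fsum//; last 2 first.
  - by move=> r; exact/measurable_EFinP/measurableT_comp.
  - by move=> n x _; rewrite EFinM nnfun_muleindic_ge0.
under [RHS]eq_integral.
  move=> x xD; rewrite EFinM muleC fimfunE -fsumEFin// ge0_mule_fsumr; last first.
    by move=> r; rewrite EFinM nnfun_muleindic_ge0.
  over.
rewrite [RHS]ge0_integral_fsum//; last 2 first.
  - by move=> r; apply/measurable_EFinP; apply: measurable_funM => //; exact: measurableT_comp.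
  - move=> n x _; apply: mule_ge0; first by rewrite lee_fin.
    by rewrite EFinM nnfun_muleindic_ge0.
apply: eq_fsbigr => r _.
rewrite integralZl_indic_nnsfun //= integral_density_indic //.
have [r0|r0] := leP 0 r.
  rewrite -ge0_integralZl //.
  - by apply: eq_integral => x _; rewrite -!EFinM mulrA [in RHS]mulrC.
  - by apply/measurable_EFinP; apply: measurable_funM.
  - by move=> x _; rewrite lee_fin mulr_ge0.
have -> : f @^-1` [set r] = set0.
  by apply/seteqP; split => x //= fxr; have : 0 <= f x by []; rewrite fxr leNgt r0.
by rewrite indic0 !integral0_eq ?mule0 // => x _; rewrite /= ?mul0r ?mulr0 ?mule0.
Qed.

Lemma integral_density (f : T -> \bar R) : measurable_fun setT f -> (forall x, 0 <= f x)%E ->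
  (\int[nu]_x f x = \int[mu]_x (f x * (k x)%:E))%E.
Proof.
move=> mf f0; pose f_ := nnsfun_approx measurableT mf.
transitivity (lim (\int[nu]_x (f_ n x)%:E @[n --> \oo])%E).
  rewrite -monotone_convergence//=.
  - apply: eq_integral => ? /[!inE] xD; apply/esym/cvg_lim => //=.
    exact: cvg_nnsfun_approx.
  - by move=> n; exact/measurable_EFinP/measurable_funTS.
  - by move=> n ? _; rewrite lee_fin.
  - by move=> ? _ ? ? mn; rewrite lee_fin; exact/lefP/nd_nnsfun_approx.
rewrite (_ : (fun n => \int[nu]_x (f_ n x)%:E)%E = fun n => (\int[mu]_x (f_ n x * k x)%:E)%E); last first.
  by apply/funext => n; exact: integral_density_nnsfun.
rewrite -monotone_convergence//=.
- apply: eq_integral => x /[!inE] xD; apply: cvg_lim => //=.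
  under eq_cvg do rewrite EFinM muleC.
  by rewrite muleC; apply: cvgeZl => //; exact: cvg_nnsfun_approx.
- by move=> n; apply/measurable_EFinP/measurable_funM.
- by move=> n ? _; rewrite lee_fin mulr_ge0.
- by move=> x _ m n mn; rewrite lee_fin ler_wpM2r //; exact/lefP/nd_nnsfun_approx.
Qed.

End Density.

(** * Sampling one step of the conditioned chain *)

Section Quantile.
Context (d : measure_display) (T : measurableType d) (R : realType).
Variables (P : probability T R) (X : nat -> {RV P >-> R}) (theta a : R).
Hypothesis a_gtN1 : -1 < a.
Hypothesis X_iid : iid_uniform X (ltrN1_ltNr1 a_gtN1).
Variables (lam : R) (g : R -> R).
Hypothesis lam_gt0 : 0 < lam.
Hypothesis g_cont : continuous g.
Hypothesis g_ge0 : forall x, - a <= x <= 1 -> 0 <= g x.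
Hypothesis g_eigen : forall x, - a <= x <= 1 -> transfer theta a g x = lam * g x.

Local Notation U := (distribution P (X 1%N)).
Local Notation tail s := (integ g s 1).

Let a_lt1 : - a < 1. Proof. by have := a_gtN1; lra. Qed.
Let a1_gt0 : 0 < a + 1. Proof. by have := a_gtN1; lra. Qed.

Definition tail_quantile (w : R) : R :=
  inf [set z | - a <= z <= 1 /\ tail z <= Num.max 0 w].

Lemma tail_noninc s z : - a <= s -> s <= z -> z <= 1 -> tail z <= tail s.
Proof.
move=> as_ sz z1; apply: integ_shrink => // x /andP[sx x1].
by apply: g_ge0; rewrite (le_trans as_ sx).
Qed.

Lemma tail_quantile_has_inf w : has_inf [set z | - a <= z <= 1 /\ tail z <= Num.max 0 w].
Proof.
split; last by exists (- a) => z [/andP[]].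
exists 1; split; first by rewrite lexx ltW.
by rewrite integ_empty // le_max lexx.
Qed.

Lemma tail_quantile_in w : - a <= tail_quantile w <= 1.
Proof.
have [ne lb] := tail_quantile_has_inf w; apply/andP; split.
  by apply: lb_le_inf => // z [/andP[]].
apply: ge_inf => //; split; first by rewrite lexx ltW.
by rewrite integ_empty // le_max lexx.
Qed.

(** The infimum is attained because the tail mass is continuous, so the
    quantile and the tail mass form a Galois connection. *)
Lemma tail_quantile_le w z : - a <= z <= 1 ->
  (tail_quantile w <= z) = (tail z <= Num.max 0 w).
Proof.
move=> zD; have [ne lb] := tail_quantile_has_inf w; apply/idP/idP => [qz|]; last first.
  by move=> h; apply: ge_inf.
have /andP[aq q1] := tail_quantile_in w; case/andP: zD => az z1.
apply: le_trans (tail_noninc aq qz z1) _.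
have [M M0 gM] := bounded_on_segment (- a) 1 g_cont.
apply/ler_addgt0Pr => e e0.
have eM : 0 < e / M by rewrite divr_gt0.
have [y [/andP[ay y1] yw] yq] := inf_adherent eM (tail_quantile_has_inf w).
have qy : tail_quantile w <= y by apply: ge_inf => //; split => //; rewrite ay y1.
rewrite (integ_split g_cont qy y1) addrC lerD //.
apply: le_trans (integ_le_cst (k := M) g_cont qy _) _.
  move=> x /andP[qx xy]; apply: le_trans (ler_norm _) _; apply: gM.
  by rewrite (le_trans aq qx) (le_trans xy y1).
rewrite -ler_pdivlMl // mulrC lerBlDl; exact: ltW.
Qed.

Lemma tail_quantile_noninc w w' : w <= w' -> tail_quantile w' <= tail_quantile w.
Proof.
move=> ww'; rewrite tail_quantile_le ?tail_quantile_in //.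
have : tail (tail_quantile w) <= Num.max 0 w by rewrite -tail_quantile_le ?tail_quantile_in.
by move=> h; apply: le_trans h _; rewrite ge_max !le_max lexx /= ww' orbT.
Qed.

(** Inverse transform sampling: fed with a uniform [v], this draws a point from
    the law whose density on [clamp a (theta * x), 1] is proportional to [g]. *)
Definition sampler (x v : R) : R :=
  tail_quantile ((v + a) / (a + 1) * tail (clamp a (theta * x))).

Lemma sampler_measurable : measurable_fun setT (fun z : R * R => sampler z.1 z.2).
Proof.
have mq : measurable_fun setT tail_quantile.
  by apply: nonincreasing_measurable => // w w'; exact: tail_quantile_noninc.
apply: (measurableT_comp mq); apply: measurable_funM.
  apply: measurable_funM => //; apply: measurable_funD => //; exact: measurable_snd.
have mT : measurable_fun setT (fun x => tail (clamp a (theta * x))).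
  have -> : (fun x => tail (clamp a (theta * x))) = fun x => (a + 1) * transfer theta a g x.
    by apply/funext => x; rewrite /transfer mulrA divff ?mul1r // gt_eqF.
  apply: measurable_funM => //; apply: continuous_measurable_fun; exact: transfer_continuous.
by apply: (measurableT_comp mT); exact: measurable_fst.
Qed.

(** The absolute values change nothing, as [S] confines both points to the segment;
    they make nonnegativity evident from the form. *)
Definition kernel_density (x v : R) : R :=
  \1_(S_set theta a) (v, x) * `|g v| / (lam * `|g x|).

Lemma kernel_density_ge0 x v : 0 <= kernel_density x v.
Proof. by rewrite !mulr_ge0 ?invr_ge0 ?mulr_ge0 // ltW. Qed.

Lemma kernel_density_measurable :
  measurable_fun setT (fun z : R * R => kernel_density z.1 z.2).
Proof.
have mg := continuous_measurable_fun g_cont.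
have mS : measurable_fun setT (\1_(S_set theta a) : R * R -> R).
  by apply: measurable_indic; exact: measurable_S_set.
apply: measurable_funM; last first.
  have mi : measurable_fun setT (fun x => (lam * `|g x|)^-1).
    have -> : (fun x => (lam * `|g x|)^-1) = (fun y => y `^ (-1)) \o (fun x => lam * `|g x|).
      by apply/funext => x; rewrite /= powR_inv1 // mulr_ge0 // ltW.
    apply: measurableT_comp; first exact: measurable_powR.
    by apply: measurable_funM => //; exact: measurableT_comp.
  by apply: (measurableT_comp mi); exact: measurable_fst.
apply: measurable_funM.
  apply: (@measurableT_comp _ _ _ _ _ _ _ _ (fun z : R * R => (z.2, z.1)) mS).
  by apply: measurable_fun_pair; [exact: measurable_snd|exact: measurable_fst].
apply: measurableT_comp => //; apply: measurableT_comp => //; exact: measurable_snd.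
Qed.

Lemma kernel_density_measurable2 x : measurable_fun setT (kernel_density x).
Proof. exact: (section_measurable x kernel_density_measurable). Qed.

Lemma sampler_measurable2 x : measurable_fun setT (sampler x).
Proof. exact: (section_measurable x sampler_measurable). Qed.

Section OnePoint.
Variable x : R.
Hypothesis xD : - a <= x <= 1.
Hypothesis gx_gt0 : 0 < g x.

Local Notation c := (clamp a (theta * x)).

Lemma tail_clamp : tail c = (a + 1) * (lam * g x).
Proof. by rewrite -g_eigen // /transfer mulrA divff ?mul1r // gt_eqF. Qed.

Let tail_c_gt0 : 0 < tail c.
Proof. by rewrite tail_clamp !mulr_gt0. Qed.

(** Beyond [z], both the kernel and the sampler put the share of the tail mass that
    lies past [z] and past the start of the reach of [x]. *)
Lemma kernel_ray z : (\int[U]_(v in `]z, +oo[) (kernel_density x v)%:E =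
  (tail (clamp a (Num.max (theta * x) z)) / tail c)%:E)%E.
Proof.
rewrite integral_mkcond.
have mray : measurable (`]z, +oo[%classic : set R) by [].
transitivity (\int[U]_v (\1_(`]z, +oo[%classic) v * kernel_density x v)%:E)%E.
  apply: eq_integral => v _; rewrite patchE indicE; case: ifP => _.
    by rewrite mul1r.
  by rewrite mul0r.
rewrite (@integral_jump _ _ _ _ _ _ a_gtN1 X_iid _ (fun v => (lam * g x)^-1 * `|g v|) (Num.max (theta * x) z)).
- rewrite integZ; last by move=> v; apply: continuous_comp; [exact: g_cont|exact: norm_continuous].
  rewrite (@eq_integ _ _ g); last first.
    move=> v /andP[h1 h2]; apply: ger0_norm; apply: g_ge0; rewrite h2 andbT.
    by apply: le_trans h1; have /andP[] := clamp_bounds (Num.max (theta * x) z) a_gtN1.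
  by rewrite tail_clamp [in RHS]invfM [in RHS]mulrC mulrA.
- by apply: cont_scale => v; apply: continuous_comp; [exact: g_cont|exact: norm_continuous].
- apply: measurable_funM; last exact: kernel_density_measurable2.
  exact: measurable_indic.
- by move=> v; rewrite mulr_ge0 // kernel_density_ge0.
- move=> v vc; rewrite !indicE mem_set /=; last first.
    by rewrite in_itv /= andbT; move: vc; rewrite /clamp; minmax_lra.
  rewrite mul1r /kernel_density indicE mem_set ?mul1r.
    by rewrite (gtr0_norm gx_gt0) mulrC.
  by split => //=; move: vc; rewrite /clamp; minmax_lra.
- move=> v vc; rewrite indicE; case: (boolP (_ \in _)); last by rewrite mul0r.
  rewrite inE /= in_itv /= andbT => zv; rewrite /kernel_density indicE memNset ?mul0r ?mulr0 //.
  by case=> /= _ _; move: vc zv; rewrite /clamp; minmax_lra.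
Qed.

Lemma sampler_ray z : (U (sampler x @^-1` `]z, +oo[) =
  (tail (clamp a (Num.max (theta * x) z)) / tail c)%:E)%E.
Proof.
have sD v : - a <= sampler x v <= 1 by exact: tail_quantile_in.
have [za|az] := ltP z (- a).
  have -> : clamp a (Num.max (theta * x) z) = c by rewrite /clamp; minmax_lra.
  rewrite divff ?gt_eqF //.
  have -> : sampler x @^-1` `]z, +oo[ = setT.
    rewrite -subTset => v _ /=; rewrite in_itv /= andbT.
    by apply: lt_le_trans za _; case/andP: (sD v).
  exact: probability_setT.
have [z1|z1] := leP 1 z.
  have -> : clamp a (Num.max (theta * x) z) = 1 by rewrite /clamp; minmax_lra.
  rewrite integ_empty // mul0r.
  have -> : sampler x @^-1` `]z, +oo[ = set0.
    rewrite -subset0 => v /=; rewrite in_itv /= andbT ltNge => /negP; apply.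
    by apply: le_trans z1; case/andP: (sD v).
  exact: measure0.
have zD : - a <= z <= 1 by rewrite az ltW.
have mray : measurable (sampler x @^-1` `]-oo, z]).
  by rewrite -[_ @^-1` _]setTI; apply: sampler_measurable2.
have -> : sampler x @^-1` `]z, +oo[ = ~` (sampler x @^-1` `]-oo, z]).
  by apply/seteqP; split => v /=; rewrite !in_itv /= andbT ltNge => /negP.
rewrite probability_setC //.
set rho := tail z / tail c.
have rho0 : 0 <= rho.
  apply: divr_ge0; last exact: ltW.
  by apply: integ_ge0 => y /andP[zy y1]; apply: g_ge0; rewrite (le_trans az zy).
have sle v : - a <= v -> (sampler x v <= z) = ((a + 1) * rho - a <= v).
  move=> av; rewrite tail_quantile_le // max_r; last first.
    by rewrite mulr_ge0 ?(ltW tail_c_gt0) // divr_ge0 ?(ltW a1_gt0) //; lra.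
  by rewrite -ler_pdivrMr // -/rho ler_pdivlMr // mulrC lerBlDr.
have E : U (sampler x @^-1` `]-oo, z]) = ((a + 1)^-1 * (1 - clamp a ((a + 1) * rho - a)))%:E.
  rewrite -[X in U X]setIT -integral_indic //.
  rewrite (@integral_jump _ _ _ _ _ _ a_gtN1 X_iid _ (fun=> 1) ((a + 1) * rho - a)).
  - have /andP[_ c1] := clamp_bounds ((a + 1) * rho - a) a_gtN1.
    by rewrite integ_cst // mul1r.
  - exact: cst_continuous.
  - exact: measurable_indic.
  - by [].
  - move=> v vc; rewrite indicE mem_set //= in_itv /= sle.
      by move: vc; rewrite /clamp; minmax_lra.
    by move: vc; have /andP[h _] := clamp_bounds ((a + 1) * rho - a) a_gtN1; lra.
  - move=> v vc; rewrite indicE memNset //= in_itv /= sle; last by case/andP: vc.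
    by move=> sv; move: vc; rewrite /clamp; have := a_lt1; minmax_lra.
transitivity (1 - ((a + 1)^-1 * (1 - clamp a ((a + 1) * rho - a)))%:E)%E.
  by congr (_ - _)%E; exact: E.
rewrite -EFinB; congr (_%:E).
have -> : clamp a (Num.max (theta * x) z) = Num.max c z.
  by rewrite /clamp maxAC max_minl (max_l (ltW z1)).
have /andP[ac c1] := clamp_bounds (theta * x) a_gtN1.
have an0 : a + 1 != 0 by rewrite gt_eqF.
have [cz|zc] := leP c z.
  have r1 : rho <= 1 by rewrite ler_pdivrMr // mul1r tail_noninc // ltW.
  have -> : clamp a ((a + 1) * rho - a) = (a + 1) * rho - a.
    apply: clamp_id; rewrite lerBrDr addNr mulr_ge0 ?(ltW a1_gt0) //=.
    have := ler_wpM2l (ltW a1_gt0) r1; lra.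
  by rewrite -/rho; field.
have r1 : 1 <= rho by rewrite ler_pdivlMr // mul1r tail_noninc // ltW.
have -> : clamp a ((a + 1) * rho - a) = 1.
  by apply: clamp_high; have := ler_wpM2l (ltW a1_gt0) r1; lra.
by rewrite subrr mulr0 subr0 divff // gt_eqF.
Qed.

(** Agreement on rays carries over to all Borel sets, and then to integrals. *)
Lemma sampler_integral (f : R -> \bar R) : measurable_fun setT f -> (forall v, 0 <= f v)%E ->
  (\int[U]_v f (sampler x v) = \int[U]_v (f v * (kernel_density x v)%:E))%E.
Proof.
move=> mf f0.
have mk := kernel_density_measurable2 x.
pose Q : {mfun R >-> R} := mfun_Sub (mem_set (sampler_measurable2 x)).
pose nu := with_density U mk (kernel_density_ge0 x).
rewrite -(integral_density U mk (kernel_density_ge0 x)) //.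
transitivity (\int[distribution U Q]_v f v)%E.
  by rewrite [RHS]ge0_integral_distribution.
apply: eq_measure_integral => A mA _.
apply: (@g_sigma_algebra_measure_unique _ _ _ (@RGenOInfty.G R) _
  (fun n => `](- n%:R), +oo[%classic)).
- by move=> _ [z ->].
- by move=> n; exists (- n%:R).
- rewrite -subTset => v _; exists (Num.bound `|v|) => //=; rewrite in_itv /= andbT ltrNl.
  by apply: le_lt_trans (archi_boundP (normr_ge0 v)); rewrite -normrN ler_norm.
- move=> _ _ [z ->] [z' ->]; exists (Num.max z z').
  by apply/seteqP; split => v /=; rewrite !in_itv /= !andbT gt_max => /andP.
- move=> _ [z ->]; transitivity (U (sampler x @^-1` `]z, +oo[)) => //.
  by rewrite sampler_ray -kernel_ray.
- by move=> n; apply: le_lt_trans (ltry 1); exact: probability_le1.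
- have mA' : (@measurable _ (g_sigma_algebraType (@ocitv R))) A := mA.
  by move: mA'; rewrite RGenOInfty.measurableE.
Qed.

End OnePoint.
End Quantile.

(** * The conditioned process *)

Section Chain.
Context (d : measure_display) (T : measurableType d) (R : realType).
Variables (P : probability T R) (X : nat -> {RV P >-> R}) (theta a : R).
Hypothesis theta_range : -1 <= theta < 1.
Hypothesis a_gtN1 : -1 < a.
Hypothesis X_iid : iid_uniform X (ltrN1_ltNr1 a_gtN1).
Variables (lam : R) (g : R -> R).
Hypothesis lam_gt0 : 0 < lam.
Hypothesis g_cont : continuous g.
Hypothesis g_ge0 : forall x, - a <= x <= 1 -> 0 <= g x.
Hypothesis g_eigen : forall x, - a <= x <= 1 -> transfer theta a g x = lam * g x.
Hypothesis g_core : 0 < core_mass theta a g.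
Variables (t : R) (h : R -> R) (y : R).

Local Notation E := (state_space theta t).
Local Notation U := (distribution P (X 1%N)).
Local Notation K := (reduced_kernel theta a t lam h).
Local Notation kd := (kernel_density theta a lam g).

Hypothesis E_D : forall x, E x -> - a <= x <= 1.
Hypothesis E_stable : forall x1 x2, E x1 -> - a <= x2 <= 1 -> theta * x1 < x2 -> E x2.
Hypothesis E_h : forall x, E x -> h x = g x /\ 0 < h x.
Hypothesis Ey : E y.

Lemma g_gt0 x : E x -> 0 < g x.
Proof. by move=> /E_h[<-]. Qed.

Lemma state_space_measurable : measurable E.
Proof.
have mD (s : R) : measurable (`[- s, 1]%classic : set R) by [].
have [q|nq] := pselect (theta != 0 /\ - t = theta^-1).
  have -> : E = `[- t, 1]%classic `\ (- t).
    apply/seteqP; split => x /=; rewrite in_itv /=.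
      by case=> -> h'; split => //; case: q => q1 q2; exact: h'.
    by case=> h1 h2.
  exact: measurableD.
have -> : E = `[- t, 1]%classic.
  apply/seteqP; split => x /=; rewrite in_itv /=; first by case.
  by move=> xt; split => // h1 h2; case: nq.
exact: mD.
Qed.

(** One step of the kernel never leaves the state space, so on the kernel's
    support the weights [h] and [g] agree. *)
Lemma kernelE x B : E x -> measurable B ->
  K x B = (\int[U]_v (\1_B v * kd x v)%:E)%E.
Proof.
move=> Ex mB; have mk := kernel_density_measurable2 theta a lam_gt0 g_cont x.
rewrite (integral_law X_iid); last 2 first.
- by apply/measurable_EFinP; apply: measurable_funM.
- by move=> v; rewrite lee_fin mulr_ge0 // kernel_density_ge0.
rewrite -ge0_integralZl //; last 3 first.
- by apply/measurable_funTS/measurable_EFinP; apply: measurable_funM.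
- by move=> v _; rewrite lee_fin mulr_ge0 // kernel_density_ge0.
- by rewrite lee_fin invr_ge0; have := a_gtN1; lra.
rewrite /reduced_kernel [LHS]integral_mkcond [RHS]integral_mkcond.
apply: eq_integral => v _; rewrite !patchE opprK.
have [hx gx] := E_h Ex.
have [Sv|nSv] := pselect (S_set theta a (v, x)); last first.
  have S0 : \1_(S_set theta a) (v, x) = 0 :> R by rewrite indicE memNset.
  by rewrite /kernel_density S0 !mul0r mulr0 mule0 !if_same.
have [vD _ xv] := Sv; have Ev := E_stable Ex vD xv.
have [hv gv] := E_h Ev.
have -> : v \in `[- a, 1]%classic by rewrite inE /= in_itv.
have S1 : \1_(S_set theta a) (v, x) = 1 :> R by rewrite indicE mem_set.
rewrite /kernel_density S1 in_setI (mem_set Ev) andbT.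
rewrite indicE; case: (v \in B); last by rewrite mul0r mule0.
rewrite /= -EFinM !mul1r -hx -hv !gtr0_norm // invfM [1 + a]addrC; congr (_%:E).
by rewrite mulrC -!mulrA; congr (_ * (_ * _)); rewrite mulrC.
Qed.

(** The sampler leaves the state space with probability zero only; sending it back
    to [y] keeps the chain inside surely. *)
Definition retract (s : R) : R := if s \in E then s else y.

Lemma retract_in s : E (retract s).
Proof. by rewrite /retract; case: ifP => [/set_mem|]. Qed.

Lemma retract_measurable : measurable_fun setT retract.
Proof.
apply: measurable_fun_ifT => //.
apply: (measurable_fun_bool true).
have -> : (fun s => s \in E) @^-1` [set true] = E.
  by apply/seteqP; split => s /=; [move/set_mem|move/mem_set].
by rewrite setTI; exact: state_space_measurable.
Qed.

Definition advance (x v : R) : R := retract (sampler theta a g x v).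

Lemma advance_measurable : measurable_fun setT (fun z : R * R => advance z.1 z.2).
Proof.
apply: (measurableT_comp retract_measurable).
exact: sampler_measurable.
Qed.

Lemma advance_integral x (f : R -> \bar R) : E x -> measurable_fun setT f ->
  (forall v, 0 <= f v)%E ->
  (\int[U]_v f (advance x v) = \int[U]_v (f v * (kd x v)%:E))%E.
Proof.
move=> Ex mf f0.
rewrite (@sampler_integral _ _ _ P X theta a a_gtN1 X_iid lam g lam_gt0 g_cont g_ge0 g_eigen x
  (E_D Ex) (g_gt0 Ex) (f \o retract)); last 2 first.
- exact: (measurableT_comp mf retract_measurable).
- by move=> v; exact: f0.
apply: eq_integral => v _ /=.
have [Sv|nSv] := pselect (S_set theta a (v, x)).
  have [vD _ xv] := Sv; have Ev := E_stable Ex vD xv.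
  by rewrite /retract mem_set.
by rewrite /kernel_density indicE memNset // !mul0r !mule0.
Qed.

Lemma chain_transition : transition_kernel E K.
Proof.
split=> [x Ex|B mB].
  have mA : measurable_fun setT (advance x).
    exact: (section_measurable x advance_measurable).
  pose Q : {mfun R >-> R} := mfun_Sub (mem_set mA).
  exists (distribution U Q) => [B mB|].
    rewrite kernelE //; under eq_integral do rewrite EFinM.
    rewrite -(advance_integral Ex (f := fun v => (\1_B v)%:E)) //; last first.
      by apply/measurable_EFinP.
    rewrite -[RHS]/(U (advance x @^-1` B)) -[X in U X]setIT -integral_indic //.
    have := mA measurableT B mB; rewrite setTI; exact.
  rewrite -[LHS]/(U (advance x @^-1` E)).
  have -> : advance x @^-1` E = setT by rewrite -subTset => v _; exact: retract_in.
  exact: probability_setT.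
pose F := fun z : R * R => (\1_B z.2 * kd z.1 z.2)%:E.
have mF : measurable_fun setT F.
  apply/measurable_EFinP; apply: measurable_funM; last exact: kernel_density_measurable.
  have mI : measurable_fun setT (\1_B : R -> R) by exact: measurable_indic.
  by apply: (measurableT_comp mI); exact: measurable_snd.
have F0 z : (0 <= F z)%E by rewrite lee_fin mulr_ge0 // kernel_density_ge0.
have mG := measurable_fun_fubini_tonelli_F (m2 := U) F mF F0.
apply: (eq_measurable_fun (fubini_F U F)); last exact: measurable_funTS mG.
by move=> x /[!inE] Ex; rewrite kernelE.
Qed.

Fixpoint chain (k : nat) (w : T) : R :=
  if k is j.+1 then if j is 0 then y else advance (chain j w) (X k w) else y.

Lemma chainS k w : (0 < k)%N -> chain k.+1 w = advance (chain k w) (X k.+1 w).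
Proof. by case: k. Qed.

Lemma chain_in k w : E (chain k w).
Proof. by case: k => [|[|k]] //=; exact: retract_in. Qed.

Lemma chain_past k n : (k <= n)%N ->
  measurable_fun (setT : set (past X n)) (chain k : past X n -> R).
Proof.
elim: k n => [|[|k] IH] n kn; [exact: measurable_cst|exact: measurable_cst|].
apply: (@measurableT_comp _ _ _ _ _ _ _ _
  ((fun w => (chain k.+1 w, X k.+2 w)) : past X n -> (R * R)%type) advance_measurable).
apply: measurable_fun_pair; first by apply: IH; exact: ltnW.
exact: past_X.
Qed.

Lemma chain_measurable k : measurable_fun setT (chain k).
Proof. exact: past_measurable (chain_past (leqnn k)). Qed.

Definition chainRV k : {RV P >-> R} := mfun_Sub (mem_set (chain_measurable k)).

Lemma history_past (Z : nat -> T -> R) n N :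
  (forall i, (0 < i <= n)%N -> measurable_fun (setT : set (past X N)) (Z i : past X N -> R)) ->
  measurable_fun (setT : set (past X N))
    ((fun w => [tuple Z i.+1 w | i < n]) : past X N -> n.-tuple R).
Proof.
move=> mZ; apply/measurable_fun_tnthP => i.
have -> : (fun z => tnth z i) \o (fun w => [tuple Z j.+1 w | j < n]) = Z i.+1.
  by apply/funext => w /=; rewrite tnth_mktuple.
by apply: mZ => /=.
Qed.

Lemma chain_markov : markov_chain E K y chainRV.
Proof.
split; first exact: chain_transition.
- have -> : [set w | chainRV 1 w = y] = setT by apply/seteqP; split.
  exact: probability_setT.
- move=> k _; have -> : [set w | E (chainRV k w)] = setT.
    by rewrite -subTset => w _; exact: chain_in.
  exact: probability_setT.
move=> k A B k0 mA mB; set H := [set w | _].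
have mH : measurable (H : set (past X k)).
  have mh := @history_past chain k _ (fun i iN => chain_past (proj2 (andP iN))).
  by have := mh measurableT A mA; rewrite setTI.
have mHT : measurable H := past_sub_measurable mH.
have mYB : measurable (chain k.+1 @^-1` B).
  by rewrite -[_ @^-1` _]setTI; exact: chain_measurable.
suff : P (H `&` chain k.+1 @^-1` B) = (\int[P]_(w in H) K (chain k w) B)%E by [].
rewrite -[X in P X]setIT -integral_indic //; last exact: measurableI.
pose F := fun z : (R * R) * R => (`|z.1.1| * \1_B (advance z.1.2 z.2))%:E.
have mI : measurable_fun setT (\1_B : R -> R) by exact: measurable_indic.
have mIA : measurable_fun setT (fun z : R * R => \1_B (advance z.1 z.2) : R).
  by apply: (measurableT_comp mI); exact: advance_measurable.
have mF : measurable_fun setT F.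
  apply/measurable_EFinP; apply: measurable_funM.
    apply: measurableT_comp => //.
    by apply: measurableT_comp; [exact: measurable_fst|exact: measurable_fst].
  apply: (@measurableT_comp _ _ _ _ _ _ _ _ (fun z : (R * R) * R => (z.1.2, z.2)) mIA).
  apply: measurable_fun_pair; last exact: measurable_snd.
  by apply: measurableT_comp; [exact: measurable_snd|exact: measurable_fst].
have F0 z : (0 <= F z)%E by rewrite lee_fin mulr_ge0.
have mV : measurable_fun (setT : set (past X k))
    ((fun w => (\1_H w, chain k w)) : past X k -> (R * R)%type).
  by apply: measurable_fun_pair; [exact: measurable_indic|exact: chain_past].
transitivity (\int[P]_w F ((\1_H w, chain k w), X k.+1 w))%E.
  apply: eq_integral => w _; rewrite /F /= ger0_norm // indicI /=.
  by rewrite -chainS.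
rewrite (integrate_next X_iid mV mF F0) [RHS]integral_mkcond; apply: eq_integral => w _.
rewrite patchE /F /= indicE; case: ifP => wH /=; last first.
  by rewrite integral0_eq // => v _; rewrite normr0 mul0r.
rewrite kernelE //; last exact: chain_in.
under [RHS]eq_integral do rewrite EFinM.
rewrite -(advance_integral (chain_in k w) (f := fun v => (\1_B v)%:E)) //; last first.
  exact/measurable_EFinP.
by apply: eq_integral => v _; rewrite normr1 mul1r.
Qed.


Local Notation J v x := (\1_(S_set theta a) (v, x) : R).
Local Notation x i w := (start_at y (fun j => X j w) i).
Local Notation survival n := (iter n (transfer theta a) (fun=> 1)).

Definition history (Z : nat -> T -> R) n (w : T) : n.-tuple R := [tuple Z i.+1 w | i < n].

Lemma history_rcons Z n w : history Z n.+1 w = rcons_tuple (history Z n w) (Z n.+1 w).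
Proof.
apply: eq_from_tnth => i; rewrite tnth_mktuple.
have -> : tnth (rcons_tuple (history Z n w) (Z n.+1 w)) i =
    nth 0 (rcons (history Z n w) (Z n.+1 w)) i by rewrite (tnth_nth 0).
rewrite nth_rcons size_tuple; case: (ltngtP i n) (ltn_ord i) => [iN|iN|->] // iS.
  have -> : nth 0 (history Z n w) i = tnth (history Z n w) (Ordinal iN).
    by rewrite (tnth_nth 0).
  by rewrite tnth_mktuple.
by rewrite ltnS leqNgt iN in iS.
Qed.

Lemma last_history Z n w : tnth (history Z n.+1 w) ord_max = Z n.+1 w.
Proof. by rewrite tnth_mktuple. Qed.

Lemma rcons_measurable n :
  measurable_fun setT (fun z : n.-tuple R * R => rcons_tuple z.1 z.2 : n.+1.-tuple R).
Proof.
apply/measurable_fun_tnthP => i.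
have [iN|iN] := ltnP i n.
  have -> : (fun z : n.+1.-tuple R => tnth z i) \o (fun z : n.-tuple R * R => rcons_tuple z.1 z.2) =
      fun z => tnth z.1 (Ordinal iN).
    by apply/funext => z /=; rewrite !(tnth_nth 0) /= nth_rcons size_tuple iN.
  by apply: (measurableT_comp (measurable_tnth (Ordinal iN))); exact: measurable_fst.
have -> : (fun z : n.+1.-tuple R => tnth z i) \o (fun z : n.-tuple R * R => rcons_tuple z.1 z.2) = snd.
  apply/funext => z /=; rewrite (tnth_nth 0) /= nth_rcons size_tuple ltnNge iN /=.
  by rewrite eqn_leq iN -ltnS ltn_ord.
exact: measurable_snd.
Qed.

Lemma J_measurable : measurable_fun setT (fun z : R * R => J z.1 z.2).
Proof.
have mS : measurable_fun setT (\1_(S_set theta a) : R * R -> R).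
  by apply: measurable_indic; exact: measurable_S_set.
by move=> D B mB; have := mS D B mB; congr (measurable (_ `&` _)); apply/seteqP; split=> -[].
Qed.

Lemma J_into v z : J v z != 0 -> - a <= v <= 1.
Proof.
by rewrite indicE; case: (boolP (_ \in _)) => [|_]; rewrite ?eqxx // inE => -[].
Qed.

Lemma x_past n i : (0 < i <= n)%N ->
  measurable_fun (setT : set (past X n)) ((fun w => x i w) : past X n -> R).
Proof. by apply: past_start_at; exact: measurable_cst. Qed.

Definition path_weight m w : R := \prod_(1 <= i < m.+1) J (x i.+1 w) (x i w).

Lemma path_weight_ge0 m w : 0 <= path_weight m w.
Proof. exact: prodr_ge0. Qed.

(** The state space is stable under steps that stay in [S]. *)
Lemma path_weight_in m w : path_weight m w != 0 -> E (x m.+1 w).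
Proof.
elim: m => [|m IH]; first by [].
rewrite /path_weight big_nat_recr //= mulf_eq0 negb_or => /andP[/IH Ex].
rewrite indicE; case: (boolP (_ \in _)) => [|_]; last by rewrite eqxx.
by rewrite inE => -[/= vD _ lt_v] _; exact: E_stable Ex vD lt_v.
Qed.

Lemma path_weight_past m n : (m < n)%N ->
  measurable_fun (setT : set (past X n)) (path_weight m : past X n -> R).
Proof.
move=> mn; apply: measurable_prod => i; rewrite mem_index_iota ltnS => /andP[i0 im].
apply: (@measurableT_comp _ _ _ _ _ _ _ _ (fun w : past X n => (x i.+1 w, x i w)) J_measurable).
apply: measurable_fun_pair; apply: x_past => //; first exact: leq_ltn_trans mn.
by rewrite i0 (leq_trans im) // ltnW.
Qed.

(** The density of the first [m + 1] values of the chain with respect to the walk. *)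
Definition doob_weight m w : R :=
  path_weight m w * `|g (x m.+1 w)| / (lam ^+ m * g y).

Lemma doob_weight_ge0 m w : 0 <= doob_weight m w.
Proof.
have gy := ltW (g_gt0 Ey); have l0 := ltW lam_gt0.
by rewrite divr_ge0 // mulr_ge0 ?exprn_ge0 // path_weight_ge0.
Qed.

Lemma doob_weightS m w :
  doob_weight m.+1 w = kd (x m.+1 w) (X m.+2 w) * doob_weight m w.
Proof.
rewrite /doob_weight /path_weight big_nat_recr //= -/(path_weight m w).
have [->|/path_weight_in/g_gt0 gx] := eqVneq (path_weight m w) 0.
  by rewrite !mul0r mulr0.
have gy := g_gt0 Ey.
rewrite /kernel_density -[x m.+2 w]/(X m.+2 w) exprS (gtr0_norm gx).
by field; rewrite !gt_eqF ?exprn_gt0.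
Qed.

(** The change of measure: a step of the chain weighs [g v / (lam * g x)] times
    a step of the killed walk, and these ratios telescope. *)
Lemma history_law m (phi : m.+1.-tuple R -> \bar R) : measurable_fun setT phi ->
  (forall z, 0 <= phi z)%E ->
  (\int[P]_w phi (history chain m.+1 w) =
   \int[P]_w (phi (history (fun i w => x i w) m.+1 w) * (doob_weight m w)%:E))%E.
Proof.
elim: m phi => [|m IH] phi mphi phi0.
  apply: eq_integral => w _.
  have -> : doob_weight 0 w = 1.
    rewrite /doob_weight /path_weight big_geq //= mul1r /start_at /= gtr0_norm ?g_gt0 //.
    by rewrite mul1r divff // gt_eqF // g_gt0.
  rewrite mule1; congr phi; apply: eq_from_tnth => i; rewrite !tnth_mktuple.
  by case: i => -[].
have mphi2 : measurable_fun setT (fun z : m.+1.-tuple R * R => phi (rcons_tuple z.1 z.2)).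
  exact: (measurableT_comp mphi (@rcons_measurable m.+1)).
have mlast : measurable_fun setT (fun z : m.+1.-tuple R * R => (tnth z.1 ord_max, z.2)).
  apply: measurable_fun_pair; last exact: measurable_snd.
  by apply: (measurableT_comp (measurable_tnth ord_max)); exact: measurable_fst.
have mkd : measurable_fun setT (fun z : m.+1.-tuple R * R => kd (tnth z.1 ord_max) z.2).
  exact: (measurableT_comp (kernel_density_measurable theta a lam_gt0 g_cont) mlast).
pose F (z : m.+1.-tuple R * R) := phi (rcons_tuple z.1 (advance (tnth z.1 ord_max) z.2)).
have mF : measurable_fun setT F.
  apply: (@measurableT_comp _ _ _ _ _ _ _ _
    (fun z : m.+1.-tuple R * R => (z.1, advance (tnth z.1 ord_max) z.2)) mphi2).
  apply: measurable_fun_pair; first exact: measurable_fst.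
  exact: (measurableT_comp advance_measurable mlast).
pose G (z : m.+1.-tuple R * R) := (phi (rcons_tuple z.1 z.2) * (kd (tnth z.1 ord_max) z.2)%:E)%E.
have mG : measurable_fun setT G.
  by apply: emeasurable_funM => //; exact/measurable_EFinP.
have G0 z : (0 <= G z)%E by rewrite mule_ge0 // lee_fin kernel_density_ge0.
transitivity (\int[P]_w F (history chain m.+1 w, X m.+2 w))%E.
  by apply: eq_integral => w _; rewrite history_rcons /F last_history -chainS.
have F0 z : (0 <= F z)%E by exact: phi0.
have mV0 : measurable_fun (setT : set (past X m.+1)) (history chain m.+1 : past X m.+1 -> _).
  by apply: history_past => i /andP[_ iN]; exact: chain_past.
rewrite (integrate_next X_iid mV0 mF F0).
transitivity (\int[P]_w fubini_F U G (history chain m.+1 w))%E.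
  apply: eq_integral => w _; rewrite /F /fubini_F /G /= last_history.
  rewrite (advance_integral (f := fun v => phi (rcons_tuple (history chain m.+1 w) v))) //.
    exact: chain_in.
  exact: (section_measurable _ mphi2).
rewrite IH; last 2 first.
- exact: measurable_fun_fubini_tonelli_F.
- by move=> z; apply: integral_ge0.
pose H (z : (m.+1.-tuple R * R) * R) := (`|z.1.2|%:E * G (z.1.1, z.2))%E.
have mH : measurable_fun setT H.
  apply: emeasurable_funM.
    apply/measurable_EFinP; apply: measurableT_comp => //.
    by apply: measurableT_comp; [exact: measurable_snd|exact: measurable_fst].
  apply: (measurableT_comp mG); apply: measurable_fun_pair; last exact: measurable_snd.
  by apply: measurableT_comp; [exact: measurable_fst|exact: measurable_fst].
have H0 z : (0 <= H z)%E by rewrite mule_ge0.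
have mV : measurable_fun (setT : set (past X m.+1))
    ((fun w => (history (fun i w => x i w) m.+1 w, doob_weight m w)) : past X m.+1 -> _).
  apply: measurable_fun_pair; first by apply: history_past => i; exact: x_past.
  apply: measurable_funM => //; apply: measurable_funM; first exact: path_weight_past.
  apply: measurableT_comp => //; apply: (measurableT_comp (continuous_measurable_fun g_cont)).
  by apply: x_past; rewrite leqnn.
transitivity (\int[P]_w \int[U]_v H ((history (fun i w => x i w) m.+1 w, doob_weight m w), v))%E.
  apply: eq_integral => w _; rewrite /H /= ger0_norm ?doob_weight_ge0 //.
  rewrite ge0_integralZl ?lee_fin ?doob_weight_ge0 //.
    exact: muleC.
  exact: (section_measurable _ mG).
rewrite -(integrate_next X_iid mV mH H0); apply: eq_integral => w _.
rewrite /H /G /= ger0_norm ?doob_weight_ge0 // last_history doob_weightS.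
rewrite (history_rcons (fun i w => x i w) m.+1) -[x m.+2 w]/(X m.+2 w).
set W := doob_weight m w; set k := kd _ _; rewrite [(k * W)%:E]EFinM.
by rewrite muleC -muleA.
Qed.

Definition lag_pairs m (z : m.+1.-tuple R) : m.-tuple (R * R) :=
  [tuple (tnth z (lift ord0 k), tnth z (widen_ord (leqnSn m) k)) | k < m].

Lemma lag_pairs_measurable m : measurable_fun setT (@lag_pairs m).
Proof.
apply/measurable_fun_tnthP => i.
have -> : (fun z : m.-tuple (R * R) => tnth z i) \o (@lag_pairs m) =
    fun z => (tnth z (lift ord0 i), tnth z (widen_ord (leqnSn m) i)).
  by apply/funext => z /=; rewrite tnth_mktuple.
by apply: measurable_fun_pair; exact: measurable_tnth.
Qed.

Lemma lag_pairs_history m (Z : nat -> T -> R) w :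
  [tuple lag_pair (fun i => Z i w) k.+1 | k < m] = lag_pairs (history Z m.+1 w).
Proof.
apply: eq_from_tnth => i; rewrite !tnth_mktuple /lag_pair /=.
by rewrite /bump leq0n add1n.
Qed.

Lemma killed_peel m k (c : T -> R) :
  measurable_fun (setT : set (past X m.+1)) (c : past X m.+1 -> R) ->
  (forall w, 0 <= c w) -> (forall w, c w != 0 -> - a <= x m.+1 w <= 1) ->
  (\int[P]_w (c w * \prod_(m.+1 <= i < m.+1 + k) J (x i.+1 w) (x i w))%:E =
   \int[P]_w (c w * survival k (x m.+1 w))%:E)%E.
Proof.
move=> c_past c_ge0 c_in; have mJ := J_measurable.
have jump (f : R -> R) (z : R) : continuous f -> (forall v, 0 <= f v) -> - a <= z <= 1 ->
    (\int[U]_v (J v z * f v)%:E = (transfer theta a f z)%:E)%E.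
  by move=> cf f0 zD; rewrite (@integral_strict_jump _ _ _ _ _ theta a a_gtN1 X_iid).
have J_ge0 v z : 0 <= J v z by [].
have := @peel _ _ _ _ _ theta a a_gtN1 X_iid (fun v z => J v z) [set z | - a <= z <= 1] (fun=> y)
  mJ J_ge0 J_into jump (measurable_cst _) k 0 m.+1 c isT c_past c_ge0 c_in.
by rewrite add0n => <-; apply: eq_integral => w _; rewrite /= mulr1.
Qed.

Lemma prob_indicator (S : set T) (f : T -> R) : measurable_fun setT f ->
  (forall w, \1_S w = f w) -> P S = (\int[P]_w (f w)%:E)%E.
Proof.
move=> mf Sf; have mS : measurable S.
  have -> : S = f @^-1` [set 1].
    apply/seteqP; split => w; rewrite /= -Sf indicE; first by move=> Sw; rewrite mem_set.
    by case: (boolP (w \in S)) => [/set_mem|_ /eqP] //; rewrite eq_sym oner_eq0.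
  by rewrite -[_ @^-1` _]setTI; exact: mf.
by rewrite -[in LHS](setIT S) -integral_indic //; apply: eq_integral => w _; rewrite Sf.
Qed.

Section Limit.
Variables (m : nat) (A : set (m.-tuple (R * R))).
Hypothesis mA : measurable A.

Let event (z : nat -> R) := A [tuple lag_pair z k.+1 | k < m].
Let ind w : R := \1_A (lag_pairs (history (fun i w => x i w) m.+1 w)).
Let c w : R := ind w * path_weight m w.
Let p : R := fine (P [set w | event (fun i => chainRV i w)]).

Let ind_past n : (m < n)%N ->
  measurable_fun (setT : set (past X n)) (ind : past X n -> R).
Proof.
move=> mn; have mI : measurable_fun setT (\1_A : _ -> R) by exact: measurable_indic.
apply: (measurableT_comp mI); apply: (measurableT_comp (@lag_pairs_measurable m)).
by apply: history_past => i /andP[i0 im]; apply: x_past; rewrite i0 (leq_trans im).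
Qed.

Let c_past : measurable_fun (setT : set (past X m.+1)) (c : past X m.+1 -> R).
Proof. by apply: measurable_funM; [exact: ind_past|exact: path_weight_past]. Qed.

Let c_ge0 w : 0 <= c w.
Proof. by rewrite mulr_ge0 // path_weight_ge0. Qed.

Let c_in w : c w != 0 -> - a <= x m.+1 w <= 1.
Proof. by rewrite mulf_eq0 negb_or => /andP[_ /path_weight_in/E_D]. Qed.

Let cf_measurable (f : R -> R) : continuous f -> measurable_fun setT (fun w => (c w * f (x m.+1 w))%:E).
Proof.
move=> cf; apply/measurable_EFinP; apply: measurable_funM; first exact: past_measurable c_past.
apply: (measurableT_comp (continuous_measurable_fun cf)).
by apply: (past_measurable (n := m.+1)); apply: x_past; rewrite leqnn.
Qed.

Let abs_g_cont : continuous (fun s => `|g s|).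
Proof. by move=> s; apply: continuous_comp; [exact: g_cont|exact: norm_continuous]. Qed.

Let limit_mass : (\int[P]_w (c w * `|g (x m.+1 w)|)%:E = (lam ^+ m * g y * p)%:E)%E.
Proof.
have gy := g_gt0 Ey.
have k0 : 0 < lam ^+ m * g y by rewrite mulr_gt0 ?exprn_gt0.
have mI : measurable_fun setT (\1_A : _ -> R) by exact: measurable_indic.
have mphi : measurable_fun setT (fun z : m.+1.-tuple R => (\1_A (lag_pairs z))%:E : \bar R).
  by apply/measurable_EFinP; exact: (measurableT_comp mI (@lag_pairs_measurable m)).
have phi0 (z : m.+1.-tuple R) : (0 <= (\1_A (lag_pairs z))%:E :> \bar R)%E by [].
have := history_law mphi phi0.
have mhc : measurable_fun setT (history chain m.+1).
  by apply: (past_measurable (n := m.+1)); apply: history_past => i /andP[_ iN]; exact: chain_past.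
have mev : measurable [set w | event (fun i => chainRV i w)].
  have := measurableT_comp (@lag_pairs_measurable m) mhc.
  move=> /(_ measurableT A mA); rewrite setTI; congr (measurable _).
  by apply/seteqP; split => w; rewrite /= /event -lag_pairs_history.
have -> : (\int[P]_w (\1_A (lag_pairs (history chain m.+1 w)))%:E = p%:E)%E.
  rewrite /p fineK ?fin_num_measure // -[X in P X]setIT -integral_indic //.
  by apply: eq_integral => w _; rewrite -lag_pairs_history !indicE; congr (_%:E); congr ((nat_of_bool _)%:R).
move=> pE; rewrite EFinM pE -ge0_integralZl //; last 3 first.
- apply/measurable_EFinP; apply: measurable_funM.
    by apply: (past_measurable (n := m.+1)); exact: ind_past.
  apply: (past_measurable (n := m.+1)); apply: measurable_funM => //; apply: measurable_funM.
    exact: path_weight_past.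
  apply: measurableT_comp => //; apply: (measurableT_comp (continuous_measurable_fun g_cont)).
  by apply: x_past; rewrite leqnn.
- by move=> w _; rewrite mule_ge0 ?lee_fin // doob_weight_ge0.
- by rewrite lee_fin ltW.
apply: eq_integral => w _; rewrite -!EFinM; congr (_%:E).
rewrite /doob_weight /c -/(ind w).
by field; rewrite !gt_eqF ?exprn_gt0.
Qed.

Let indicator_start n (C : set (nat -> R)) :
  (forall w, (\1_[set w | (C `&` Omega theta a n) (start_at y (fun i => X i w))] w : R) =
     \1_[set w | C (start_at y (fun i => X i w))] w * path_weight n w).
Proof.
move=> w; rewrite /path_weight.
have -> : [set w | (C `&` Omega theta a n) (start_at y (fun i => X i w))] =
   [set w | C (start_at y (fun i => X i w))] `&`
   [set w | forall i, (1 <= i < n.+1)%N -> [set w | S_set theta a (x i.+1 w, x i w)] w].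
  apply/seteqP; split => v [Cv Ov]; split => // i /andP[i1 iN].
    by have := Ov i; rewrite i1 -ltnS iN => /(_ isT); case: i i1 {iN}.
  by have := Ov i; rewrite i1 ltnS iN => /(_ isT); case: i i1 {iN}.
by rewrite indicI /= indic_forall; congr (_ * _).
Qed.

Let survival_peel k : (\int[P]_w (ind w * path_weight (m + k) w)%:E =
  \int[P]_w (c w * survival k (x m.+1 w))%:E)%E.
Proof.
rewrite -(killed_peel k c_past c_ge0 c_in); apply: eq_integral => w _.
rewrite /c -mulrA; congr ((_ * _)%:E).
by rewrite /path_weight -addSn (big_cat_nat _ (n := m.+1)) //= ?leq_addr.
Qed.

Let numerator k : prob_start X y (event `&` Omega theta a (m + k)%N) =
  fine (\int[P]_w (c w * survival k (x m.+1 w))%:E).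
Proof.
rewrite -survival_peel /prob_start; congr fine; apply: prob_indicator.
  apply: measurable_funM.
    by apply: (past_measurable (n := m.+1)); exact: ind_past.
  by apply: (past_measurable (n := (m + k).+1)); exact: path_weight_past.
move=> w; rewrite indicator_start; congr (_ * _).
by rewrite /ind -lag_pairs_history.
Qed.

Let denominator n : prob_start X y (Omega theta a n) = survival n y.
Proof.
transitivity (fine (\int[P]_w (path_weight n w)%:E)).
  congr fine; apply: prob_indicator.
    by apply: (past_measurable (n := n.+1)); exact: path_weight_past.
  move=> w; have := indicator_start n setT w; rewrite setTI => ->.
  by rewrite indicE mem_set // mul1r.
have := @killed_peel 0 n (fun=> 1) (measurable_cst _) (fun=> ler01) (fun _ _ => E_D Ey).
under eq_integral do rewrite mul1r.
rewrite -[X in fine X]/(\int[P]_w (\prod_(1 <= i < 1 + n) J (x i.+1 w) (x i w))%:E)%E => ->.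
under eq_integral do rewrite mul1r.
rewrite -[X in fine X]/(\int[P]_w cst (survival n y)%:E w)%E integral_cst //.
transitivity (fine ((survival n y)%:E * 1)%E); last by rewrite mule1.
by congr (fine (_ * _)%E); exact: probability_setT.
Qed.

(** Integrating out the last steps leaves the survival probability from the
    [m + 1]-st value, which is asymptotic to a multiple of [g]. The powers of [lam]
    and the multiple cancel in the quotient, and the remaining weight is that of
    [history_law]. *)
Lemma conditioned_limit :
  (fun n => cond_prob_start X y event (Omega theta a n)) @ \oo --> p.
Proof.
have gy := g_gt0 Ey.
have [L L0 [e e0 He]] := survival_asymptotics theta_range a_gtN1 lam_gt0 g_cont g_ge0 g_eigen g_core.
have e_ge0 j : 0 <= e j.
  have := He j y (E_D Ey); rewrite -[_ <= e j * _]/(_ <= _) => h0.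
  by have := le_trans (normr_ge0 _) h0; rewrite pmulr_lge0.
pose i0 := lam ^+ m * g y * p.
have p0 : 0 <= p by apply: fine_ge0.
have i00 : 0 <= i0 by rewrite !mulr_ge0 ?exprn_ge0 // ltW.
pose num j := fine (\int[P]_w (c w * survival j.+1 (x m.+1 w))%:E).
have bounds j : (L - e j) * i0 <= num j / lam ^+ j.+1 <= (L + e j) * i0.
  have lj : 0 < lam ^+ j.+1 by exact: exprn_gt0.
  have ms := cf_measurable (@survival_continuous R theta a a_gtN1 j.+1).
  have mg := cf_measurable abs_g_cont.
  have s0 w : (0 <= (c w * survival j.+1 (x m.+1 w))%:E)%E.
    by rewrite lee_fin mulr_ge0 // survival_ge0.
  have g0 w : (0 <= (c w * `|g (x m.+1 w)|)%:E)%E by rewrite lee_fin mulr_ge0.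
  have pw w : lam ^+ j.+1 * (L - e j) * (c w * `|g (x m.+1 w)|) <= c w * survival j.+1 (x m.+1 w)
       <= lam ^+ j.+1 * (L + e j) * (c w * `|g (x m.+1 w)|).
    have [->|/c_in xD] := eqVneq (c w) 0; first by rewrite !mul0r !mulr0 lexx.
    have := He j _ xD; rewrite ler_distl (ger0_norm (g_ge0 xD)) => /andP[h1 h2].
    set s := survival _ _ in h1 h2 *; set G := g _ in h1 h2 *.
    have -> : c w * s = lam ^+ j.+1 * (c w * (s / lam ^+ j.+1)) by field; rewrite gt_eqF.
    have perm r : lam ^+ j.+1 * r * (c w * G) = lam ^+ j.+1 * (c w * (r * G)) by ring.
    by rewrite !perm; apply/andP; split; apply/ler_wpM2l/ler_wpM2l => //; [exact: ltW|lra|exact: ltW|lra].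
  have up : (\int[P]_w (c w * survival j.+1 (x m.+1 w))%:E <= (lam ^+ j.+1 * (L + e j) * i0)%:E)%E.
    rewrite [X in (_ <= X)%E]EFinM -limit_mass -ge0_integralZl ?lee_fin //; last first.
      by rewrite mulr_ge0 ?addr_ge0 // ltW.
    apply: ge0_le_integral => //; first exact: emeasurable_funM.
    by move=> w _; rewrite -EFinM lee_fin; case/andP: (pw w).
  have nfin : (\int[P]_w (c w * survival j.+1 (x m.+1 w))%:E)%E \is a fin_num.
    by rewrite ge0_fin_numE ?(le_lt_trans up) ?ltry //; apply: integral_ge0.
  have up' : num j <= lam ^+ j.+1 * (L + e j) * i0 by rewrite -lee_fin fineK.
  rewrite ler_pdivrMr // mulrAC [(L + e j) * _]mulrC up' andbT.
  rewrite ler_pdivlMr //.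
  have [neg|pos] := leP (L - e j) 0.
    apply: (@le_trans _ _ 0); first by rewrite !mulr_le0_ge0 // ltW.
    by apply: fine_ge0; apply: integral_ge0.
  rewrite -lee_fin fineK // mulrAC [_ * lam ^+ _]mulrC EFinM -limit_mass -ge0_integralZl ?lee_fin //; last first.
    by rewrite mulr_ge0 // ltW.
  apply: ge0_le_integral => //.
  - by move=> w _; rewrite mule_ge0 // lee_fin mulr_ge0 // ltW.
  - exact: emeasurable_funM.
  by move=> w _; rewrite -EFinM lee_fin; case/andP: (pw w).
have cnum : (fun j => num j / lam ^+ j.+1) @ \oo --> L * i0.
  apply: (squeeze_cvgr (f := fun j => (L - e j) * i0) (h := fun j => (L + e j) * i0)).
  - exact: nearW.
  - rewrite -[X in X * i0]subr0; apply: cvgM; last exact: cvg_cst.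
    by apply: cvgB => //; exact: cvg_cst.
  - rewrite -[X in X * i0]addr0; apply: cvgM; last exact: cvg_cst.
    by apply: cvgD => //; exact: cvg_cst.
pose q n := survival n.+1 y / lam ^+ n.+1.
have cq : q @ \oo --> L * g y := cvg_of_bound e0 (fun n => He n y (E_D Ey)).
rewrite -(cvg_shiftn m.+1) /=.
have -> : p = (L * i0) / (lam ^+ m * (L * g y)).
  by rewrite /i0; field; rewrite !gt_eqF ?exprn_gt0.
have -> : (fun n => cond_prob_start X y event (Omega theta a (n + m.+1))) =
    (fun j => (num j / lam ^+ j.+1) / (lam ^+ m * q (j + m)%N)).
  apply/funext => j; rewrite /cond_prob_start denominator addnC addSnnS numerator /num /q.
  rewrite [(j + m)%N]addnC -addnS exprD; set s := survival _ y; set I := fine _.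
  have [->|s0] := eqVneq s 0; first by rewrite !mul0r invr0 !mulr0 invr0 mulr0.
  by field; rewrite s0 gt_eqF ?exprn_gt0 // gt_eqF ?exprn_gt0 // gt_eqF.
apply: cvgM => //; apply: cvgV; first by rewrite mulf_neq0 ?mulf_neq0 ?gt_eqF ?exprn_gt0.
apply: cvgM; first exact: cvg_cst.
by rewrite (cvg_shiftn m q).
Qed.

End Limit.
End Chain.

Theorem theorem1p2 (R : realType) (d : measure_display) (T : measurableType d)
    (P : probability T R) (X : nat -> {RV P >-> R}) (theta a : R)
    (theta_range : -1 <= theta < 1) (a_gtN1 : -1 < a)
    (X_iid : iid_uniform X (ltrN1_ltNr1 a_gtN1))
    (r : region) (reg : in_region r theta a) :
  exists (lambda : R) (h : R -> R),
    [/\ persistence_exponent X theta lambda,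
        lambda_spec r theta a lambda,
        h_spec r theta a lambda h &
        forall y : R, state_space theta (region_t r theta a) y ->
        exists (d' : measure_display) (T' : measurableType d')
               (P' : probability T' R) (Y : nat -> {RV P' >-> R}),
          markov_chain (state_space theta (region_t r theta a))
            (reduced_kernel theta a (region_t r theta a) lambda h) y Y /\
          forall (m : nat) (A : set (m.-tuple (R * R))), measurable A ->
            (fun n : nat => cond_prob_start X y
               [set x | A [tuple lag_pair x k.+1 | k < m]] (Omega theta a n))
              @ \oo -->
            fine (P' [set w |
              A [tuple lag_pair (fun i => Y i w) k.+1 | k < m]])].
Proof.
have [lam [h [lamE hE [g [lam0 g_cont g_ge0 g_eigen g_core] hg]]]] :=
  region_spectra theta_range a_gtN1 reg.
have geo := geometryP theta_range a_gtN1 reg.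
exists lam, h; split => //; first exact: (persistence_exponentP theta_range X_iid lam0 g_cont).
move=> y Ey; exists d, T, P.
have E_D x : state_space theta (region_t r theta a) x -> - a <= x <= 1.
  by case=> /andP[tx x1] _; rewrite x1 andbT; apply: le_trans tx; rewrite lerN2 (geom_le geo).
exists (chainRV X theta a_gtN1 g_cont g_ge0 (region_t r theta a) y); split.
  exact: (chain_markov X_iid lam0 g_cont g_ge0 g_eigen E_D (geom_stable geo) hg Ey).
move=> m A mA.
exact: (conditioned_limit theta_range X_iid lam0 g_eigen g_core E_D (geom_stable geo) hg Ey mA).
Qed.
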